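(* Let $H=A+W$ be a real symmetric random matrix satisfying the model assumptions (A1)--(A4) of the context. Let $\epsilon_0\in(0,1/2)$ be a small constant, $E_0\in\mathbb{R}$ fixed with $\rho(E_0)\ge\epsilon_0$, $\eta_*=N^{-100}$, and let $\beta_*$ be the threshold fixed in the context. Consider a (small) constant $\hat\epsilon\in(0,\beta_*/3)$ such that $[E_0-\hat\epsilon,E_0+\hat\epsilon]\subset\{E\in\mathbb{R}:\rho(E)\ge\epsilon_0/2\}$, and a small constant $\delta\in(0,1)$. Then for $x,y\in[E_0-\hat\epsilon,E_0+\hat\epsilon]$ with $|x-y|\ge N^\delta\eta_*$, $$\partial_w\operatorname{Tr}\big(M'(z)M^{-1}(z)V(z,w)\big)\Big|_{z=x\pm\mathrm{i}\eta_*,\ w=y\mp\mathrm{i}\eta_*}=-\frac1{(x-y)^2}\big(1+O(\hat\epsilon)\big)$$ (for both choices of sign), where the implicit constant in $O(\hat\epsilon)$ is independent of $x$ and $y$.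
   Context: Notation. $[N]=\{1,\dots,N\}$; Greek letters $\alpha$ denote index pairs in $[N]^2$, and a pair $(i,j)$ is written $ij$. $E^{jb}$ is the matrix unit with entry $1$ at $(j,b)$. $\langle X\rangle=N^{-1}\operatorname{Tr}X$, $\|X\|$ is the operator norm, $\|X\|_{\mathrm{hs}}=\langle X^*X\rangle^{1/2}$. $\mathcal C_{A,B}[X]=AXB$ on $\mathbb{C}^{N\times N}$, $1$ is the identity operator. Statements are asymptotic ($N$ sufficiently large); implicit constants depend only on the model parameters (the constants in (A1)--(A4)) and on fixed $N$-independent parameters such as $\epsilon_0$. Model. For every $N$, $H=A+W$ is a real symmetric $N\times N$ matrix with $A$ deterministic and $W$ random, $\mathbb{E}W=0$. $\kappa(\alpha_1,\dots,\alpha_k)$ is the joint cumulant of $\sqrt N W_{\alpha_1},\dots,\sqrt N W_{\alpha_k}$. The constants below are positive and independent of $N$. (A1) $\|A\|\le C_A$. (A2) For every integer $p\ge2$, $\mathbb{E}|\sqrt N W_\alpha|^p\le\nu_p$ for all $\alpha$ and $N$. (A3)(i) For every $k\ge2$, the operator norm of the $N^2\times N^2$ matrix with $(\alpha,\alpha')$ entry $\sum_{\alpha_1,\dots,\alpha_{k-2}}|\kappa(\alpha_1,\dots,\alpha_{k-2},\alpha,\alpha')|$ is at most $C_k$. (ii) $\kappa(\alpha_1,\alpha_2)=\kappa_c(\alpha_1,\alpha_2)+\kappa_d(\alpha_1,\alpha_2)$, where there are positive $C_{r,s},D_{r,s}$ ($r,s$ integers, $|r|,|s|\le N/2$) with $\max_{a,x}|\kappa_c(xa,(a+s)(x+r))|\le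 C_{r,s}$, $\sum_{r,s}C_{r,s}\le C_2'$, $\max_{a,x}|\kappa_d(xa,(x+r)(a+s))|\le D_{r,s}$, $\sum_{r,s}D_{r,s}\le C_2''$ (shifted indices modulo $N$ with representatives in $[N]$), and $\kappa_d(aj,bk)=\kappa_c(aj,kb)$. (iii) $N^{-3/2}\sup\sum|\kappa(a_1b_1,a_2b_2,a_3b_3)||X_{b_1a_2}||Y_{b_2a_3}||Z_{b_3a_1}|\le C_3'$, sum over all $a_i,b_i\in[N]$, supremum over $X,Y,Z\in\mathbb{C}^{N\times N}$ with $\|X\|,\|Y\|\le1$, $\|Z\|_{\mathrm{hs}}\le1$. (iv) There is $\mu>0$ such that for every $\alpha\in[N]^2$ there is $\mathcal N(\alpha)\subset[N]^2$ with $|\mathcal N(\alpha)|\le N^{1/2-\mu}$ and $W_\alpha$ independent of the family $(W_\beta)_{\beta\notin\mathcal N(\alpha)}$. (A4) $N\,\mathbb{E}[|\operatorname{Tr}(WX)|^2]\ge c_{\mathrm{full}}\operatorname{Tr}(X^2)$ for every deterministic real symmetric $X$. $\mathcal S[X]=\mathbb{E}[WXW]$. For $z\in\mathbb{C}\setminus\mathbb{R}$, $M(z)$ is the unique solution of $-M^{-1}(z)=z-A+\mathcal S[M(z)]$ with $\operatorname{Im}z\cdot\operatorname{Im}M(z)>0$, $\operatorname{Im}M=(M-M^* )/(2\mathrm{i})$; $M'(z)=\partial_zM(z)$; $\rho(E)=\lim_{\eta\downarrow0}\frac1\pi\langle\operatorname{Im}M(E+\mathrm{i}\eta)\rangle$.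 Stability operator. $\mathcal B_{z,w}=1-\mathcal C_{M(z),M(w)}\mathcal S$, and $V_{ij}(z,w)=\sum_b\big(\mathcal B_{z,w}^{-1}\mathcal C_{M(z),M(w)}\mathcal S[E^{jb}]\big)_{ib}$. Thresholds: $\beta_*,\epsilon_*>0$ are small constants of order one (depending on model parameters and $\epsilon_0$ only), $\epsilon_*<1/3$, fixed (by a known result) such that whenever $\rho(\operatorname{Re}z),\rho(\operatorname{Re}w)\ge\epsilon_0/2$, $|\operatorname{Im}z|,|\operatorname{Im}w|\in(0,100)$, $\operatorname{Im}z\operatorname{Im}w<0$ and $|z-w|\le\beta_*$: the norms of $(\zeta-\mathcal B_{z,w})^{-1}$ induced by $\|\cdot\|$ and by $\|\cdot\|_{\mathrm{hs}}$ are bounded by a constant for all $\zeta\in\mathbb{C}$ with $|\zeta|\ge\epsilon_*$, $|1-\zeta|\ge1-2\epsilon_*$, and the disk of radius $\epsilon_*$ around $0$ contains exactly one eigenvalue of $\mathcal B_{z,w}$, of algebraic multiplicity one. *)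

(* Defs.v *)
From HB Require Import structures.
From mathcomp Require Import all_boot all_order all_algebra.
From mathcomp Require Import all_classical all_reals all_analysis.
From mathcomp Require Export complex.

Set Implicit Arguments.
Unset Strict Implicit.
Unset Printing Implicit Defensive.

Import Order.TTheory GRing.Theory Num.Theory.
Import numFieldNormedType.Exports.

Local Open Scope classical_set_scope.
Local Open Scope complex_scope.
Local Open Scope ring_scope.

Section Matrices.
Variable R : realType.
Implicit Types N : nat.

Definition cabs (z : R[i]) : R := Normc.normc z.

Definition cmx m n (X : 'M[R]_(m, n)) : 'M[R[i]]_(m, n) :=
  map_mx (real_complex R) X.

Definition adjmx m n (X : 'M[R[i]]_(m, n)) : 'M[R[i]]_(n, m) :=
  (map_mx (@conjc R) X)^T.

Definition ntr N (X : 'M[R[i]]_N) : R[i] := N%:R^-1 * \tr X.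

Definition l2norm N (v : 'cV[R[i]]_N) : R :=
  Num.sqrt (\sum_i cabs (v i 0) ^+ 2).

(* Not the library's norm `|X|, which is the maximum of the entries. *)
Definition opnorm N (X : 'M[R[i]]_N) : R :=
  sup [set l2norm (X *m v) | v in [set v | l2norm v <= 1]].

Definition hsnorm N (X : 'M[R[i]]_N) : R :=
  Num.sqrt (complex.Re (ntr (adjmx X *m X))).

Definition immx N (X : 'M[R[i]]_N) : 'M[R[i]]_N :=
  (2 * 'i)^-1 *: (X - adjmx X).

(* In R[i], 0 < c means that c is real and positive. *)
Definition posdefmx N (X : 'M[R[i]]_N) : Prop :=
  forall v : 'cV[R[i]]_N, v != 0 -> 0 < (adjmx v *m X *m v) 0 0.

(* Linear operators on N x N matrices are given as functions; [lin_mx T] is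
   the matrix of T acting from the right on [mxvec X].  The operators used
   below are linear, so that the suprema are over bounded sets. *)
Definition sop_norm N (nrm : 'M[R[i]]_N -> R) (T : 'M[R[i]]_N -> 'M[R[i]]_N)
    : R :=
  sup [set nrm (T X) | X in [set X | nrm X <= 1]].

Definition sop_invertible N (T : 'M[R[i]]_N -> 'M[R[i]]_N) : bool :=
  lin_mx T \in unitmx.

Definition sop_inv N (T : 'M[R[i]]_N -> 'M[R[i]]_N) (X : 'M[R[i]]_N)
    : 'M[R[i]]_N :=
  vec_mx (mxvec X *m invmx (lin_mx T)).

Definition sandwich N (A B X : 'M[R[i]]_N) : 'M[R[i]]_N := A *m X *m B.

End Matrices.

Section Probability.
Context (R : realType) (d : measure_display) (Omega : measurableType d).
Variable P : probability Omega R.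

(* Joint cumulant of X_0, ..., X_(k-1), by the moment-cumulant formula. *)
Definition joint_cumulant k (X : 'I_k -> Omega -> R) : R :=
  \sum_(p : {set {set 'I_k}} | finset.partition p [set: 'I_k]%SET)
    (-1) ^+ #|p|.-1 * (#|p|.-1)`!%:R *
    \prod_(B in p) fine ('E_P[fun t => (\prod_(i in B) X i t)%R])%E.

(* X is independent of the family (Y_i) for i in I, i.e. of the sigma-algebra
   which that family generates. *)
Definition indep_of_family (T : Type) (X : Omega -> R) (I : set T)
    (Y : T -> Omega -> R) : Prop :=
  forall U V : set Omega,
    preimage_set_system setT X measurable U ->
    <<s \bigcup_(i in I) preimage_set_system setT (Y i) measurable >> V ->
    P (U `&` V) = (P U * P V)%E.

Definition cexpect (X : Omega -> R[i]) : R[i] :=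
  Complex (fine ('E_P[fun t => complex.Re (X t)])%E)
          (fine ('E_P[fun t => complex.Im (X t)])%E).

End Probability.

Section Model.
Variable R : realType.

Record model_params := ModelParams {
  C_A : R;
  nu : nat -> R;
  C_kappa : nat -> R;
  C_cross : int -> int -> R;
  D_direct : int -> int -> R;
  C2' : R;
  C2'' : R;
  C3' : R;
  mu : R;
  c_full : R;
  C_A_gt0 : 0 < C_A;
  nu_gt0 : forall q, (2 <= q)%N -> 0 < nu q;
  C_kappa_gt0 : forall k, (2 <= k)%N -> 0 < C_kappa k;
  C_cross_gt0 : forall r s, 0 < C_cross r s;
  D_direct_gt0 : forall r s, 0 < D_direct r s;
  C2'_gt0 : 0 < C2';
  C2''_gt0 : 0 < C2'';
  C3'_gt0 : 0 < C3';
  mu_gt0 : 0 < mu;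
  c_full_gt0 : 0 < c_full }.

Definition pair_ix (N : nat) : finType := ('I_N * 'I_N)%type.

(* The integers r with |r| <= N / 2. *)
Definition shifts (N : nat) : seq int :=
  [seq k%:Z - (N./2)%:Z | k <- iota 0 (N./2).*2.+1].

Definition is_shift (N : nat) (a : 'I_N) (s : int) (b : 'I_N) : Prop :=
  ((b : nat)%:Z = (a : nat)%:Z + s %[mod N%:Z])%Z.

Section FixedSize.
Variable N : nat.
Context (d : measure_display) (Omega : measurableType d).
Variable P : probability Omega R.
Variable A : 'M[R]_N.
Variable W : pair_ix N -> {RV P >-> R}.

Definition Wmx (t : Omega) : 'M[R]_N := \matrix_(i, j) W (i, j) t.

Definition kappa (s : seq (pair_ix N)) : R :=
  joint_cumulant P
    (fun (i : 'I_(size s)) t => Num.sqrt N%:R * W (tnth (in_tuple s) i) t).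

Definition kappa_abs_mx (k : nat) : 'M[R]_#|pair_ix N| :=
  \matrix_(u, v) \sum_(t : (k - 2).-tuple (pair_ix N))
                    `|kappa (t ++ [:: enum_val u; enum_val v])|.

Definition kappa2_decomposition (p : model_params)
    (kc kd : pair_ix N -> pair_ix N -> R) : Prop :=
  [/\ forall al al', kappa [:: al; al'] = kc al al' + kd al al',
      forall (x a y b : 'I_N) (r s : int), r \in shifts N -> s \in shifts N ->
        is_shift x r y -> is_shift a s b ->
        `|kc (x, a) (b, y)| <= C_cross p r s /\
        `|kd (x, a) (y, b)| <= D_direct p r s,
      \sum_(r <- shifts N) \sum_(s <- shifts N) C_cross p r s <= C2' p,
      \sum_(r <- shifts N) \sum_(s <- shifts N) D_direct p r s <= C2'' p &
      forall a j b k : 'I_N, kd (a, j) (b, k) = kc (a, j) (k, b)].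

Definition kappa3_sum (X Y Z : 'M[R[i]]_N) : R :=
  \sum_(u1 : pair_ix N) \sum_(u2 : pair_ix N) \sum_(u3 : pair_ix N)
    `|kappa [:: u1; u2; u3]| *
    cabs (X u1.2 u2.1) * cabs (Y u2.2 u3.1) * cabs (Z u3.2 u1.1).

Record model (p : model_params) : Prop := Model {
  A_sym : A^T = A;
  W_sym : forall i j t, W (i, j) t = W (j, i) t;
  W_centered : forall al, ('E_P[W al] = 0)%E;
  A1 : opnorm (cmx A) <= C_A p;
  A2 : forall q, (2 <= q)%N -> forall al,
    ('E_P[fun t => (`|Num.sqrt N%:R * W al t| ^+ q)%R] <= (nu p q)%:E)%E;
  A3i : forall k, (2 <= k)%N -> opnorm (cmx (kappa_abs_mx k)) <= C_kappa p k;
  A3ii : exists kc kd, kappa2_decomposition p kc kd;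
  A3iii : forall X Y Z : 'M[R[i]]_N,
    opnorm X <= 1 -> opnorm Y <= 1 -> hsnorm Z <= 1 ->
    N%:R `^ (- (3 / 2)) * kappa3_sum X Y Z <= C3' p;
  A3iv : forall al, exists nbh : {set pair_ix N},
    #|nbh|%:R <= N%:R `^ (1 / 2 - mu p) /\
    indep_of_family P (W al) [set be | be \notin nbh] W;
  A4 : forall X : 'M[R]_N, X^T = X ->
    ((c_full p * \tr (X *m X))%:E <=
     N%:R%:E * 'E_P[fun t => (`|\tr (Wmx t *m X)| ^+ 2)%R])%E }.

Definition covS (X : 'M[R[i]]_N) : 'M[R[i]]_N :=
  \matrix_(i, j) cexpect P (fun t => (cmx (Wmx t) *m X *m cmx (Wmx t)) i j).

Definition mde_solution (z : R[i]) (Mz : 'M[R[i]]_N) : Prop :=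
  [/\ Mz \in unitmx,
      - invmx Mz = z%:M - cmx A + covS Mz &
      posdefmx ((complex.Im z)%:C *: immx Mz)].

Definition is_mde_M (M : R[i] -> 'M[R[i]]_N) : Prop :=
  forall z, complex.Im z != 0 -> unique (mde_solution z) (M z).

Variable M : R[i] -> 'M[R[i]]_N.

Definition dM (z : R[i]) : 'M[R[i]]_N :=
  \matrix_(i, j) derive1 (fun u : R[i] => M u i j : (R[i])^o) z.

Definition rho (E : R) : R :=
  lim (pi^-1 * complex.Re (ntr (immx (M (Complex E eta)))) @[eta --> 0^'+]).

Definition stabB (z w : R[i]) (X : 'M[R[i]]_N) : 'M[R[i]]_N :=
  X - sandwich (M z) (M w) (covS X).

Definition V (z w : R[i]) : 'M[R[i]]_N :=
  \matrix_(i, j) \sum_b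
    (sop_inv (stabB z w) (sandwich (M z) (M w) (covS (delta_mx j b)))) i b.

Definition stability_thresholds (eps0 beta_s eps_s K : R) : Prop :=
  forall z w : R[i],
    eps0 / 2 <= rho (complex.Re z) -> eps0 / 2 <= rho (complex.Re w) ->
    0 < `|complex.Im z| < 100 -> 0 < `|complex.Im w| < 100 ->
    complex.Im z * complex.Im w < 0 -> cabs (z - w) <= beta_s ->
    (forall zeta : R[i], eps_s <= cabs zeta -> 1 - 2 * eps_s <= cabs (1 - zeta) ->
       let T := fun X => zeta *: X - stabB z w X in
       [/\ sop_invertible T,
           sop_norm (@opnorm R N) (sop_inv T) <= K &
           sop_norm (@hsnorm R N) (sop_inv T) <= K]) /\
    (exists lambda : R[i],
       unique (fun l => cabs l < eps_s /\ eigenvalue (lin_mx (stabB z w)) l)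
         lambda /\
       mup lambda (char_poly (lin_mx (stabB z w))) = 1%N).

Definition traceV (z w : R[i]) : R[i] :=
  \tr (dM z *m invmx (M z) *m V z w).

End FixedSize.
End Model.

(* Main.v *)
Require Import Defs.
From HB Require Import structures.
From mathcomp Require Import all_boot all_order all_algebra.
From mathcomp Require Import all_classical all_reals all_analysis.
From mathcomp Require Import measurable_realfun spectral ring lra.

Set Implicit Arguments.
Unset Strict Implicit.
Unset Printing Implicit Defensive.

Import Order.TTheory GRing.Theory Num.Theory.
Import numFieldNormedType.Exports.

Local Open Scope classical_set_scope.
Local Open Scope complex_scope.
Local Open Scope ring_scope.

(** The trace in question is the logarithmic derivative of the stability operator
    [B = 1 - C_(M(z),M(w)) S] in the direction [M'(z)]: the sum over one index in
    the definition of [V] turns [Tr (M' M^-1 V)] into the trace, over the space of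
    matrices, of [B^-1 C_(M'(z),M(w)) S] ([trace_Vmx]). For [z] and [w] on opposite
    sides of the real axis [B] has a small eigenvalue near [z = w]. It can be
    isolated exactly, without spectral perturbation theory.

    By the lower bound on the covariance, [S X = S1 X + c0 <X> 1], where [S1] is
    completely positive up to a transposition of size [O(1/N)]. Hence [B] is a
    rank-one perturbation of the operator [B1] that [S1] defines in place of [S].
    Subtracting the Dyson equations at [z] and [w] gives
    [B (M(z) - M(w)) = (z - w) M(z) M(w)], which determines the rank-one update:
    with [q = z - w + c0 <M(z) - M(w)>] one has [det B = det B1 (z - w) / q]. At the
    level of logarithmic derivatives ([rank_one_trace], [trace_formula]),
    [[
      Tr (M' M^-1 V) = Tr (B1^-1 C_(M'(z),M(w)) S1) - 1 / (z - w) + (1 + c0 <M'(z)>) / q,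
    ]]
    and the derivative in [w] is [- 1 / (z - w)^2] plus terms in which the only
    inverses are those of [B1] and [q] ([trace_derive]).

    These terms are bounded uniformly in [N] ([derivative_bound]) where the density
    of states is bounded below.
    - With [h] the absolute imaginary part of [M] and [k = |Im z| + S h], the
      imaginary part of the Dyson equation says that conjugating [k] by [M], on
      either side, gives [h]. Since [S h >= c0 <h>], this bounds [M], [M^-1], [h],
      [h^-1] and [k] ([bulk_exists]).
    - In the Hilbert-Schmidt norm with weights [h^-1] on the left and [k] on the
      right, [X |-> M(z) S X M(w)] is a contraction: the difference of the two
      squared norms is a sum of squares over the Kraus operators of [S]
      ([kraus_schur]). For [S1] the rate is strictly below one, because of the
      missing flat part, so that [B1] has a bounded inverse ([pair_stable]).
    - When both parameters are equal, the flat part contributes a square to that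
      sum which can only be small if [X] is ([same_side_stable]). Since
      [M' = M^2 + M (S M') M], this bounds [M'] in the Hilbert-Schmidt norm.
    - The imaginary parts of [z - w] and of [<M(z) - M(w)>] have the same sign, so
      that [q] stays away from zero.
    - The traces over the space of matrices are bounded by Hilbert-Schmidt norms,
      using that the covariance matrix has norm [O(1/N)] ([fn2_smull], [tr_cov]).

    The density [rho] is a limit at the real axis, whereas the statement concerns
    the height [N^-100]. Where the density at positive height is bounded below,
    its derivative is bounded because [M'] is, so the lower bound extends from
    arbitrarily small heights to all heights below a constant
    ([density_continuation]).

    Finally [|z - w| >= |x - y|], and [|x - y|] is larger than the heights by the
    factor [N^delta]. Replacing [(z - w)^-2] by [(x - y)^-2] therefore costs a
    relative error [O(N^-delta)], while the bounded part of the derivative is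
    [O((x - y)^2) = O(eps_hat)] relative to [(x - y)^-2]. *)

(** * Complex fields *)

(** Positivity of expressions built from positive hypotheses and squares. *)
Ltac posr :=
  first [ assumption | done
  | match goal with
    | |- is_true (0 <= _ ^+ 2) => apply: sqr_ge0
    | |- is_true (0 <= _ + _) => apply: addr_ge0; posr
    | |- is_true (0 <= _ * _) => apply: mulr_ge0; posr
    | |- is_true (0 <= _^-1) => rewrite invr_ge0; posr
    | |- is_true (0 <= _ ^+ _) => apply: exprn_ge0; posr
    | |- is_true (0 <= _) => apply: ltW; assumption
    | |- is_true (0 < _ + _) =>
        first [ apply: addr_gt0; posr | apply: ltr_wpDl; posr | apply: ltr_wpDr; posr ]
    | |- is_true (0 < _ * _) => apply: mulr_gt0; posr
    | |- is_true (0 < _^-1) => rewrite invr_gt0; posr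
    | |- is_true (0 < _ ^+ _) => apply: exprn_gt0; posr
    end ].

Ltac le_eq := rewrite le_eqVlt; apply/orP; left; apply/eqP.

Lemma sum_pairE (V : nmodType) (I J : finType) (F : I * J -> V) :
  \sum_al F al = \sum_i \sum_j F (i, j).
Proof. by rewrite pair_bigA; apply: eq_bigr => -[]. Qed.

Definition swap_ix {I : finType} (al : I * I) : I * I := (al.2, al.1).

Lemma swap_ixK I : involutive (@swap_ix I). Proof. by case. Qed.

Lemma reindex_swap (V : nmodType) (I : finType) (F : I * I -> V) :
  \sum_al F (swap_ix al) = \sum_al F al.
Proof. by rewrite [RHS](reindex_inj (inv_inj (@swap_ixK I))). Qed.

(** The complex numbers over [R], presented abstractly: over a concrete pair
    type, the matrix products below would unfold to real arithmetic whenever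
    two of them are compared. *)
Record complexField (R : realType) := ComplexField {
  cf_sort :> numClosedFieldType;
  cre : cf_sort -> R;
  cinj : {rmorphism R -> cf_sort};
  cre_inj : cancel cinj cre;
  cinj_re : forall x, cinj (cre x) = 'Re x }.

Arguments cre {R c} x.
Arguments cinj {R} c.

Notation "x %:CC" := (cinj _ x) (at level 2, format "x %:CC") : ring_scope.

Section ComplexParts.
Variables (R : realType) (C : complexField R).
Implicit Types (x y : C) (a b : R).

Definition cim x : R := cre (- 'i * x).
Definition cnorm x : R := cre `|x|.

Lemma cinj_inj : injective (cinj C).
Proof. exact: can_inj (@cre_inj _ C). Qed.

Lemma cinj_real a : (cinj C a) \is Num.real.
Proof. by rewrite -(cre_inj C a) cinj_re Creal_Re. Qed.

Lemma conj_cinj a : (cinj C a)^* = a%:CC.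
Proof. by apply/CrealP; apply: cinj_real. Qed.

Lemma cre_real x : x \is Num.real -> (cre x)%:CC = x.
Proof. by move=> xr; rewrite cinj_re; apply/Creal_ReP. Qed.

Lemma creD x y : cre (x + y) = cre x + cre y.
Proof. by apply: cinj_inj; rewrite rmorphD /= !cinj_re raddfD. Qed.

Lemma creN x : cre (- x) = - cre x.
Proof. by apply: cinj_inj; rewrite rmorphN /= !cinj_re raddfN. Qed.

Lemma creB x y : cre (x - y) = cre x - cre y.
Proof. by rewrite creD creN. Qed.

Lemma cre0 : cre (0 : C) = 0.
Proof. by rewrite -(rmorph0 (cinj C)) cre_inj. Qed.

Lemma creZ a x : cre (a%:CC * x) = a * cre x.
Proof. by apply: cinj_inj; rewrite rmorphM /= !cinj_re ReMl ?cinj_real. Qed.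

Lemma cre_conj x : cre (x^* ) = cre x.
Proof. by apply: cinj_inj; rewrite !cinj_re Re_conj. Qed.

Lemma cre_sum I (r : seq I) (P : pred I) (F : I -> C) :
  cre (\sum_(i <- r | P i) F i) = \sum_(i <- r | P i) cre (F i).
Proof. by elim/big_rec2: _ => [|i x y _ <-]; rewrite ?cre0 ?creD. Qed.

Lemma cimE x : (cim x)%:CC = 'Im x.
Proof. by rewrite cinj_re mulNr raddfN /= mulrC ReMir opprK. Qed.

Lemma crect x : x = (cre x)%:CC + 'i * (cim x)%:CC.
Proof. by rewrite cinj_re cimE -Crect. Qed.

Lemma cimD x y : cim (x + y) = cim x + cim y.
Proof. by rewrite /cim mulrDr creD. Qed.

Lemma cimN x : cim (- x) = - cim x.
Proof. by rewrite /cim mulrN creN. Qed.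

Lemma cimB x y : cim (x - y) = cim x - cim y.
Proof. by rewrite cimD cimN. Qed.

Lemma cimZ a x : cim (a%:CC * x) = a * cim x.
Proof. by rewrite /cim mulrCA creZ. Qed.

Lemma cim_conj x : cim (x^* ) = - cim x.
Proof. by apply: cinj_inj; rewrite rmorphN /= !cimE Im_conj. Qed.

Lemma cinj_ge0 a : (0 <= cinj C a) = (0 <= a).
Proof.
apply/idP/idP => h; last first.
  have -> : a = Num.sqrt a ^+ 2 by rewrite sqr_sqrtr.
  by rewrite rmorphXn /= -realEsqr cinj_real.
case: (ltP a 0) => // a0.
have h1 : 0 <= cinj C (- a).
  have -> : - a = Num.sqrt (- a) ^+ 2 by rewrite sqr_sqrtr // oppr_ge0 ltW.
  by rewrite rmorphXn /= -realEsqr cinj_real.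
have : a = 0.
  apply: cinj_inj; rewrite rmorph0; apply/le_anti.
  by rewrite h andbT -oppr_ge0 -rmorphN.
by move=> e; rewrite e ltxx in a0.
Qed.

Lemma cinj_le a b : (cinj C a <= cinj C b) = (a <= b).
Proof. by rewrite -subr_ge0 -rmorphB cinj_ge0 subr_ge0. Qed.

Lemma cinj_norm x : (cnorm x)%:CC = `|x|.
Proof. by rewrite cre_real ?normr_real. Qed.

Lemma cnorm_ge0 x : 0 <= cnorm x.
Proof. by rewrite -cinj_ge0 cinj_norm normr_ge0. Qed.

Lemma cnormM x y : cnorm (x * y) = cnorm x * cnorm y.
Proof. by apply: cinj_inj; rewrite rmorphM /= !cinj_norm normrM. Qed.

Lemma cnormD x y : cnorm (x + y) <= cnorm x + cnorm y.
Proof. by rewrite -cinj_le rmorphD /= !cinj_norm ler_normD. Qed.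

Lemma cnormN x : cnorm (- x) = cnorm x.
Proof. by rewrite /cnorm normrN. Qed.

Lemma cnormV x : cnorm x^-1 = (cnorm x)^-1.
Proof. by apply: cinj_inj; rewrite fmorphV /= !cinj_norm normfV. Qed.

Lemma cnorm0 : cnorm (0 : C) = 0.
Proof. by rewrite /cnorm normr0 cre0. Qed.

Lemma cnorm1 : cnorm (1 : C) = 1.
Proof. by rewrite /cnorm normr1 -(rmorph1 (cinj C)) cre_inj. Qed.

Lemma cnorm_i : cnorm ('i : C) = 1.
Proof. by rewrite /cnorm normCi -(rmorph1 (cinj C)) cre_inj. Qed.

Lemma cnorm_eq0 x : (cnorm x == 0) = (x == 0).
Proof.
by rewrite -(inj_eq cinj_inj) rmorph0 cinj_norm normr_eq0.
Qed.

Lemma cnorm_real a : cnorm (cinj C a) = `|a|.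
Proof.
have sq : forall b, 0 <= b -> cnorm (cinj C b) = b.
  by move=> b b0; rewrite /cnorm ger0_norm ?cre_inj // cinj_ge0.
case: (ger0P a) => a0; first exact: sq.
by rewrite -cnormN -rmorphN sq // oppr_ge0 ltW.
Qed.

Lemma cnorm_conj x : cnorm (x^* ) = cnorm x.
Proof. by rewrite /cnorm norm_conjC. Qed.

Lemma sqr_cnorm x : cnorm x ^+ 2 = cre x ^+ 2 + cim x ^+ 2.
Proof.
apply: cinj_inj; rewrite rmorphXn rmorphD !rmorphXn /= cinj_norm cinj_re cimE.
by rewrite normC2_Re_Im.
Qed.

Lemma mulJc x : x^* * x = (cnorm x ^+ 2)%:CC.
Proof. by rewrite rmorphXn /= cinj_norm normCK mulrC. Qed.

Lemma cre_le_cnorm x : `|cre x| <= cnorm x.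
Proof.
rewrite -(@ler_pXn2r _ 2) ?nnegrE ?cnorm_ge0 //.
by rewrite sqr_cnorm real_normK ?num_real // lerDl sqr_ge0.
Qed.

Lemma cim_le_cnorm x : `|cim x| <= cnorm x.
Proof.
rewrite -(@ler_pXn2r _ 2) ?nnegrE ?cnorm_ge0 //.
by rewrite sqr_cnorm real_normK ?num_real // lerDr sqr_ge0.
Qed.

Lemma cnorm_sum I (r : seq I) (P : pred I) (F : I -> C) :
  cnorm (\sum_(i <- r | P i) F i) <= \sum_(i <- r | P i) cnorm (F i).
Proof.
elim/big_rec2: _ => [|i x y _ le_xy]; first by rewrite cnorm0.
by rewrite (le_trans (cnormD _ _)) // lerD2l.
Qed.

End ComplexParts.

(** * Adjoints, weighted inner products and positive matrices *)

Section Adjoint.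
Variables (R : realType) (C : complexField R).

Definition adjm m n (X : 'M[C]_(m, n)) : 'M[C]_(n, m) :=
  (map_mx (@Num.conj C) X)^T.

Lemma adjmE m n (X : 'M[C]_(m, n)) i j : adjm X i j = (X j i)^*.
Proof. by rewrite !mxE. Qed.

Lemma adjmK m n (X : 'M[C]_(m, n)) : adjm (adjm X) = X.
Proof. by apply/matrixP => i j; rewrite !mxE conjCK. Qed.

Lemma adjmM m n p (X : 'M[C]_(m, n)) (Y : 'M[C]_(n, p)) :
  adjm (X *m Y) = adjm Y *m adjm X.
Proof. by rewrite /adjm map_mxM trmx_mul. Qed.

Lemma adjmD m n (X Y : 'M[C]_(m, n)) : adjm (X + Y) = adjm X + adjm Y.
Proof. by rewrite /adjm map_mxD linearD. Qed.

Lemma adjmN m n (X : 'M[C]_(m, n)) : adjm (- X) = - adjm X.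
Proof. by rewrite /adjm map_mxN linearN. Qed.

Lemma adjmB m n (X Y : 'M[C]_(m, n)) : adjm (X - Y) = adjm X - adjm Y.
Proof. by rewrite adjmD adjmN. Qed.

Lemma adjmZ m n a (X : 'M[C]_(m, n)) : adjm (a *: X) = a^* *: adjm X.
Proof. by rewrite /adjm map_mxZ linearZ. Qed.

Lemma adjm0 m n : adjm (0 : 'M[C]_(m, n)) = 0.
Proof. by rewrite /adjm map_mx0 trmx0. Qed.

Lemma adjm_sum m n I (r : seq I) (P : pred I) (F : I -> 'M[C]_(m, n)) :
  adjm (\sum_(i <- r | P i) F i) = \sum_(i <- r | P i) adjm (F i).
Proof.
elim/big_rec2: _ => [|i x y _ <-]; [exact: adjm0 | exact: adjmD].
Qed.

Lemma adjm_scalar n (a : C) : adjm (a%:M : 'M[C]_n) = (a^* )%:M.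
Proof. by rewrite /adjm map_scalar_mx tr_scalar_mx. Qed.

Lemma adjm1 n : adjm (1%:M : 'M[C]_n) = 1%:M.
Proof. by rewrite adjm_scalar conjC1. Qed.

Lemma adjm_inv n (X : 'M[C]_n) : adjm (invmx X) = invmx (adjm X).
Proof. by rewrite /adjm map_invmx trmx_inv. Qed.

Lemma adjm_unit n (X : 'M[C]_n) : (adjm X \in unitmx) = (X \in unitmx).
Proof. by rewrite /adjm unitmx_tr map_unitmx. Qed.

Lemma mxtrace_adj n (X : 'M[C]_n) : \tr (adjm X) = (\tr X)^*.
Proof.
rewrite /mxtrace rmorph_sum; apply: eq_bigr => i _.
by rewrite adjmE.
Qed.

Lemma mxtrace_sum n I (r : seq I) (P : pred I) (F : I -> 'M[C]_n) :
  \tr (\sum_(i <- r | P i) F i) = \sum_(i <- r | P i) \tr (F i).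
Proof. exact: (raddf_sum (@mxtrace _ n)). Qed.

Lemma mxtraceB n (X Y : 'M[C]_n) : \tr (X - Y) = \tr X - \tr Y.
Proof. exact: linearB. Qed.

Lemma Re_mxtrace_adj n (X : 'M[C]_n) : cre (\tr (adjm X)) = cre (\tr X).
Proof. by rewrite mxtrace_adj cre_conj. Qed.

End Adjoint.

Section RealInner.
Variables (R : realType) (C : complexField R).

(** The real inner product on complex matrices that is weighted by [a] on the
    left and by [k] on the right. *)
Definition wip m n (a : 'M[C]_m) (k : 'M[C]_n) (X Y : 'M[C]_(m, n)) : R :=
  cre (\tr (adjm X *m a *m Y *m k)).

Definition fn2 m n (X : 'M[C]_(m, n)) : R := cre (\tr (adjm X *m X)).

Lemma fn2E m n (X : 'M[C]_(m, n)) : fn2 X = \sum_i \sum_j cnorm (X i j) ^+ 2.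
Proof.
rewrite /fn2 /mxtrace cre_sum exchange_big /=; apply: eq_bigr => j _.
rewrite mxE cre_sum; apply: eq_bigr => i _.
by rewrite adjmE mulJc cre_inj.
Qed.

Lemma fn2_ge0 m n (X : 'M[C]_(m, n)) : 0 <= fn2 X.
Proof.
by rewrite fn2E; apply: sumr_ge0 => i _; apply: sumr_ge0 => j _; apply: sqr_ge0.
Qed.

Lemma fn2_eq0 m n (X : 'M[C]_(m, n)) : fn2 X = 0 -> X = 0.
Proof.
rewrite fn2E => /eqP; rewrite psumr_eq0; last first.
  by move=> i _; apply: sumr_ge0 => j _; apply: sqr_ge0.
move=> /allP h; apply/matrixP => i j; rewrite mxE.
have := h i (mem_index_enum _); rewrite psumr_eq0 => [/allP h2|k _]; last exact: sqr_ge0.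
have := h2 j (mem_index_enum _); rewrite /= sqrf_eq0 cnorm_eq0 => /eqP //.
Qed.

Lemma fn2_wip m n (X : 'M[C]_(m, n)) : fn2 X = wip 1%:M 1%:M X X.
Proof. by rewrite /wip !mulmx1. Qed.

Lemma fn2_adj m n (X : 'M[C]_(m, n)) : fn2 (adjm X) = fn2 X.
Proof. by rewrite /fn2 adjmK mxtrace_mulC. Qed.

Lemma fn2_tr m n (X : 'M[C]_(m, n)) : fn2 X^T = fn2 X.
Proof.
rewrite !fn2E exchange_big /=; apply: eq_bigr => i _; apply: eq_bigr => j _.
by rewrite mxE.
Qed.

Lemma fn2Z m n a (X : 'M[C]_(m, n)) : fn2 (a *: X) = cnorm a ^+ 2 * fn2 X.
Proof.
rewrite !fn2E mulr_sumr; apply: eq_bigr => i _; rewrite mulr_sumr.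
by apply: eq_bigr => j _; rewrite mxE cnormM exprMn.
Qed.

Lemma fn2N m n (X : 'M[C]_(m, n)) : fn2 (- X) = fn2 X.
Proof. by rewrite /fn2 adjmN mulNmx mulmxN opprK. Qed.

Lemma fn2_0 m n : fn2 (0 : 'M[C]_(m, n)) = 0.
Proof. by rewrite /fn2 mulmx0 mxtrace0 cre0. Qed.

Lemma fn2_scalar n (a : C) : fn2 (a%:M : 'M[C]_n) = n%:R * cnorm a ^+ 2.
Proof.
rewrite /fn2 adjm_scalar -scalar_mxM mulJc mxtrace_scalar.
by rewrite -rmorphMn /= cre_inj mulr_natl.
Qed.

Section Weighted.
Variables (m n : nat) (a : 'M[C]_m) (k : 'M[C]_n).

Lemma wipDl X Y Z : wip a k (X + Y) Z = wip a k X Z + wip a k Y Z.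
Proof. by rewrite /wip adjmD !mulmxDl mxtraceD creD. Qed.

Lemma wipDr X Y Z : wip a k X (Y + Z) = wip a k X Y + wip a k X Z.
Proof. by rewrite /wip mulmxDr mulmxDl mxtraceD creD. Qed.

Lemma wipNl X Y : wip a k (- X) Y = - wip a k X Y.
Proof. by rewrite /wip adjmN !mulNmx linearN /= creN. Qed.

Lemma wipNr X Y : wip a k X (- Y) = - wip a k X Y.
Proof. by rewrite /wip mulmxN mulNmx linearN /= creN. Qed.

Lemma wipZl (c : R) X Y : wip a k (c%:CC *: X) Y = c * wip a k X Y.
Proof. by rewrite /wip adjmZ conj_cinj -!scalemxAl linearZ /= creZ. Qed.

Lemma wipZr (c : R) X Y : wip a k X (c%:CC *: Y) = c * wip a k X Y.
Proof. by rewrite /wip -scalemxAr -!scalemxAl linearZ /= creZ. Qed.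

Lemma wipC X Y : adjm a = a -> adjm k = k -> wip a k X Y = wip a k Y X.
Proof.
move=> ha hk; rewrite /wip -Re_mxtrace_adj !adjmM adjmK ha hk.
by rewrite [in LHS]mxtrace_mulC !mulmxA.
Qed.

End Weighted.

Definition psd n (X : 'M[C]_n) : Prop :=
  adjm X = X /\ forall v : 'cV[C]_n, 0 <= cre (\tr (adjm v *m X *m v)).

(** [lepd X Y] is the Loewner order. *)
Definition lepd n (X Y : 'M[C]_n) : Prop := psd (Y - X).

Lemma col_mx_tr n m (X : 'M[C]_n) (V : 'M[C]_(n, m)) :
  \tr (adjm V *m X *m V) = \sum_j \tr (adjm (col j V) *m X *m col j V).
Proof.
rewrite {1}/mxtrace; apply: eq_bigr => j _; rewrite trace_mx11 !mxE.
apply: eq_bigr => i _; rewrite !mxE; congr (_ * _); apply: eq_bigr => l _.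
by rewrite !mxE.
Qed.

Lemma psd_tr n m (X : 'M[C]_n) (V : 'M[C]_(n, m)) : psd X ->
  0 <= cre (\tr (adjm V *m X *m V)).
Proof.
by move=> [_ pX]; rewrite col_mx_tr cre_sum; apply: sumr_ge0 => j _; apply: pX.
Qed.

Lemma psd_conj n m (X : 'M[C]_n) (V : 'M[C]_(n, m)) : psd X ->
  psd (adjm V *m X *m V).
Proof.
move=> pX; split; first by rewrite !adjmM adjmK pX.1 mulmxA.
by move=> v; have := psd_tr (V *m v) pX; rewrite adjmM !mulmxA.
Qed.

Lemma psd_conjr n m (X : 'M[C]_n) (V : 'M[C]_(m, n)) : psd X ->
  psd (V *m X *m adjm V).
Proof. by move=> /(psd_conj (adjm V)); rewrite adjmK. Qed.

Lemma psd_scalar n (a : R) : 0 <= a -> psd (a%:CC%:M : 'M[C]_n).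
Proof.
move=> a0; split; first by rewrite adjm_scalar conj_cinj.
by move=> v; rewrite -mulmxA mul_scalar_mx -scalemxAr linearZ /= creZ mulr_ge0 ?fn2_ge0.
Qed.

Lemma psd1 n : psd (1%:M : 'M[C]_n).
Proof. by rewrite -(rmorph1 (cinj C)); apply: psd_scalar. Qed.

Lemma psdD n (X Y : 'M[C]_n) : psd X -> psd Y -> psd (X + Y).
Proof.
move=> [hX pX] [hY pY]; split; first by rewrite adjmD hX hY.
by move=> v; rewrite mulmxDr mulmxDl mxtraceD creD addr_ge0.
Qed.

Lemma psd0 n : psd (0 : 'M[C]_n).
Proof. by split=> [|v]; rewrite ?adjm0 // mulmx0 mul0mx mxtrace0 cre0. Qed.

Lemma psdZ n (a : R) (X : 'M[C]_n) : 0 <= a -> psd X -> psd (a%:CC *: X).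
Proof.
move=> a0 [hX pX]; split; first by rewrite adjmZ hX conj_cinj.
by move=> v; rewrite -scalemxAr -scalemxAl linearZ /= creZ mulr_ge0.
Qed.

Lemma psd_sum n I (r : seq I) (F : I -> 'M[C]_n) :
  (forall i, psd (F i)) -> psd (\sum_(i <- r) F i).
Proof.
move=> pF; apply: (big_ind (@psd n)) => [|X Y|i _]; [exact: psd0|exact: psdD|exact: pF].
Qed.

Lemma lepd_trans n (Y X Z : 'M[C]_n) : lepd X Y -> lepd Y Z -> lepd X Z.
Proof. by move=> p q; have := psdD p q; rewrite addrC subrKA. Qed.

Lemma lepd_refl n (X : 'M[C]_n) : lepd X X.
Proof. by rewrite /lepd subrr; apply: psd0. Qed.

(** A square root, from the spectral theorem. *)
Lemma psd_ex_factor n (X : 'M[C]_n) : psd X ->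
  exists G : 'M[C]_n, X = G *m adjm G.
Proof.
move=> [hX pX].
have tC m p (Y : 'M[C]_(m, p)) : map_mx (@Num.conj C) (trmx Y) = adjm Y.
  by apply/matrixP => i j; rewrite !mxE.
have nX : X \is normalmx.
  by apply/normalmxP; rewrite tC hX.
have eX := orthomx_spectralP nX.
set U := spectralmx X in eX; set d := spectral_diag X in eX.
have uU : U \is unitarymx by apply: spectral_unitarymx.
rewrite (invmx_unitary uU) tC in eX.
have UU : U *m adjm U = 1%:M.
  by have /unitarymxP := uU; rewrite tC.
have dE : diag_mx d = U *m X *m adjm U.
  by rewrite [X in RHS]eX !mulmxA UU mul1mx -mulmxA UU mulmx1.
have d_ge0 i : 0 <= cre (d 0 i).
  have := pX (adjm U *m delta_mx i 0).
  rewrite adjmM adjmK -!mulmxA [U *m (_ *m _)]mulmxA [U *m X *m (_ *m _)]mulmxA -dE.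
  rewrite trace_mx11 mul_diag_mx mxE (bigD1 i) //= big1 ?addr0 => [|l li].
    by rewrite !mxE !eqxx /= mulr1 conjC1 mul1r.
  by rewrite !mxE (negPf li) /= conjC0 mul0r.
have d_real i : d 0 i = (cre (d 0 i))%:CC.
  have := congr1 (fun Y : 'M[C]_n => Y i i) (congr1 (@adjm R C n n) dE).
  rewrite /= !adjmM adjmK hX mulmxA -dE !mxE eqxx mulr1n => /CrealP.
  by move=> /cre_real ->.
exists (adjm U *m diag_mx (map_mx (fun x => cinj C (Num.sqrt (cre x))) d)).
rewrite adjmM adjmK [LHS]eX.
have -> : adjm (diag_mx (map_mx (fun x => cinj C (Num.sqrt (cre x))) d)) =
          diag_mx (map_mx (fun x => cinj C (Num.sqrt (cre x))) d).
  apply/matrixP => i j; rewrite adjmE !mxE eq_sym.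
  by case: eqP => [->|_]; rewrite ?mulr1n ?mulr0n ?conj_cinj ?conjC0.
rewrite -!mulmxA; congr (_ *m _); rewrite mulmxA; congr (_ *m _).
rewrite mulmx_diag; congr diag_mx; apply/rowP => i; rewrite !mxE.
by rewrite -rmorphM /= -expr2 sqr_sqrtr // -d_real.
Qed.

Lemma wip_ge0 m n (a : 'M[C]_m) (k : 'M[C]_n) X : psd a -> psd k ->
  0 <= wip a k X X.
Proof.
move=> pa /psd_ex_factor [G ->]; rewrite /wip.
have := psd_tr (X *m G) pa; rewrite adjmM -!mulmxA.
by rewrite [in X in X -> _]mxtrace_mulC !mulmxA.
Qed.

Lemma wip_lel m n (a b : 'M[C]_m) (k : 'M[C]_n) X : lepd a b -> psd k ->
  wip a k X X <= wip b k X X.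
Proof.
move=> ab pk; have := wip_ge0 X ab pk.
by rewrite /wip mulmxBr !mulmxBl linearB /= creB subr_ge0.
Qed.

Lemma wip_ler m n (a : 'M[C]_m) (k l : 'M[C]_n) X : psd a -> lepd k l ->
  wip a k X X <= wip a l X X.
Proof.
move=> pa kl; have := wip_ge0 X pa kl.
by rewrite /wip mulmxBr linearB /= creB subr_ge0.
Qed.

Lemma wip_scalarl m n (c : R) (k : 'M[C]_n) (X : 'M[C]_(m, n)) :
  wip c%:CC%:M k X X = c * wip 1%:M k X X.
Proof.
by rewrite /wip mulmx1 mul_mx_scalar -!scalemxAl linearZ /= creZ.
Qed.

Lemma wip_scalarr m n (c : R) (a : 'M[C]_m) (X : 'M[C]_(m, n)) :
  wip a c%:CC%:M X X = c * wip a 1%:M X X.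
Proof. by rewrite /wip mulmx1 mul_mx_scalar linearZ /= creZ. Qed.

Lemma wip_lower m n (a : 'M[C]_m) (k : 'M[C]_n) (al kl : R) X : 0 <= al -> psd k ->
  lepd al%:CC%:M a -> lepd kl%:CC%:M k -> al * kl * fn2 X <= wip a k X X.
Proof.
move=> al0 pk la lk; apply: le_trans (wip_lel X la pk).
rewrite wip_scalarl -mulrA; apply: ler_wpM2l => //.
by apply: le_trans (wip_ler X (psd1 _) lk); rewrite wip_scalarr fn2_wip.
Qed.

Lemma wip_upper m n (a : 'M[C]_m) (k : 'M[C]_n) (au ku : R) X : 0 <= au -> psd k ->
  lepd a au%:CC%:M -> lepd k ku%:CC%:M -> wip a k X X <= au * ku * fn2 X.
Proof.
move=> au0 pk la lk; apply: le_trans (wip_lel X la pk) _.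
rewrite wip_scalarl -mulrA; apply: ler_wpM2l => //.
by apply: le_trans (wip_ler X (psd1 _) lk) _; rewrite wip_scalarr fn2_wip.
Qed.

(** Young's inequality for the weighted inner product. *)
Lemma wip_young m n (a : 'M[C]_m) (k : 'M[C]_n) (t : R) X Y :
  0 < t -> psd a -> psd k ->
  wip a k (X + Y) (X + Y) <= (1 + t) * wip a k X X + (1 + t^-1) * wip a k Y Y.
Proof.
move=> t0 pa pk.
have := wip_ge0 (t%:CC *: X - Y) pa pk.
rewrite !wipDl !wipDr !wipNl !wipNr !wipZl !wipZr opprK (wipC Y X pa.1 pk.1).
move: (wip a k X X) (wip a k X Y) (wip a k Y Y) => p q r h.
have t1 : 0 <= t^-1 by rewrite invr_ge0 ltW.
have := mulr_ge0 t1 h.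
have -> : t^-1 * (t * (t * p) + - (t * q) + (- (t * q) + r)) =
          t * p - 2 * q + t^-1 * r by field; rewrite gt_eqF.
move: (t^-1) => u; lra.
Qed.

Lemma fn2D_le m n (X Y : 'M[C]_(m, n)) : fn2 (X + Y) <= 2 * fn2 X + 2 * fn2 Y.
Proof.
rewrite !fn2_wip; have := wip_young X Y ltr01 (psd1 m) (psd1 n).
by rewrite invr1.
Qed.

Lemma fn2B_le m n (X Y : 'M[C]_(m, n)) : fn2 (X - Y) <= 2 * fn2 X + 2 * fn2 Y.
Proof. by rewrite -(fn2N Y) fn2D_le. Qed.

Lemma wip_le_young m n (a : 'M[C]_m) (k : 'M[C]_n) X Y : psd a -> psd k ->
  2 * wip a k X Y <= wip a k X X + wip a k Y Y.
Proof.
move=> pa pk; have := wip_ge0 (X - Y) pa pk.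
rewrite !wipDl !wipDr !wipNl !wipNr opprK (wipC Y X pa.1 pk.1).
move: (wip a k X X) (wip a k X Y) (wip a k Y Y) => p q r; lra.
Qed.

End RealInner.

(** * Completely positive maps *)

Section Kraus.
Variables (R : realType) (C : complexField R).

(** The two sums together say that the map is completely positive and equal to
    its own adjoint for the trace pairing, as holds for [X |-> E (W X W)] with a
    symmetric [W]. *)
Definition kraus n (Phi : 'M[C]_n -> 'M[C]_n) : Prop :=
  exists (I : finType) (G : I -> 'M[C]_n),
    (forall X, Phi X = \sum_i G i *m X *m adjm (G i)) /\
    (forall X, Phi X = \sum_i adjm (G i) *m X *m G i).

Section Single.
Variables (n : nat) (Phi : 'M[C]_n -> 'M[C]_n).
Hypothesis cpPhi : kraus Phi.

Lemma kraus_psd X : psd X -> psd (Phi X).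
Proof.
case: cpPhi => I [G [-> _]] pX; apply: psd_sum => i; exact: psd_conjr.
Qed.

Lemma krausD X Y : Phi (X + Y) = Phi X + Phi Y.
Proof.
case: cpPhi => I [G [PhiE _]]; rewrite !PhiE -big_split; apply: eq_bigr => i _.
by rewrite mulmxDr mulmxDl.
Qed.

Lemma krausZ a X : Phi (a *: X) = a *: Phi X.
Proof.
case: cpPhi => I [G [PhiE _]]; rewrite !PhiE scaler_sumr; apply: eq_bigr => i _.
by rewrite -scalemxAr -scalemxAl.
Qed.

Lemma krausN X : Phi (- X) = - Phi X.
Proof. by rewrite -scaleN1r krausZ scaleN1r. Qed.

Lemma krausB X Y : Phi (X - Y) = Phi X - Phi Y.
Proof. by rewrite krausD krausN. Qed.

Lemma kraus_adj X : Phi (adjm X) = adjm (Phi X).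
Proof.
case: cpPhi => I [G [PhiE _]]; rewrite !PhiE adjm_sum; apply: eq_bigr => i _.
by rewrite !adjmM adjmK mulmxA.
Qed.

Lemma kraus_le X Y : lepd X Y -> lepd (Phi X) (Phi Y).
Proof. by move=> XY; rewrite /lepd -krausB; apply: kraus_psd. Qed.

(** Expanding the weighted square norms of [h G^* M1^* g Z - X G^* M2] over the
    Kraus operators [G] gives this noncommutative Schur test; the choice
    [Z = M1 Phi(X) M2] turns it into a contraction estimate. *)
Lemma kraus_schur (h g k M1 M2 X Z : 'M[C]_n) :
  psd g -> psd k -> adjm h = h -> h *m g = 1%:M ->
  0 <= wip (g *m (M1 *m Phi h *m adjm M1) *m g) k Z Z
       - 2 * wip g k Z (M1 *m Phi X *m M2)
       + wip g (Phi (M2 *m k *m adjm M2)) X X.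
Proof.
case: cpPhi => I [G [PhiE PhiE']] pg pk hh hg.
pose P i := h *m adjm (G i) *m adjm M1 *m g *m Z - X *m adjm (G i) *m M2.
have : 0 <= \sum_i wip g k (P i) (P i).
  by apply: sumr_ge0 => i _; apply: wip_ge0.
suff -> : \sum_i wip g k (P i) (P i) =
   wip (g *m (M1 *m Phi h *m adjm M1) *m g) k Z Z
       - 2 * wip g k Z (M1 *m Phi X *m M2)
       + wip g (Phi (M2 *m k *m adjm M2)) X X by [].
have e1 : wip (g *m (M1 *m Phi h *m adjm M1) *m g) k Z Z =
   \sum_i wip g k (h *m adjm (G i) *m adjm M1 *m g *m Z)
                  (h *m adjm (G i) *m adjm M1 *m g *m Z).
  rewrite PhiE /wip mulmx_sumr mulmx_suml mulmx_sumr mulmx_suml.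
  rewrite mulmx_sumr mulmx_suml mulmx_suml mxtrace_sum cre_sum.
  apply: eq_bigr => i _; congr (cre (\tr _)).
  rewrite !adjmM !adjmK pg.1 hh !mulmxA.
  congr (_ *m _); congr (_ *m _); congr (_ *m _); congr (_ *m _).
  by rewrite -!mulmxA [h *m (g *m _)]mulmxA hg mul1mx.
have e2 : wip g k Z (M1 *m Phi X *m M2) =
   \sum_i wip g k (h *m adjm (G i) *m adjm M1 *m g *m Z)
                  (X *m adjm (G i) *m M2).
  rewrite PhiE /wip mulmx_sumr !mulmx_suml.
  rewrite mulmx_sumr mulmx_suml mxtrace_sum cre_sum.
  apply: eq_bigr => i _; congr (cre (\tr _)).
  rewrite !adjmM !adjmK pg.1 hh !mulmxA; congr (_ *m _).
  by rewrite -!mulmxA [h *m (g *m _)]mulmxA hg mul1mx.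
have e3 : wip g (Phi (M2 *m k *m adjm M2)) X X =
   \sum_i wip g k (X *m adjm (G i) *m M2) (X *m adjm (G i) *m M2).
  rewrite PhiE' /wip mulmx_sumr mxtrace_sum cre_sum.
  apply: eq_bigr => i _; congr cre.
  rewrite !adjmM !adjmK !mulmxA mxtrace_mulC !mulmxA mxtrace_mulC !mulmxA.
  by rewrite mxtrace_mulC !mulmxA.
rewrite e1 e2 e3 mulr_sumr -sumrB -big_split; apply: eq_bigr => i _.
rewrite /P wipDl !wipDr !wipNl !wipNr opprK (wipC _ (h *m _ *m _ *m _ *m _) pg.1 pk.1).
by rewrite mulr2n mulrDl mul1r /=; ring.
Qed.

(** Here [g] is the inverse of [h]. In the application both inequalities come
    from Ward identities, and the rate [b < 1] from leaving out the flat part of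
    the covariance map. *)
Lemma kraus_contraction (h g k M1 M2 X : 'M[C]_n) (b : R) :
  psd g -> psd k -> adjm h = h -> h *m g = 1%:M ->
  lepd (M1 *m Phi h *m adjm M1) h ->
  lepd (Phi (M2 *m k *m adjm M2)) (b%:CC *: k) ->
  wip g k (M1 *m Phi X *m M2) (M1 *m Phi X *m M2) <= b * wip g k X X.
Proof.
move=> pg pk hh hg le1 le2.
set Z := M1 *m Phi X *m M2.
have gh : g *m h = 1%:M by apply: mulmx1C.
have := kraus_schur M1 M2 X Z pg pk hh hg; rewrite -/Z.
have l1 : wip (g *m (M1 *m Phi h *m adjm M1) *m g) k Z Z <= wip g k Z Z.
  apply: wip_lel => //.
  have := psd_conj g le1; rewrite pg.1 mulmxBr mulmxBl.
  by rewrite gh mul1mx.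
have l2 := wip_ler X pg le2.
have l3 : wip g (b%:CC *: k) X X = b * wip g k X X.
  by rewrite /wip -scalemxAr linearZ /= creZ.
move: l2; rewrite l3.
move: (wip _ _ _ _) (wip _ _ _ _) (wip _ _ _ _) (wip _ _ _ _) l1 => p q r s l1 l2 l4; lra.
Qed.

(** A contraction in a weighted norm makes [1 - M1 Phi(.) M2] bounded below,
    with a constant that depends on the contraction rate and on the
    equivalence of the weighted norm with the Frobenius norm. *)
Lemma kraus_lower (h g k M1 M2 X : 'M[C]_n) (b gl gu kl ku : R) :
  0 < b < 1 -> 0 < gl -> 0 < kl -> 0 <= gu -> psd g -> psd k ->
  adjm h = h -> h *m g = 1%:M ->
  lepd (M1 *m Phi h *m adjm M1) h ->
  lepd (Phi (M2 *m k *m adjm M2)) (b%:CC *: k) ->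
  lepd gl%:CC%:M g -> lepd g gu%:CC%:M -> lepd kl%:CC%:M k -> lepd k ku%:CC%:M ->
  fn2 X <= 4 / (1 - b) ^+ 2 * (gu * ku / (gl * kl)) *
           fn2 (X - M1 *m Phi X *m M2).
Proof.
move=> /andP[b0 b1] gl0 kl0 gu0 pg pk hh hg le1 le2 lgl lgu lkl lku.
have := kraus_contraction X pg pk hh hg le1 le2.
set Z := M1 *m Phi X *m M2; set Y := X - Z => cZ.
have b1' : 0 < 1 - b by rewrite subr_gt0.
set t := (1 - b) / (2 * b).
have t0 : 0 < t by rewrite divr_gt0 // mulr_gt0.
have := wip_young Z Y t0 pg pk; rewrite [Z + Y]addrC subrK => yg.
have lowX := wip_lower X (ltW gl0) pk lgl lkl.
have upY := wip_upper Y gu0 pk lgu lku.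
have wY0 := wip_ge0 Y pg pk.
have step : wip g k X X <= 4 / (1 - b) ^+ 2 * wip g k Y Y.
  have e1 : (1 + t) * b = (1 + b) / 2.
    by rewrite /t; field; rewrite gt_eqF.
  have e2 : 1 + t^-1 = (1 + b) / (1 - b).
    by rewrite /t; field; rewrite !gt_eqF.
  have : wip g k X X <= (1 + b) / 2 * wip g k X X + (1 + b) / (1 - b) * wip g k Y Y.
    apply: le_trans yg _; rewrite e2 -e1 lerD2r -mulrA ler_wpM2l //.
    by rewrite addr_ge0 // ltW.
  move=> h1; have h2 : (1 - b) / 2 * wip g k X X <= 2 / (1 - b) * wip g k Y Y.
    have : (1 + b) / (1 - b) * wip g k Y Y <= 2 / (1 - b) * wip g k Y Y.
      by rewrite ler_wpM2r // ler_wpM2r ?invr_ge0 ?ltW //; lra.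
    move: h1; lra.
  have -> : 4 / (1 - b) ^+ 2 * wip g k Y Y = ((1 - b) / 2)^-1 * (2 / (1 - b) * wip g k Y Y).
    by field; rewrite gt_eqF.
  by rewrite ler_pdivlMl // divr_gt0.
have glkl : 0 < gl * kl by rewrite mulr_gt0.
have -> : 4 / (1 - b) ^+ 2 * (gu * ku / (gl * kl)) * fn2 Y =
          (gl * kl)^-1 * (4 / (1 - b) ^+ 2 * (gu * ku * fn2 Y)).
  by rewrite mulrA [_^-1 * _]mulrC; ring.
rewrite ler_pdivlMl //; apply: le_trans lowX _; apply: le_trans step _.
by rewrite ler_wpM2l // divr_ge0 ?sqr_ge0.
Qed.

End Single.

(** * Stability on the same side of the real axis *)

Definition normtr n (X : 'M[C]_n) : C := n%:R^-1 * \tr X.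

Section Defect.
Variables (n : nat) (Phi : 'M[C]_n -> 'M[C]_n) (c0 : R).
Hypothesis n_gt0 : (0 < n)%N.
Hypothesis cpPhi : kraus Phi.
Hypothesis c0_gt0 : 0 < c0.

Variables (h g k M : 'M[C]_n) (tau : R).
Hypothesis tau_gt0 : 0 < tau.
Hypothesis h_tau : normtr h = tau%:CC.
Hypothesis pg : psd g.
Hypothesis pk : psd k.
Hypothesis hh : adjm h = h.
Hypothesis hg : h *m g = 1%:M.
Hypothesis MkM : M *m k *m adjm M = h.

Let Psi X := Phi X + (c0%:CC * normtr X)%:M.

Lemma normtr_trace (X : 'M[C]_n) : \tr X = n%:R * normtr X :> C.
Proof. by rewrite /normtr mulrA mulfV ?mul1r // pnatr_eq0 -lt0n. Qed.

Lemma cre_nat (x : C) : cre (n%:R * x) = n%:R * cre x.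
Proof. by rewrite -(rmorph_nat (cinj C)) creZ. Qed.

(** The flat part of the Schur test is an exact sum of two squares. *)
Lemma flat_schur X Z (t : C) : normtr X = t * tau%:CC ->
  tau * (wip 1%:M k (adjm M *m g *m Z - t *: M) (adjm M *m g *m Z - t *: M) +
         wip g 1%:M (X - t *: h) (X - t *: h)) =
  tau * wip (g *m (M *m adjm M) *m g) k Z Z
    - 2 * wip g k Z (normtr X *: (M *m M)) + tau * wip g 1%:M X X.
Proof.
move=> Xt.
rewrite !wipDl !wipDr !wipNl !wipNr !opprK.
rewrite (wipC (t *: M)) ?adjm1 ?pk.1 // (wipC (t *: h)) ?adjm1 ?pg.1 //.
have eM : wip 1%:M k (t *: M) (t *: M) = n%:R * cnorm t ^+ 2 * tau.
  rewrite /wip mulmx1 adjmZ -!scalemxAl -scalemxAr -!scalemxAl scalerA linearZ /=.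
  rewrite mulJc creZ -mulmxA mxtrace_mulC MkM normtr_trace h_tau cre_nat cre_inj.
  by rewrite mulrCA mulrA.
have eh : wip g 1%:M (t *: h) (t *: h) = n%:R * cnorm t ^+ 2 * tau.
  rewrite /wip mulmx1 adjmZ hh -!scalemxAl -scalemxAr scalerA linearZ /=.
  by rewrite mulJc creZ hg mul1mx normtr_trace h_tau cre_nat cre_inj mulrCA mulrA.
have eX : wip g 1%:M X (t *: h) = n%:R * cnorm t ^+ 2 * tau.
  rewrite (wipC X) ?adjm1 ?pg.1 // /wip mulmx1 adjmZ hh -!scalemxAl linearZ /=.
  rewrite hg mul1mx normtr_trace Xt.
  have -> : t^* * (n%:R * (t * tau%:CC)) = n%:R * (cnorm t ^+ 2 * tau)%:CC :> C.
    by rewrite rmorphM /= -mulJc; ring.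
  by rewrite cre_nat cre_inj mulrA.
have eZ : wip 1%:M k (adjm M *m g *m Z) (adjm M *m g *m Z) =
          wip (g *m (M *m adjm M) *m g) k Z Z.
  by rewrite /wip mulmx1 !adjmM adjmK pg.1 !mulmxA.
have eC : wip g k Z (normtr X *: (M *m M)) =
          tau * wip 1%:M k (adjm M *m g *m Z) (t *: M).
  rewrite /wip mulmx1 !adjmM adjmK pg.1 Xt [t * _]mulrC -scalerA -scalemxAr.
  by rewrite -scalemxAl linearZ /= creZ -!scalemxAr !mulmxA.
rewrite eM eh eX eZ eC.
by move: (wip _ _ _ _) (wip _ _ _ _) (wip _ _ _ _) => p q r; ring.
Qed.

(** With a flat part in the map, the contraction loses the sum of squares of
    [flat_schur]. *)
Lemma schur_defect X Z (t : C) : normtr X = t * tau%:CC ->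
  lepd (M *m Psi h *m adjm M) h -> lepd (Psi h) k ->
  Z = M *m Psi X *m M ->
  c0 * tau * (wip 1%:M k (adjm M *m g *m Z - t *: M) (adjm M *m g *m Z - t *: M) +
         wip g 1%:M (X - t *: h) (X - t *: h)) <= wip g k X X - wip g k Z Z.
Proof.
move=> Xt le1 le2 ZE.
have gh : g *m h = 1%:M by apply: mulmx1C.
rewrite -mulrA flat_schur //.
have := kraus_schur cpPhi M M X Z pg pk hh hg; rewrite MkM => ks.
have l1 : wip (g *m (M *m Psi h *m adjm M) *m g) k Z Z <= wip g k Z Z.
  apply: wip_lel => //.
  have := psd_conj g le1; rewrite pg.1 mulmxBr mulmxBl.
  by rewrite gh mul1mx.
have l2 := wip_ler X pg le2.
have e1 : wip (g *m (M *m Psi h *m adjm M) *m g) k Z Z =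
  wip (g *m (M *m Phi h *m adjm M) *m g) k Z Z +
  c0 * (tau * wip (g *m (M *m adjm M) *m g) k Z Z).
  rewrite /Psi h_tau -rmorphM /= mulmxDr mulmxDl mulmxDr mulmxDl mul_mx_scalar.
  rewrite -scalemxAl -scalemxAr -scalemxAl.
  rewrite /wip mulmxDr !mulmxDl mxtraceD creD -scalemxAr -!scalemxAl linearZ /=.
  by rewrite creZ mulrA.
have e2 : wip g (Psi h) X X = wip g (Phi h) X X + c0 * (tau * wip g 1%:M X X).
  rewrite /Psi h_tau -rmorphM /= /wip mulmxDr mxtraceD creD mul_mx_scalar linearZ /=.
  by rewrite creZ mulmx1 mulrA.
have e3 : wip g k Z Z = wip g k Z (M *m Phi X *m M) +
    c0 * wip g k Z (normtr X *: (M *m M)).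
  rewrite {2}ZE /Psi mulmxDr mulmxDl wipDr -wipZr; congr (_ + wip _ _ _ _).
  by rewrite mul_mx_scalar -scalemxAl scalerA.
move: ks l1 l2 e3; rewrite e1 e2 !mulrDr mulrN [c0 * (2 * _)]mulrCA.
set a1 := c0 * (tau * wip _ _ _ _); set a2 := c0 * (tau * wip _ _ _ _).
set a3 := c0 * _; set a4 := wip g k Z Z; set a5 := wip g k X X.
set a6 := wip g k Z _; set a7 := wip g _ X X; set a8 := wip _ _ Z Z.
by clearbody a1 a2 a3 a4 a5 a6 a7 a8 => *; lra.
Qed.

(** If [X] is nearly fixed by [M Psi(.) M], the defect forces [X] to be close to
    [t h] and [t M^*] to be close to [t M], while [M - M^*] is comparable to
    [h]; hence [t], and with it [X], is small. *)
Lemma same_side_lower X (gl gu kl ku m thr Q : R) :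
  0 < gl -> 0 < gu -> 0 < kl -> 0 < ku -> 0 <= m -> 0 < thr -> thr <= tau ->
  lepd gl%:CC%:M g -> lepd g gu%:CC%:M -> lepd kl%:CC%:M k -> lepd k ku%:CC%:M ->
  (forall V : 'M[C]_n, fn2 (adjm M *m g *m V) <= m * fn2 V) ->
  fn2 (M - adjm M) = 4 * fn2 h ->
  lepd (M *m Psi h *m adjm M) h -> lepd (Psi h) k ->
  Q = ((2 + 2 * m) / gl + kl^-1) / (c0 * thr) ->
  fn2 X <= 2 * (Q * (1 + 2 * Q * (gu * ku)) * (gu * ku) + 2 * m) *
           fn2 (X - M *m Psi X *m M).
Proof.
move=> gl0 gu0 kl0 ku0 m0 thr0 thr_le lgl lgu lkl lku hm hM le1 le2 QE.
have gh : g *m h = 1%:M by apply: mulmx1C.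
set Z := M *m Psi X *m M; set Y := X - Z.
have [t Xt] : exists t : C, normtr X = t * tau%:CC.
  exists (normtr X / tau%:CC); rewrite divfK // -(rmorph0 (cinj C)).
  by rewrite (inj_eq (@cinj_inj _ C)) gt_eqF.
have := schur_defect Xt le1 le2 (erefl Z).
set A := adjm M *m g *m Z - t *: M; set B := X - t *: h => def.
have lowA : kl * fn2 A <= wip 1%:M k A A.
  by apply: le_trans (wip_ler A (psd1 _ _) lkl); rewrite wip_scalarr fn2_wip.
have lowB : gl * fn2 B <= wip g 1%:M B B.
  by apply: le_trans (wip_lel B lgl (psd1 _ _)); rewrite wip_scalarl fn2_wip.
have upY := wip_upper Y (ltW gu0) pk lgu lku.
have upX := wip_upper X (ltW gu0) pk lgu lku.
have tM : fn2 (t *: h) <= 2^-1 * fn2 A + m * fn2 B + m * fn2 Y.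
  have e : t *: (adjm M - M) = A - (adjm M *m g *m B - adjm M *m g *m Y).
    rewrite -mulmxBr /Y opprB [B + _]addrC subrKA.
    rewrite mulmxBr -scalemxAr -[_ *m g *m h]mulmxA gh mulmx1 scalerBr /A.
    by rewrite opprB [RHS]addrC subrKA.
  have e1 : 4 * fn2 (t *: h) = fn2 (t *: (adjm M - M)).
    by rewrite !fn2Z -[adjm M - M]opprB fn2N hM mulrCA.
  have := fn2B_le A (adjm M *m g *m B - adjm M *m g *m Y); rewrite -e -e1.
  have := fn2B_le (adjm M *m g *m B) (adjm M *m g *m Y).
  move: (hm B) (hm Y).
  move: (fn2 _) (fn2 _) (fn2 _) (fn2 _) (fn2 _) (fn2 _) (fn2 _) => *; lra.
have Xle : fn2 X <= (2 + 2 * m) * fn2 B + fn2 A + 2 * m * fn2 Y.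
  have := fn2D_le B (t *: h); rewrite /B subrK -/B.
  move: tM; move: (fn2 _) (fn2 _) (fn2 _) (fn2 _) (fn2 _) => *; lra.
have c0thr : 0 < c0 * thr by rewrite mulr_gt0.
have Q0 : 0 < Q.
  rewrite QE divr_gt0 // addr_gt0 ?invr_gt0 // divr_gt0 //.
  by rewrite ltr_pwDl ?mulr_ge0.
have wA0 := wip_ge0 A (psd1 _ n) pk; have wB0 := wip_ge0 B pg (psd1 _ n).
have wZ0 := wip_ge0 Z pg pk; have wY0 := wip_ge0 Y pg pk.
have def' : c0 * thr * (wip 1%:M k A A + wip g 1%:M B B) <= wip g k X X - wip g k Z Z.
  apply: le_trans def; rewrite ler_wpM2r ?addr_ge0 // ler_pM2l //.
have XQ : fn2 X <= Q * (wip g k X X - wip g k Z Z) + 2 * m * fn2 Y.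
  apply: le_trans Xle _; rewrite lerD2r.
  have fA : fn2 A <= kl^-1 * wip 1%:M k A A by rewrite ler_pdivlMl.
  have fB : fn2 B <= gl^-1 * wip g 1%:M B B by rewrite ler_pdivlMl.
  have h1 : (2 + 2 * m) * fn2 B + fn2 A <=
     ((2 + 2 * m) / gl + kl^-1) * (wip 1%:M k A A + wip g 1%:M B B).
    have p0 : 0 <= (2 + 2 * m) / gl by rewrite divr_ge0 ?ltW // ltr_pwDl ?mulr_ge0.
    have q0 : 0 <= kl^-1 by rewrite invr_ge0 ltW.
    have fB' : (2 + 2 * m) * fn2 B <= (2 + 2 * m) / gl * wip g 1%:M B B.
      by rewrite -mulrA ler_wpM2l // ltW // ltr_pwDl ?mulr_ge0.
    have mix (p q u v a b : R) : 0 <= p -> 0 <= q -> 0 <= u -> 0 <= v ->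
        a <= q * u -> b <= p * v -> b + a <= (p + q) * (u + v).
      by move=> h1 h2 h3 h4 h5 h6; have := mulr_ge0 h1 h3; have := mulr_ge0 h2 h4; lra.
    exact: mix.
  apply: le_trans h1 _.
  rewrite QE -mulrA ler_wpM2l //; last by rewrite ler_pdivlMl.
  by rewrite addr_ge0 ?invr_ge0 ?divr_ge0 ?ltW // ltr_pwDl ?mulr_ge0.
set G := gu * ku; have G0 : 0 < G by rewrite mulr_gt0.
set s := (2 * Q * G)^-1.
have s0 : 0 < s by rewrite invr_gt0 !mulr_gt0.
have yg := wip_young Z Y s0 pg pk; rewrite [Z + Y]addrC subrK in yg.
have sv : s^-1 = 2 * Q * G by rewrite invrK.
have Qs : Q * s * G = 2^-1.
  by rewrite /s; field; rewrite !gt_eqF.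
have wZX : wip g k Z Z <= G * fn2 X.
  apply: le_trans upX; rewrite -subr_ge0; apply: le_trans def'.
  by rewrite mulr_ge0 ?addr_ge0 // ltW.
have h2 : Q * (wip g k X X - wip g k Z Z) <= 2^-1 * fn2 X + Q * (1 + 2 * Q * G) * (G * fn2 Y).
  have : wip g k X X - wip g k Z Z <= s * (G * fn2 X) + (1 + 2 * Q * G) * (G * fn2 Y).
    have a1 : s * wip g k Z Z <= s * (G * fn2 X) by rewrite ler_pM2l.
    have a2 : (1 + 2 * Q * G) * wip g k Y Y <= (1 + 2 * Q * G) * (G * fn2 Y).
      by rewrite ler_wpM2l // addr_ge0 // !mulr_ge0 // ltW.
    move: yg; rewrite sv mulrDl mul1r.
    move=> yg'; rewrite lerBlDl; apply: le_trans yg' _; rewrite !addrA.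
    by apply: lerD => //; rewrite lerD2l.
  move=> h3; apply: le_trans (ler_wpM2l (ltW Q0) h3) _.
  rewrite -Qs; le_eq.
  by move: (1 + _) => u; ring.
have -> : 2 * (Q * (1 + 2 * Q * G) * G + 2 * m) * fn2 Y =
          2 * (Q * (1 + 2 * Q * G) * (G * fn2 Y) + 2 * m * fn2 Y).
  by move: (1 + _) => u; ring.
move: (Q * (wip g k X X - wip g k Z Z)) (Q * (1 + 2 * Q * G) * (G * fn2 Y)) XQ h2.
move: (2 * m * fn2 Y) (fn2 X) => v x w u h3 h4; lra.
Qed.

End Defect.
End Kraus.

(** * Loewner order, operator bounds and the covariance map *)

Section SelfEnergy.
Variables (R : realType) (C : complexField R).

Section Loewner.
Variable n : nat.
Implicit Types (X Y h : 'M[C]_n).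

Lemma lepdP X Y : adjm X = X -> adjm Y = Y ->
  (forall v : 'cV[C]_n, cre (\tr (adjm v *m X *m v)) <= cre (\tr (adjm v *m Y *m v))) ->
  lepd X Y.
Proof.
move=> hX hY le; split; first by rewrite adjmB hX hY.
by move=> v; rewrite mulmxBr mulmxBl linearB /= creB subr_ge0.
Qed.

Lemma lepd_qf X Y m (V : 'M[C]_(n, m)) : lepd X Y ->
  cre (\tr (adjm V *m X *m V)) <= cre (\tr (adjm V *m Y *m V)).
Proof.
by move=> /(psd_tr V); rewrite mulmxBr mulmxBl linearB /= creB subr_ge0.
Qed.

Lemma qf_scalar m (V : 'M[C]_(n, m)) (c : R) :
  cre (\tr (adjm V *m c%:CC%:M *m V)) = c * fn2 V.
Proof. by rewrite mul_mx_scalar -scalemxAl linearZ /= creZ. Qed.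

Lemma lepd_add2 X Y X' Y' : lepd X Y -> lepd X' Y' -> lepd (X + X') (Y + Y').
Proof. by move=> p q; have := psdD p q; rewrite addrACA -opprD. Qed.

Lemma lepdZ (c : R) X Y : 0 <= c -> lepd X Y -> lepd (c%:CC *: X) (c%:CC *: Y).
Proof. by move=> c0 p; rewrite /lepd -scalerBr; apply: psdZ. Qed.

Lemma lepd_scalar (c d : R) : c <= d -> lepd (c%:CC%:M : 'M[C]_n) d%:CC%:M.
Proof.
move=> cd; rewrite /lepd -raddfB /= -rmorphB; apply: psd_scalar.
by rewrite subr_ge0.
Qed.

Lemma lepd_conjr m (V : 'M[C]_(m, n)) X Y : lepd X Y ->
  lepd (V *m X *m adjm V) (V *m Y *m adjm V).
Proof. by move=> p; have := psd_conjr V p; rewrite mulmxBr mulmxBl. Qed.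

Lemma psd_trmx X : psd X -> psd X^T.
Proof.
move=> [hX pX].
have adjT m p (Y : 'M[C]_(m, p)) : adjm Y^T = (adjm Y)^T.
  by apply/matrixP => i j; rewrite !(mxE, adjmE).
split; first by rewrite adjT hX.
move=> v; rewrite -mxtrace_tr !trmx_mul trmxK mulmxA.
have := pX (adjm v)^T; rewrite -adjT adjmK.
by rewrite adjT.
Qed.

Lemma psd_addl X Y : psd Y -> lepd X (X + Y).
Proof. by rewrite /lepd [X + Y]addrC addrK. Qed.

Lemma lepd_psd X Y : psd X -> lepd X Y -> psd Y.
Proof. by move=> p q; have := psdD p q; rewrite addrC subrK. Qed.

(** A Hermitian matrix and its inverse have reciprocal bounds; both follow from
    expanding one square. *)
Lemma lepd_invl h g (H : R) : 0 < H -> psd h -> h *m g = 1%:M -> adjm g = g ->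
  lepd h H%:CC%:M -> lepd (H^-1)%:CC%:M g.
Proof.
move=> H0 ph hg ag hH; apply: lepdP => //; first by rewrite adjm_scalar conj_cinj.
move=> v; rewrite qf_scalar.
pose x := g *m v.
have hx : h *m x = v by rewrite mulmxA hg mul1mx.
have := psd_tr ((H^-1)%:CC *: v - x) ph.
rewrite adjmB adjmZ conj_cinj !mulmxBl !mulmxBr -!scalemxAl -!scalemxAr.
rewrite !mxtraceB !mxtraceZ !creB !creZ -!mulmxA hx.
have -> : adjm x *m (h *m v) = adjm v *m v.
  by rewrite mulmxA -[h in LHS]ph.1 -adjmM hx.
have -> : adjm v *m (g *m v) = adjm x *m v by rewrite /x adjmM ag !mulmxA.
have := lepd_qf v hH; rewrite qf_scalar -mulmxA -/(fn2 v).
move: (cre _) (cre _) (fn2 v) => q r s qs.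
have i0 : 0 <= H^-1 by rewrite invr_ge0 ltW.
have : H^-1 * (H^-1 * r) <= H^-1 * s.
  by rewrite ler_wpM2l // ler_pdivrMl.
move: (H^-1 * s) (H^-1 * (H^-1 * r)) => a1 a2 h1 h2; clear -h1 h2; lra.
Qed.

Lemma lepd_invr h g (e : R) : 0 < e -> psd h -> h *m g = 1%:M -> adjm g = g ->
  lepd e%:CC%:M h -> lepd g (e^-1)%:CC%:M.
Proof.
move=> e0 ph hg ag eh; apply: lepdP => //; first by rewrite adjm_scalar conj_cinj.
move=> v; rewrite qf_scalar.
pose x := g *m v.
have hx : h *m x = v by rewrite mulmxA hg mul1mx.
have := fn2_ge0 (v - e%:CC *: x).
rewrite /fn2 adjmB adjmZ conj_cinj !mulmxBl !mulmxBr -!scalemxAl -!scalemxAr.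
rewrite !mxtraceB !mxtraceZ !creB !creZ.
have -> : adjm v *m x = adjm x *m v.
  by rewrite /x adjmM ag mulmxA.
have -> : adjm v *m g *m v = adjm x *m v by rewrite /x adjmM ag.
have := lepd_qf x eh; rewrite qf_scalar -mulmxA hx -/(fn2 v) -/(fn2 x).
rewrite ler_pdivlMl //.
move: (cre _) (fn2 v) (fn2 x) => q s r h1 h2.
have := ler_wpM2l (ltW e0) h1.
by move: (e * (e * r)) (e * q) h2 => a1 a2 r1 r2; clear -r1 r2; lra.
Qed.

End Loewner.

Definition imm n (M : 'M[C]_n) : 'M[C]_n := (2 * 'i)^-1 *: (M - adjm M).

Lemma twoi_neq0 : 2 * 'i != 0 :> C.
Proof. by rewrite mulf_neq0 ?neq0Ci // pnatr_eq0. Qed.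

Lemma immE n (M : 'M[C]_n) : M - adjm M = (2 * 'i) *: imm M.
Proof. by rewrite scalerA mulfV ?scale1r // twoi_neq0. Qed.

Lemma adjm_imm n (M : 'M[C]_n) : adjm (imm M) = imm M.
Proof.
rewrite /imm adjmZ adjmB adjmK -opprB scalerN -scaleNr; congr (_ *: _).
rewrite rmorphV ?unitfE ?twoi_neq0 //= rmorphM /= conjCi conjC_nat mulrN invrN opprK.
by [].
Qed.

Lemma imm_qf n m (M : 'M[C]_n) (V : 'M[C]_(n, m)) :
  cre (\tr (adjm V *m imm M *m V)) = cim (\tr (adjm V *m M *m V)).
Proof.
rewrite /imm -scalemxAr -scalemxAl linearZ /= mulmxBr mulmxBl linearB /=.
have -> : \tr (adjm V *m adjm M *m V) = (\tr (adjm V *m M *m V))^*.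
  by rewrite -mxtrace_adj !adjmM adjmK mulmxA.
set x := \tr _.
have -> : x - x^* = (2 * 'i) * (cim x)%:CC.
  rewrite cimE {1 2}[x]Crect conjC_rect ?Creal_Re ?Creal_Im //.
  by move: ('Re x) ('Im x) => a b; ring.
by rewrite mulrA mulVf ?twoi_neq0 // mul1r cre_inj.
Qed.

Section OperatorBounds.
Variable n : nat.
Implicit Types (X Y : 'M[C]_n).

(** [opb m X] bounds the square of the operator norm of [X] by [m]. *)
Definition opb (m : R) X := forall p (V : 'M[C]_(n, p)), fn2 (X *m V) <= m * fn2 V.

Lemma opbD m m' X Y : opb m X -> opb m' Y -> opb (2 * m + 2 * m') (X + Y).
Proof.
move=> bX bY p V; rewrite mulmxDl; apply: le_trans (fn2D_le _ _) _.
have -> : (2 * m + 2 * m') * fn2 V = 2 * (m * fn2 V) + 2 * (m' * fn2 V) by ring.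
by apply: lerD; rewrite ler_pM2l.
Qed.

Lemma opbN m X : opb m X -> opb m (- X).
Proof. by move=> bX p V; rewrite mulNmx fn2N. Qed.

Lemma opb_scalar (a : C) : opb (cnorm a ^+ 2) (a%:M : 'M[C]_n).
Proof. by move=> p V; rewrite mul_scalar_mx fn2Z. Qed.

Lemma opb_le m m' X : m <= m' -> opb m X -> opb m' X.
Proof.
by move=> mm bX p V; apply: le_trans (bX _ _) _; rewrite ler_wpM2r // fn2_ge0.
Qed.

(** Young's inequality for the inner product of [X X^* V] with [V]. *)
Lemma opb_adj m X : 0 < m -> opb m X -> opb m (adjm X).
Proof.
move=> m0 bX p V; set U := adjm X *m V.
have := wip_le_young ((m^-1)%:CC *: (X *m U)) V (psd1 _ n) (psd1 _ p).
rewrite !wipZl wipZr -!fn2_wip.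
have -> : wip 1%:M 1%:M (X *m U) V = fn2 U.
  by rewrite /wip !mulmx1 adjmM -mulmxA.
have := bX _ U; have mi : 0 < m^-1 by rewrite invr_gt0.
move=> h; have h2 : m^-1 * (m^-1 * fn2 (X *m U)) <= m^-1 * fn2 U.
  by rewrite ler_pM2l // ler_pdivrMl.
rewrite -ler_pdivrMl //.
move: h2; move: (m^-1 * (m^-1 * _)) (m^-1 * fn2 U) (fn2 V) => *; lra.
Qed.

Lemma opb_mulr m p X (V : 'M[C]_(p, n)) : 0 < m -> opb m X -> fn2 (V *m X) <= m * fn2 V.
Proof.
move=> m0 bX; rewrite -fn2_adj adjmM -(fn2_adj V).
exact: (opb_adj m0 bX).
Qed.

Lemma opb_fn2 m X : opb m X -> fn2 X <= m * n%:R.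
Proof.
move=> /(_ _ 1%:M); rewrite mulmx1 -(rmorph1 (cinj C)) fn2_scalar.
by rewrite cnorm_real normr1 expr1n mulr1.
Qed.

End OperatorBounds.

(** The covariance map [X |-> E (W X W)], in terms of the covariance [g] of the
    entries of [W]. *)
Definition covform n (g : 'I_n * 'I_n -> 'I_n * 'I_n -> C) (X : 'M[C]_n) : 'M[C]_n :=
  \matrix_(i, j) \sum_a \sum_b g (i, a) (b, j) * X a b.

(** The operator norm of [g], read as a matrix on pairs of indices. *)
Definition covbound n (g : 'I_n * 'I_n -> 'I_n * 'I_n -> C) (c : R) : Prop :=
  forall x : 'I_n * 'I_n -> C,
    \sum_be cnorm (\sum_al g al be * x al) ^+ 2 <= c ^+ 2 * \sum_al cnorm (x al) ^+ 2.

(** What is used of the covariance map [S]: it is completely positive and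
    symmetric, it dominates a multiple of that of the Gaussian orthogonal
    ensemble, and its coefficients form a bounded operator on pairs of indices. *)
Record self_energy n (c0 C2 : R) (S : 'M[C]_n -> 'M[C]_n) : Prop := SelfEnergy {
  se_kraus : kraus S;
  se_split : exists Phi, kraus Phi /\ forall X,
    S X = Phi X + (c0%:CC * normtr X)%:M + (c0 / n%:R)%:CC *: X^T;
  se_cov : exists g, [/\ covbound g (C2 / n%:R), forall al be, g al be = g be al &
    forall X, S X = covform g X] }.

Section SelfEnergyBounds.
Variables (n : nat) (c0 C2 : R) (S : 'M[C]_n -> 'M[C]_n).
Hypothesis n_gt0 : (0 < n)%N.
Hypothesis C2_gt0 : 0 < C2.
Hypothesis hS : self_energy c0 C2 S.

Lemma se_adj X : S (adjm X) = adjm (S X).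
Proof. exact: kraus_adj (se_kraus hS) X. Qed.

Lemma n_R_gt0 : 0 < n%:R :> R.
Proof. by rewrite ltr0n. Qed.

Lemma two_mul_le (s x y : R) : 0 < s -> 2 * (x * y) <= s^-1 * x ^+ 2 + s * y ^+ 2.
Proof.
move=> s0; have i0 : 0 <= s^-1 by rewrite invr_ge0 ltW.
have := mulr_ge0 i0 (sqr_ge0 (x - s * y)).
have -> : s^-1 * (x - s * y) ^+ 2 = s^-1 * x ^+ 2 + s * y ^+ 2 - 2 * (x * y).
  by field; rewrite gt_eqF.
by rewrite subr_ge0.
Qed.

(** Applied to the vectors supported on the index pairs [(i, a)] with a fixed
    [a], the bound on the coefficients controls [S(1)]. *)
Lemma se_unit_le : lepd (S 1%:M) C2%:CC%:M.
Proof.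
have [g [bg _ Sg]] := se_cov hS.
apply: lepdP; first by rewrite -se_adj adjm1.
  by rewrite adjm_scalar conj_cinj.
move=> u; rewrite qf_scalar.
set c := C2 / n%:R; have c_gt0 : 0 < c by rewrite divr_gt0 // n_R_gt0.
pose y a be := \sum_al g al be * (if al.2 == a then (u al.1 0)^* else 0).
have e1 : \tr (adjm u *m S 1%:M *m u) = \sum_a \sum_j y a (a, j) * u j 0.
  rewrite trace_mx11 mxE exchange_big /=; apply: eq_bigr => j _.
  rewrite -mulr_suml; congr (_ * _).
  rewrite mxE.
  under eq_bigr => i _ do rewrite Sg !mxE mulr_sumr.
  rewrite exchange_big /=; apply: eq_bigr => a _.
  rewrite /y sum_pairE /=.
  apply: eq_bigr => i _; rewrite (bigD1 a) //= big1 ?addr0 => [|b /negPf ba].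
    rewrite (bigD1 a) //= eqxx big1 ?addr0 => [|b /negPf ->]; last by rewrite mulr0.
    by rewrite !mxE eqxx mulr1 mulrC.
  by rewrite !mxE eq_sym ba mulr0.
have fu : fn2 u = \sum_i cnorm (u i 0) ^+ 2.
  by rewrite fn2E; apply: eq_bigr => i _; rewrite big_ord1.
have ya a : \sum_be cnorm (y a be) ^+ 2 <= c ^+ 2 * fn2 u.
  apply: le_trans (bg _) _; rewrite ler_wpM2l ?sqr_ge0 //.
  rewrite sum_pairE /= fu.
  apply: ler_sum => i _; rewrite (bigD1 a) //= eqxx big1 ?addr0 ?cnorm_conj //.
  by move=> b /negPf ->; rewrite cnorm0 expr0n.
have ha a : cre (\sum_j y a (a, j) * u j 0) <= c * fn2 u.
  have h1 : cre (\sum_j y a (a, j) * u j 0) <=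
            \sum_j (2^-1 * (c^-1 * cnorm (y a (a, j)) ^+ 2 + c * cnorm (u j 0) ^+ 2)).
    rewrite cre_sum; apply: ler_sum => j _.
    apply: le_trans (ler_norm _) _; apply: le_trans (cre_le_cnorm _) _.
    by rewrite cnormM ler_pdivlMl // two_mul_le.
  apply: le_trans h1 _; rewrite -mulr_sumr big_split /= -!mulr_sumr -fu.
  have h2 : \sum_j cnorm (y a (a, j)) ^+ 2 <= c ^+ 2 * fn2 u.
    apply: le_trans (ya a).
    rewrite [X in _ <= X]sum_pairE [X in _ <= X](bigD1 a) //=.
    by rewrite lerDl; apply: sumr_ge0 => b _; apply: sumr_ge0 => j _; apply: sqr_ge0.
  have h3 : c^-1 * \sum_j cnorm (y a (a, j)) ^+ 2 <= c * fn2 u.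
    by rewrite ler_pdivrMl // mulrA -expr2.
  by move: (c^-1 * _) (c * fn2 u) h3 => a1 a2 h3; lra.
rewrite e1 cre_sum; apply: le_trans (ler_sum _ (fun a _ => ha a)) _.
rewrite sumr_const card_ord -mulr_natl mulrA (_ : n%:R * c = C2) //.
by rewrite mulrC divfK // gt_eqF // n_R_gt0.
Qed.

Lemma se_le (H : R) X : 0 <= H -> lepd X H%:CC%:M -> lepd (S X) (C2 * H)%:CC%:M.
Proof.
move=> H0 XH; apply: lepd_trans (kraus_le (se_kraus hS) XH) _.
rewrite -scalemx1 (krausZ (se_kraus hS)) mulrC rmorphM /= -scale_scalar_mx.
exact: lepdZ se_unit_le.
Qed.

(** The operator Cauchy-Schwarz inequality over the Kraus operators, with the
    bound on [S(1)]. *)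
Lemma se_opb m X : 0 <= m -> opb m X -> opb (C2 ^+ 2 * m) (S X).
Proof.
move=> m0 bX p V; have [I [G [SE _]]] := se_kraus hS.
set U := S X *m V; set s := C2^-1.
have s0 : 0 < s by rewrite invr_gt0.
have unit q (W : 'M[C]_(n, q)) : \sum_i fn2 (adjm (G i) *m W) <= C2 * fn2 W.
  have := lepd_qf W se_unit_le; rewrite qf_scalar SE mulmx_sumr mulmx_suml mxtrace_sum.
  rewrite cre_sum; apply: le_trans; apply: ler_sum => i _.
  by rewrite /fn2 mulmx1 adjmM adjmK !mulmxA.
have e : fn2 U = \sum_i wip 1%:M 1%:M (adjm (G i) *m U) (X *m adjm (G i) *m V).
  rewrite {1}/fn2 {2}/U SE mulmx_suml mulmx_sumr mxtrace_sum cre_sum.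
  by apply: eq_bigr => i _; rewrite /wip !mulmx1 adjmM adjmK !mulmxA.
have h : 2 * (s * fn2 U) <= s ^+ 2 * (C2 * fn2 U) + m * (C2 * fn2 V).
  rewrite [in X in X <= _]e mulr_sumr mulr_sumr.
  apply: (@le_trans _ _ (s ^+ 2 * \sum_i fn2 (adjm (G i) *m U) +
                         m * \sum_i fn2 (adjm (G i) *m V))); last first.
    by apply: lerD; rewrite ler_wpM2l ?sqr_ge0.
  rewrite !mulr_sumr -big_split /=; apply: ler_sum => i _.
  have := wip_le_young (s%:CC *: (adjm (G i) *m U)) (X *m adjm (G i) *m V)
    (psd1 _ n) (psd1 _ p).
  rewrite !wipZl wipZr -!fn2_wip [s * (s * _)]mulrA -expr2 => h1; apply: le_trans h1 _.
  by rewrite lerD2l -mulmxA.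
have e2 : s ^+ 2 * (C2 * fn2 U) = s * fn2 U.
  by rewrite /s; field; rewrite gt_eqF.
move: h; rewrite e2 => h.
have : s * fn2 U <= m * (C2 * fn2 V).
  by move: (s * fn2 U) (m * (C2 * fn2 V)) h => a b h; lra.
rewrite /s ler_pdivrMl // => h3; apply: le_trans h3 _.
by le_eq; ring.
Qed.

End SelfEnergyBounds.
End SelfEnergy.

(** * The matrix Dyson equation *)

Section Dyson.
Variables (R : realType) (C : complexField R).
Variables (n : nat) (c0 C2 : R) (S : 'M[C]_n -> 'M[C]_n) (A : 'M[C]_n).

(** The imaginary part of [M], with the sign that makes it positive. *)
Definition habs (z : C) (M : 'M[C]_n) : 'M[C]_n := (Num.sg (cim z))%:CC *: imm M.

Definition mdesol (z : C) (M : 'M[C]_n) : Prop :=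
  [/\ M \in unitmx, - invmx M = z%:M - A + S M &
      forall v : 'cV[C]_n, v != 0 -> 0 < cre (\tr (adjm v *m habs z M *m v))].

(** By the Ward identities below this is [M^-1 h (M^-1)^*] for [h] the imaginary
    part of [M]. *)
Definition kweight (z : C) (M : 'M[C]_n) : 'M[C]_n :=
  (`|cim z|)%:CC%:M + S (habs z M).

Hypothesis c0_gt0 : 0 < c0.
Hypothesis hS : self_energy c0 C2 S.
Hypothesis hA : adjm A = A.

Section OnePoint.
Variables (z : C) (M : 'M[C]_n).
Hypothesis hM : mdesol z M.
Let h := habs z M.
Let k := kweight z M.

Lemma mde_unit : M \in unitmx. Proof. by case: hM. Qed.

Lemma mde_eq : invmx M = A - z%:M - S M.
Proof. by case: hM => _ e _; rewrite -[LHS]opprK e opprD opprB. Qed.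

Lemma adjm_habs : adjm h = h.
Proof. by rewrite /h /habs adjmZ conj_cinj adjm_imm. Qed.

Lemma psd_habs : psd h.
Proof.
split; first exact: adjm_habs.
move=> v; have [->|v0] := eqVneq v 0; last by case: hM => _ _ /(_ _ v0) /ltW.
by rewrite mulmx0 mxtrace0 cre0.
Qed.

Lemma habs_inj (v : 'cV[C]_n) : h *m v = 0 -> v = 0.
Proof.
move=> hv; apply/eqP; apply/negP => /negP v0.
by case: hM => _ _ /(_ _ v0); rewrite -mulmxA hv mulmx0 mxtrace0 cre0 ltxx.
Qed.

Lemma habs_unit : h \in unitmx.
Proof.
rewrite -unitmx_tr -row_free_unit -kermx_eq0; apply/eqP.
apply/row_matrixP => i; rewrite row0; apply: trmx_inj; rewrite trmx0.
apply: habs_inj; apply: trmx_inj; rewrite trmx_mul trmxK trmx0.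
by rewrite -row_mul mulmx_ker row0.
Qed.

Lemma psd_kweight : psd k.
Proof.
apply: psdD; first exact: psd_scalar.
exact: (kraus_psd (se_kraus hS) psd_habs).
Qed.

Lemma resolvent_imm :
  invmx (adjm M) - invmx M = (2 * 'i) *: ((cim z)%:CC%:M + S (imm M)).
Proof.
have e := mde_eq.
have e' : invmx (adjm M) = A - (z^* )%:M - S (adjm M).
  by rewrite -adjm_inv e !adjmB hA adjm_scalar (se_adj hS).
rewrite e' e [RHS]scalerDr -(krausZ (se_kraus hS)) -immE.
rewrite (krausB (se_kraus hS)) scale_scalar_mx.
have -> : 2 * 'i * (cim z)%:CC = z - z^*.
  rewrite cimE {2 3}[z]Crect conjC_rect ?Creal_Re ?Creal_Im //.
  by move: ('Re z) ('Im z) => a b; ring.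
rewrite [(z - _)%:M]raddfB /=; move: (S M) (S _) (z%:M) ((z^* )%:M) => a b c d.
apply/matrixP => i j; rewrite !mxE; ring.
Qed.

Lemma sg_kweight : (Num.sg (cim z))%:CC *: ((cim z)%:CC%:M + S (imm M)) = k.
Proof.
rewrite scalerDr scale_scalar_mx -rmorphM /= -normrEsg.
by rewrite /k /kweight /habs (krausZ (se_kraus hS)).
Qed.

Lemma ward_gen (P Q : 'M[C]_n) :
  P *m (invmx (adjm M) - invmx M) *m Q = (2 * 'i) *: imm M ->
  P *m k *m Q = h.
Proof.
rewrite resolvent_imm -scalemxAr -scalemxAl => /(scalerI (twoi_neq0 C)) e.
by rewrite -sg_kweight -scalemxAr -scalemxAl e.
Qed.

(** Ward identities: conjugating the imaginary part of [- M^-1] by [M]. *)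
Lemma ward : M *m k *m adjm M = h.
Proof.
apply: ward_gen; rewrite -immE mulmxBr mulmxBl mulmxV ?mde_unit // mul1mx.
by rewrite mulmxKV // adjm_unit mde_unit.
Qed.

Lemma ward' : adjm M *m k *m M = h.
Proof.
apply: ward_gen; rewrite -immE mulmxBr mulmxBl mulmxV ?adjm_unit ?mde_unit //.
by rewrite mul1mx mulmxKV // mde_unit.
Qed.

Lemma kweight_ge_im : lepd (`|cim z|)%:CC%:M k.
Proof. apply: psd_addl; exact: (kraus_psd (se_kraus hS) psd_habs). Qed.

Lemma Sh_le_k : lepd (S h) k.
Proof. by rewrite /k /kweight addrC; apply: psd_addl; apply: psd_scalar. Qed.

Lemma ward_S_le : lepd (M *m S h *m adjm M) h.
Proof. by have := lepd_conjr M Sh_le_k; rewrite ward. Qed.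

Lemma cre_normtr_habs (tau : R) : tau = cre (normtr h) -> normtr h = tau%:CC.
Proof.
move=> ->; rewrite cre_real //.
have : \tr h \is Num.real by apply/CrealP; rewrite -mxtrace_adj adjm_habs.
by move=> tr; rewrite /normtr realM // realV realn.
Qed.

(** On positive matrices [S] dominates what is left of it without the
    transposition. *)
Lemma flat_split : exists Phi, [/\ kraus Phi,
  forall X, S X = Phi X + (c0%:CC * normtr X)%:M + (c0 / n%:R)%:CC *: X^T &
  forall X, psd X -> lepd (Phi X + (c0%:CC * normtr X)%:M) (S X)].
Proof.
have [Phi [kPhi SE]] := se_split hS; exists Phi; split=> // X pX.
rewrite SE; apply: psd_addl; apply: psdZ; last exact: psd_trmx.
by rewrite divr_ge0 // ltW.
Qed.

Lemma flat_le (thr : R) : thr <= cre (normtr h) -> lepd (c0 * thr)%:CC%:M k.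
Proof.
move=> tle; have [Phi [kPhi SE le]] := flat_split.
apply: lepd_trans Sh_le_k; apply: lepd_trans (le _ psd_habs).
rewrite (@cre_normtr_habs (cre (normtr h))) // -rmorphM /= addrC.
apply: lepd_trans; last by apply: psd_addl; apply: (kraus_psd kPhi psd_habs).
by apply: lepd_scalar; rewrite ler_pM2l.
Qed.

End OnePoint.

(** Quantitative control of a solution by a single constant. *)
Record bulk (B : R) (z : C) (M : 'M[C]_n) : Prop := Bulk {
  bulk_sol : mdesol z M;
  bulk_im : 0 < `|cim z| <= 1;
  bulk_ge1 : 1 <= B;
  bulk_M : opb B M;
  bulk_adjM : opb B (adjm M);
  bulk_hl : lepd (B^-1)%:CC%:M (habs z M);
  bulk_hu : lepd (habs z M) B%:CC%:M;
  bulk_kl : lepd (B^-1)%:CC%:M (kweight z M);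
  bulk_ku : lepd (kweight z M) B%:CC%:M;
  bulk_thr : B^-1 <= cre (normtr (habs z M)) }.

(** Young's inequality for the inner product of [V] with [M V]. *)
Lemma habs_young (z : C) M p (V : 'M[C]_(n, p)) (r : R) : 0 < r ->
  2 * cre (\tr (adjm V *m habs z M *m V)) <= r^-1 * fn2 V + r * fn2 (M *m V).
Proof.
move=> r0; rewrite /habs -scalemxAr -scalemxAl linearZ /= creZ imm_qf.
set x := \tr _.
have hx (e : R) : `|e| <= 1 -> 2 * (e * cim x) <= r^-1 * fn2 V + r * fn2 (M *m V).
  move=> e1.
  pose u : C := e%:CC * (- 'i).
  have ex : e * cim x = wip 1%:M 1%:M V (u *: (M *m V)).
    rewrite /wip !mulmx1 -scalemxAr linearZ /= /u -mulrA creZ mulmxA -/x.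
    by [].
  have uu : cnorm u <= 1.
    by rewrite /u cnormM cnorm_real cnormN cnorm_i mulr1.
  have := wip_le_young V (r%:CC *: (u *: (M *m V))) (psd1 C n) (psd1 C p).
  rewrite !wipZr wipZl -ex -!fn2_wip fn2Z => h.
  have i0 : 0 <= r^-1 by rewrite invr_ge0 ltW.
  have := ler_wpM2l i0 h.
  have -> : r^-1 * (2 * (r * (e * cim x))) = 2 * (e * cim x).
    by field; rewrite gt_eqF.
  move=> h2; apply: le_trans h2 _; rewrite mulrDr lerD2l.
  rewrite (_ : r^-1 * (r * (r * _)) = r * (cnorm u ^+ 2 * fn2 (M *m V))); last first.
    by field; rewrite gt_eqF.
  rewrite ler_pM2l // -[X in _ <= X]mul1r ler_wpM2r ?fn2_ge0 //.
  by rewrite expr_le1 ?cnorm_ge0.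
apply: hx; case: (ltrgt0P (cim z)) => [? | ? | ->].
- by rewrite gtr0_sg // normr1.
- by rewrite ltr0_sg // normrN1.
- by rewrite sgr0 normr0.
Qed.

(** If the weight [k] is at least [T], the Ward identity bounds [M]. *)
Section KweightLower.
Variables (z : C) (M : 'M[C]_n) (T : R).
Hypothesis hM : mdesol z M.
Hypothesis T_gt0 : 0 < T.
Hypothesis hT : lepd T%:CC%:M (kweight z M).

Lemma ward_lower p (V : 'M[C]_(n, p)) :
  T * fn2 (M *m V) <= cre (\tr (adjm V *m habs z M *m V)).
Proof.
rewrite -(ward' hM); have := lepd_qf (M *m V) hT.
by rewrite qf_scalar adjmM !mulmxA.
Qed.

Lemma ward_lower' p (V : 'M[C]_(n, p)) :
  T * fn2 (adjm M *m V) <= cre (\tr (adjm V *m habs z M *m V)).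
Proof.
rewrite -(ward hM); have := lepd_qf (adjm M *m V) hT.
by rewrite qf_scalar adjmM adjmK !mulmxA.
Qed.

Lemma mde_opb : opb (T ^+ 2)^-1 M.
Proof.
move=> p V; have := habs_young z M V T_gt0; have := ward_lower V.
move=> h1 h2; have h3 : T * fn2 (M *m V) <= T^-1 * fn2 V.
  by move: (T * _) (T^-1 * _) (cre _) h1 h2 => a b c *; lra.
by rewrite expr2 invfM -mulrA -ler_pdivrMl ?invr_gt0 // invrK.
Qed.

Lemma mde_habs_le : lepd (habs z M) (1 + (T ^+ 2)^-1)%:CC%:M.
Proof.
have i0 : 0 < (T ^+ 2)^-1 by rewrite invr_gt0 exprn_gt0.
apply: lepdP => [||v]; rewrite ?adjm_habs ?adjm_scalar ?conj_cinj // qf_scalar.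
have := habs_young z M v ltr01; rewrite invr1 !mul1r => h1.
have := mde_opb v; have := fn2_ge0 v => h2 h3.
have := mulr_ge0 (ltW i0) h2; rewrite [(1 + _^-1) * _]mulrDl mul1r.
by move: (fn2 v) (fn2 (M *m v)) (_^-1 * fn2 v) (cre _) h1 h2 h3 => d b c a *; lra.
Qed.

End KweightLower.
End Dyson.

Section Bulk.
Variables (R : realType) (C : complexField R).

(** A lower bound on the normalized trace of [Im M] and the flatness of [S]
    bound [M] through the Ward identity. The equation then bounds first [z] and
    next [M^-1], and everything else follows. *)
Lemma bulk_exists (c0 C2 CA thr : R) : 0 < c0 -> 0 < C2 -> 0 < thr ->
  exists B : R, 1 <= B /\
  forall n (S : 'M[C]_n -> 'M[C]_n) (A : 'M[C]_n), (0 < n)%N ->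
    self_energy c0 C2 S -> adjm A = A -> opb (CA ^+ 2) A ->
  forall z M, 0 < `|cim z| <= 1 -> mdesol S A z M ->
    thr <= cre (normtr (habs z M)) -> bulk S A B z M.
Proof.
move=> c00 C20 t0.
set T := c0 * thr; have T0 : 0 < T by rewrite mulr_gt0.
set m := (T ^+ 2)^-1; have m0 : 0 < m by rewrite invr_gt0 exprn_gt0.
set Zc := (4 * CA ^+ 2 * m + 4 * C2 ^+ 2 * m ^+ 2 + 2) / thr ^+ 2.
have num0 : 0 < 4 * CA ^+ 2 * m + 4 * C2 ^+ 2 * m ^+ 2 + 2.
  by posr.
have Zc0 : 0 < Zc by rewrite /Zc; posr.
set mi := 2 * (2 * CA ^+ 2 + 2 * Zc) + 2 * (C2 ^+ 2 * m).
have mi0 : 0 < mi.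
  by rewrite /mi; posr.
set ku := 1 + C2 * (1 + m); have ku0 : 0 < ku.
  by rewrite /ku; posr.
have iT0 : 0 < T^-1 by rewrite invr_gt0.
have miT0 : 0 < mi / T by rewrite mulr_gt0.
have it0 : 0 < thr^-1 by rewrite invr_gt0.
set B := 1 + m + mi + mi / T + T^-1 + ku + thr^-1.
have [[B1 Bm Bmi BmiT] [BT Bku Bthr]] : [/\ 1 + m <= B, m <= B, mi <= B & mi / T <= B] /\
    [/\ T^-1 <= B, ku <= B & thr^-1 <= B].
  by rewrite /B; move: (mi / T) (T^-1) (thr^-1) miT0 iT0 it0 => a b c *; split; split; lra.
have B0 : 0 < B by apply: lt_le_trans Bm.
have BV a : 0 < a -> a^-1 <= B -> B^-1 <= a.
  by move=> a0 h; rewrite -[a]invrK lef_pV2 ?posrE ?invr_gt0.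
have B_ge1 : 1 <= B by apply: le_trans B1; rewrite lerDl ltW.
exists B; split=> // n S A n0 hS hA bA z M /andP[z0 z1] hM tle.
have n0R : 0 < n%:R :> R by rewrite ltr0n.
have hT : lepd T%:CC%:M (kweight S z M) by exact: (flat_le c00 hS hM tle).
have hh := adjm_habs z M.
have wardT' := @ward_lower' _ _ _ _ _ _ _ hS hA _ _ _ hM hT.
have bM : opb m M := mde_opb hS hA hM T0 hT.
have bM' : opb m (adjm M) by apply: opb_adj.
have hu : lepd (habs z M) (1 + m)%:CC%:M := mde_habs_le hS hA hM T0 hT.
have hkuu : lepd (kweight S z M) ku%:CC%:M.
  have m1 : 0 <= 1 + m by rewrite addr_ge0 // ltW.
  have := lepd_add2 (lepd_scalar C n z1) (se_le n0 C20 hS m1 hu).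
  by rewrite /ku rmorphD raddfD.
have fM : n%:R * thr ^+ 2 <= fn2 M.
  have := habs_young z M 1%:M it0; rewrite adjm1 mul1mx !mulmx1 invrK.
  rewrite normtr_trace // cre_nat -(rmorph1 (cinj C)) fn2_scalar cnorm_real normr1.
  rewrite expr1n mulr1 => h1.
  have h2 : n%:R * thr <= n%:R * cre (normtr (habs z M)) by rewrite ler_pM2l.
  rewrite expr2 mulrA -ler_pdivlMr // [fn2 M / _]mulrC.
  rewrite [thr * _]mulrC in h1.
  by move: (n%:R * thr) (thr^-1 * fn2 M) (n%:R * cre _) h1 h2 => a b c h1 h2; lra.
have zb : cnorm z ^+ 2 <= Zc.
  have e : z *: M = A *m M - S M *m M - 1%:M.
    have := mulVmx (mde_unit hM); rewrite (mde_eq hM) !mulmxBl mul_scalar_mx => h.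
    by rewrite -h; apply/matrixP => i j; rewrite !mxE; ring.
  have := congr1 (@fn2 R C n n) e; rewrite fn2Z => e1.
  have f1 : fn2 (1%:M : 'M[C]_n) = n%:R.
    by rewrite -(rmorph1 (cinj C)) fn2_scalar cnorm_real normr1 expr1n mulr1.
  have h1 : fn2 (A *m M - S M *m M - 1%:M) <=
            2 * (2 * fn2 (A *m M) + 2 * fn2 (S M *m M)) + 2 * n%:R.
    apply: le_trans (fn2B_le _ _) _; rewrite f1 lerD2r ler_pM2l //; exact: fn2B_le.
  have h2 : fn2 (A *m M) <= CA ^+ 2 * (m * n%:R).
    apply: le_trans (bA _ _) _; rewrite ler_wpM2l ?sqr_ge0 //; exact: (opb_fn2 bM).
  have h3 : fn2 (S M *m M) <= C2 ^+ 2 * m * (m * n%:R).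
    apply: le_trans (se_opb n0 C20 hS (ltW m0) bM _) _.
    by apply: ler_wpM2l; [posr | exact: (opb_fn2 bM)].
  rewrite /Zc ler_pdivlMr ?exprn_gt0 // -(ler_pM2l n0R).
  have h4 : cnorm z ^+ 2 * (n%:R * thr ^+ 2) <= cnorm z ^+ 2 * fn2 M.
    by rewrite ler_wpM2l ?sqr_ge0.
  have -> : n%:R * (cnorm z ^+ 2 * thr ^+ 2) = cnorm z ^+ 2 * (n%:R * thr ^+ 2) by ring.
  apply: le_trans h4 _; rewrite e1; apply: le_trans h1 _.
  have -> : n%:R * (4 * CA ^+ 2 * m + 4 * C2 ^+ 2 * m ^+ 2 + 2) =
     2 * (2 * (CA ^+ 2 * (m * n%:R)) + 2 * (C2 ^+ 2 * m * (m * n%:R))) + 2 * n%:R by ring.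
  by rewrite lerD2r ler_pM2l //; apply: lerD; rewrite ler_pM2l.
have bV : opb mi (invmx M).
  rewrite (mde_eq hM); apply: opbD; last first.
    by apply: opbN; exact: (se_opb n0 C20 hS (ltW m0) bM).
  apply: opbD => //; apply: opbN; apply: opb_le zb _; exact: opb_scalar.
have bV' : opb mi (adjm (invmx M)) by apply: opb_adj.
have hl : lepd (T / mi)%:CC%:M (habs z M).
  apply: lepdP => [||v]; rewrite ?adjm_scalar ?conj_cinj // qf_scalar.
  apply: le_trans (wardT' _ v).
  rewrite -mulrA ler_pM2l // ler_pdivrMl //.
  have := bV' _ (adjm M *m v); rewrite mulmxA -adjmM mulmxV ?adjm1 ?mul1mx //.
  exact: mde_unit hM.
have lower (X : 'M[C]_n) a : 0 < a -> a^-1 <= B -> lepd a%:CC%:M X -> lepd (B^-1)%:CC%:M X.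
  by move=> a0 ab; apply: lepd_trans; apply: lepd_scalar; apply: BV.
have upper (X : 'M[C]_n) a : a <= B -> lepd X a%:CC%:M -> lepd X B%:CC%:M.
  by move=> ab lX; apply: lepd_trans lX _; apply: lepd_scalar.
split=> //.
- by rewrite z0.
- exact: opb_le bM.
- exact: opb_le bM'.
- by apply: lower hl; rewrite ?invf_div // divr_gt0.
- exact: upper hu.
- exact: lower hT.
- exact: upper hkuu.
- by apply: le_trans tle; apply: BV.
Qed.
End Bulk.

(** * Stability operators *)

Section FrobeniusBounds.
Variables (R : realType) (C : complexField R).

(** Lagrange's identity. *)
Lemma sum_CS (I : finType) (a b : I -> R) :
  (\sum_i a i * b i) ^+ 2 <= (\sum_i a i ^+ 2) * (\sum_i b i ^+ 2).
Proof.
have : 0 <= \sum_i \sum_j (a i * b j - a j * b i) ^+ 2.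
  by apply: sumr_ge0 => i _; apply: sumr_ge0 => j _; apply: sqr_ge0.
have -> : \sum_i \sum_j (a i * b j - a j * b i) ^+ 2 =
    \sum_i \sum_j a i ^+ 2 * b j ^+ 2 + \sum_i \sum_j b i ^+ 2 * a j ^+ 2 -
    2 * \sum_i \sum_j (a i * b i) * (a j * b j).
  rewrite mulr_sumr -big_split -sumrB; apply: eq_bigr => i _ /=.
  rewrite mulr_sumr -big_split -sumrB; apply: eq_bigr => j _ /=; ring.
by rewrite -!big_distrlr /=; nra.
Qed.

Lemma cnorm_sum_CS (I : finType) (x y : I -> C) :
  cnorm (\sum_i x i * y i) ^+ 2 <=
  (\sum_i cnorm (x i) ^+ 2) * (\sum_i cnorm (y i) ^+ 2).
Proof.
apply: le_trans (sum_CS _ _); rewrite ler_pXn2r ?nnegrE ?cnorm_ge0 //.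
  apply: le_trans (cnorm_sum _ _ _) _; apply: ler_sum => i _.
  by rewrite cnormM.
by apply: sumr_ge0 => i _; rewrite mulr_ge0 ?cnorm_ge0.
Qed.

Lemma fn2M_le m n p (X : 'M[C]_(m, n)) (Y : 'M[C]_(n, p)) :
  fn2 (X *m Y) <= fn2 X * fn2 Y.
Proof.
rewrite !fn2E mulr_suml; apply: ler_sum => i _.
rewrite [X in _ * X]exchange_big /= mulr_sumr; apply: ler_sum => j _.
by rewrite mxE; apply: cnorm_sum_CS.
Qed.

Lemma opb_of_le n (g : 'M[C]_n) (B : R) : 0 < B -> psd g -> lepd g B%:CC%:M ->
  opb (B ^+ 2) g.
Proof.
move=> B0 pg gB p V; set U := g *m V.
have := wip_le_young ((B^-1)%:CC *: U) V pg (psd1 C p).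
rewrite !wipZl wipZr.
have -> : wip g 1%:M U V = fn2 U.
  by rewrite /wip /fn2 mulmx1 -mulmxA.
have hU : wip g 1%:M U U <= B * fn2 U.
  by apply: le_trans (wip_lel U gB (psd1 C p)) _; rewrite wip_scalarl fn2_wip.
have hV : wip g 1%:M V V <= B * fn2 V.
  by apply: le_trans (wip_lel V gB (psd1 C p)) _; rewrite wip_scalarl fn2_wip.
have i0 : 0 < B^-1 by rewrite invr_gt0.
have h2 : B^-1 * (B^-1 * wip g 1%:M U U) <= B^-1 * fn2 U.
  by rewrite ler_pM2l // ler_pdivrMl.
move=> h; rewrite expr2 -mulrA -ler_pdivrMl //.
move: h h2 hV; move: (B^-1 * (B^-1 * _)) (B^-1 * fn2 U) (wip g _ V V) (B * fn2 V).
by move=> a1 a2 a3 a4 *; lra.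
Qed.

(** The difference of [M] and its adjoint is what prevents the same-side
    stability operator from having a kernel. *)
Lemma habs_sep n (z : C) (M : 'M[C]_n) : cim z != 0 ->
  fn2 (M - adjm M) = 4 * fn2 (habs z M).
Proof.
move=> z0; have c2 : cnorm (2 : C) = 2.
  by rewrite -(rmorph_nat (cinj C)) cnorm_real ger0_norm ?ler0n.
rewrite immE /habs !fn2Z cnormM cnorm_i c2 cnorm_real normr_sg z0 expr1n mul1r mulr1.
by congr (_ * _); ring.
Qed.

Lemma inv_habs_facts n (S : 'M[C]_n -> 'M[C]_n) A z M : mdesol S A z M ->
  [/\ adjm (invmx (habs z M)) = invmx (habs z M), psd (invmx (habs z M)) &
      habs z M *m invmx (habs z M) = 1%:M].
Proof.
move=> hM; have hu := habs_unit hM; have ag : adjm (invmx (habs z M)) = invmx (habs z M).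
  by rewrite adjm_inv adjm_habs.
split=> //; last by rewrite mulmxV.
have := psd_conj (invmx (habs z M)) (psd_habs hM).
by rewrite ag -mulmxA mulmxV // mulmx1.
Qed.

(** The transposition in [S] has size [O (1 / n)] and is treated as a
    perturbation. *)
Lemma perturb_lower n (K q : R) (X Y Z : 'M[C]_n) : 0 < K ->
  fn2 X <= K * fn2 (Y + Z) -> fn2 Z <= q * fn2 X -> 4 * K * q <= 1 ->
  fn2 X <= 4 * K * fn2 Y.
Proof.
move=> K0 h1 h2 h3.
have h4 : fn2 X <= K * (2 * fn2 Y + 2 * fn2 Z).
  by apply: le_trans h1 _; rewrite ler_pM2l // fn2D_le.
have h5 : 4 * K * fn2 Z <= fn2 X.
  have h6 : 4 * K * fn2 Z <= 4 * K * (q * fn2 X) by rewrite ler_pM2l // mulr_gt0.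
  apply: le_trans h6 _; rewrite mulrA -[X in _ <= X]mul1r ler_wpM2r ?fn2_ge0 //.
by move: (fn2 X) (fn2 Y) (fn2 Z) h4 h5 => x y u h4 h5; nra.
Qed.

End FrobeniusBounds.

Section Stability.
Variables (R : realType) (C : complexField R).
Variables (c0 C2 : R).
Hypothesis c0_gt0 : 0 < c0.
Hypothesis C2_gt0 : 0 < C2.

(** The flat part of [S] is [X |-> c0 <X> 1]. *)
Definition unflat n (S : 'M[C]_n -> 'M[C]_n) (X : 'M[C]_n) : 'M[C]_n :=
  S X - (c0%:CC * normtr X)%:M.

Lemma transpose_le n B (M1 M2 X : 'M[C]_n) : 0 < B -> opb B M1 -> opb B M2 ->
  fn2 (M1 *m ((c0 / n%:R)%:CC *: X^T) *m M2) <= (c0 / n%:R) ^+ 2 * B ^+ 2 * fn2 X.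
Proof.
move=> B0 b1 b2; apply: le_trans (opb_mulr _ B0 b2) _.
have h := b1 _ ((c0 / n%:R)%:CC *: X^T); rewrite fn2Z fn2_tr cnorm_real real_normK ?num_real // in h.
apply: le_trans (ler_wpM2l (ltW B0) h) _.
by le_eq; ring.
Qed.

Lemma small_transpose (K B : R) : 0 < K -> 0 < B -> exists n0 : nat, forall n, (n0 < n)%N ->
  4 * K * ((c0 / n%:R) ^+ 2 * B ^+ 2) <= 1.
Proof.
move=> K0 B0; set Q := 4 * K * c0 ^+ 2 * B ^+ 2.
have Q0 : 0 < Q by rewrite /Q; posr.
exists (Num.truncn Q).+1 => n nQ.
have n1 : 1 <= n%:R :> R by rewrite ler1n (leq_ltn_trans _ nQ).
have n0 : 0 < n%:R :> R by apply: lt_le_trans n1.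
have Qn : Q <= n%:R.
  apply: le_trans (ltW (truncnS_gt Q)) _; rewrite ler_nat.
  exact: ltnW.
rewrite (_ : 4 * K * _ = Q / (n%:R ^+ 2)); last first.
  by rewrite /Q; field; rewrite gt_eqF.
rewrite ler_pdivrMr ?exprn_gt0 // mul1r; apply: le_trans Qn _.
by rewrite expr2 -{1}[n%:R]mul1r ler_pM2r.
Qed.

(** Without the flat part the stability operator is bounded below uniformly in
    the spectral parameters, on the same or on opposite sides. *)
Lemma pair_stable (B : R) : 1 <= B -> exists K : R, 0 < K /\ exists n0 : nat,
  forall n (S : 'M[C]_n -> 'M[C]_n) A z w Mz Mw, (n0 < n)%N ->
    self_energy c0 C2 S -> adjm A = A -> bulk S A B z Mz -> bulk S A B w Mw ->
  forall X, fn2 X <= K * fn2 (X - Mz *m unflat S X *m Mw).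
Proof.
move=> B1; have B0 : 0 < B by apply: lt_le_trans B1.
(* The flat part is at least [c0 / B], hence at least a fraction [e] of the
   weight [k], which is at most [B]. *)
set e := c0 / (B ^+ 2 + c0); have d0 : 0 < B ^+ 2 + c0 by posr.
have e0 : 0 < e by rewrite /e; posr.
have e1 : e < 1 by rewrite /e ltr_pdivrMr // mul1r ltrDr exprn_gt0.
set K := 4 / (1 - (1 - e)) ^+ 2 * (B * B / (B^-1 * B^-1)).
have K0 : 0 < K.
  have ee : 0 < 1 - (1 - e) by rewrite opprB addrC subrK.
  by rewrite /K; posr.
have [n0 hn0] := small_transpose K0 B0.
exists (4 * K); split; first by rewrite mulr_gt0.
exists n0 => n S A z w Mz Mw n_gt hS hA bz bw X.
have n_gt0 : (0 < n)%N by apply: leq_ltn_trans n_gt.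
have [Phi [kPhi SE Phile]] := flat_split c0_gt0 hS.
have solz := bulk_sol bz; have solw := bulk_sol bw.
have [ag pg hg] := inv_habs_facts solz.
have Bi : 0 < B^-1 by rewrite invr_gt0.
have phile Y : psd Y -> lepd (Phi Y + (c0%:CC * normtr Y)%:M) (S Y) by apply: Phile.
have flat_psd (z' : C) M' : bulk S A B z' M' ->
    lepd ((c0 / B)%:CC%:M : 'M[C]_n) (c0%:CC * normtr (habs z' M'))%:M.
  move=> b'; rewrite (@cre_normtr_habs _ _ _ _ _ (cre (normtr (habs z' M')))) //.
  by rewrite -rmorphM; apply: lepd_scalar; rewrite ler_pM2l // (bulk_thr b').
have le1 : lepd (Mz *m Phi (habs z Mz) *m adjm Mz) (habs z Mz).
  apply: lepd_trans (ward_S_le hS hA solz); apply: lepd_conjr.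
  apply: lepd_trans (phile _ (psd_habs solz)); apply: psd_addl.
  apply: (lepd_psd _ (flat_psd _ _ bz)); apply: psd_scalar.
  by rewrite divr_ge0 // ltW.
have le2 : lepd (Phi (Mw *m kweight S w Mw *m adjm Mw)) ((1 - e)%:CC *: kweight S w Mw).
  rewrite (ward hS hA solw).
  have h1 : lepd (Phi (habs w Mw) + (c0 / B)%:CC%:M) (kweight S w Mw).
    apply: lepd_trans (Sh_le_k S w Mw); apply: lepd_trans (phile _ (psd_habs solw)).
    by apply: lepd_add2; [exact: lepd_refl | exact: flat_psd].
  have h2 : lepd (e%:CC *: kweight S w Mw) (c0 / B)%:CC%:M.
    apply: (@lepd_trans _ _ _ (e%:CC *: B%:CC%:M)).
      by apply: lepdZ; [exact: ltW | exact: bulk_ku bw].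
    rewrite scale_scalar_mx -rmorphM; apply: lepd_scalar.
    rewrite /e -mulrA ler_pM2l // mulrC ler_pdivrMr // -ler_pdivrMl ?invr_gt0 // invrK.
    by rewrite -expr2 lerDl ltW.
  have := lepd_add2 h1 (lepd_refl (- (e%:CC *: kweight S w Mw))).
  rewrite (_ : kweight S w Mw - _ = (1 - e)%:CC *: kweight S w Mw); last first.
    by rewrite rmorphB rmorph1 scalerBl scale1r.
  apply: lepd_trans; rewrite -addrA; exact: psd_addl.
have := kraus_lower kPhi X (b := 1 - e) (gl := B^-1) (gu := B) (kl := B^-1) (ku := B)
  _ Bi Bi (ltW B0) pg (psd_kweight hS solw) (adjm_habs z Mz) hg le1 le2 _ _
  (bulk_kl bw) (bulk_ku bw).
rewrite -/K => low.
have {}low : fn2 X <= K * fn2 (X - Mz *m Phi X *m Mw).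
  apply: low.
  - by rewrite subr_gt0 e1 ltrBlDr ltrDl.
  - exact: lepd_invl B0 (psd_habs solz) hg ag (bulk_hu bz).
  - by rewrite -[B]invrK; apply: lepd_invr (psd_habs solz) hg ag (bulk_hl bz).
apply: (perturb_lower (q := (c0 / n%:R) ^+ 2 * B ^+ 2)
   (Z := Mz *m ((c0 / n%:R)%:CC *: X^T) *m Mw) K0 _ _ (hn0 _ n_gt)).
  apply: le_trans low _; le_eq.
  congr (_ * fn2 _); rewrite -addrA [- _ + _]addrC -[X in _ = _ + X]opprB; congr (_ - _).
  rewrite -mulmxBl -mulmxBr /unflat SE; congr (_ *m _ *m _).
  by rewrite addrAC addrK addrK.
exact: transpose_le B0 (bulk_M bz) (bulk_M bw).
Qed.

(** The flat part of [S] also makes the full stability operator at two equal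
    parameters bounded below. *)
Lemma same_side_stable (B : R) : 1 <= B -> exists K : R, 0 < K /\ exists n0 : nat,
  forall n (S : 'M[C]_n -> 'M[C]_n) A z M, (n0 < n)%N ->
    self_energy c0 C2 S -> adjm A = A -> bulk S A B z M ->
  forall X, fn2 X <= K * fn2 (X - M *m S X *m M).
Proof.
move=> B1; have B0 : 0 < B by apply: lt_le_trans B1.
have Bi : 0 < B^-1 by rewrite invr_gt0.
set Q := ((2 + 2 * (B * B ^+ 2)) / B^-1 + (B^-1)^-1) / (c0 * B^-1).
have Q0 : 0 < Q by rewrite /Q; posr.
set K := 2 * (Q * (1 + 2 * Q * (B * B)) * (B * B) + 2 * (B * B ^+ 2)).
have K0 : 0 < K by rewrite /K; posr.
have [n0 hn0] := small_transpose K0 B0.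
exists (4 * K); split; first by rewrite mulr_gt0.
exists n0 => n S A z M n_gt hS hA bz X.
have n_gt0 : (0 < n)%N by apply: leq_ltn_trans n_gt.
have [Phi [kPhi SE Phile]] := flat_split c0_gt0 hS.
have solz := bulk_sol bz; have [ag pg hg] := inv_habs_facts solz.
have ph := psd_habs solz.
set tau := cre (normtr (habs z M)).
have tB : B^-1 <= tau := bulk_thr bz.
have tau0 : 0 < tau by apply: lt_le_trans tB.
have gu : lepd (invmx (habs z M)) B%:CC%:M.
  by rewrite -[B]invrK; apply: lepd_invr ph hg ag (bulk_hl bz).
have gl : lepd (B^-1)%:CC%:M (invmx (habs z M)).
  exact: lepd_invl B0 ph hg ag (bulk_hu bz).
have zim : cim z != 0 by have /andP[] := bulk_im bz; rewrite normr_gt0.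
have hm (V : 'M[C]_n) : fn2 (adjm M *m invmx (habs z M) *m V) <= B * B ^+ 2 * fn2 V.
  rewrite -mulmxA; apply: le_trans (bulk_adjM bz _) _; rewrite -mulrA ler_pM2l //.
  exact: opb_of_le.
have le2 : lepd (Phi (habs z M) + (c0%:CC * normtr (habs z M))%:M) (kweight S z M).
  by apply: lepd_trans (Sh_le_k S z M); apply: Phile.
have le1 : lepd (M *m (Phi (habs z M) + (c0%:CC * normtr (habs z M))%:M) *m adjm M)
                (habs z M).
  by have := lepd_conjr M le2; rewrite (ward hS hA solz).
have low := same_side_lower n_gt0 kPhi c0_gt0 tau0 (cre_normtr_habs (erefl tau)) pg
  (psd_kweight hS solz) (adjm_habs z M) hg (ward hS hA solz) X Bi B0 Bi B0
  _ Bi tB gl gu (bulk_kl bz) (bulk_ku bz) hm (habs_sep _ zim) le1 le2 (erefl Q).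
rewrite -/K in low.
apply: (perturb_lower (q := (c0 / n%:R) ^+ 2 * B ^+ 2)
   (Z := M *m ((c0 / n%:R)%:CC *: X^T) *m M) K0 _ _ (hn0 _ n_gt)).
  apply: le_trans (low _) _; first by posr.
  le_eq.
  congr (_ * fn2 _); rewrite -addrA [- _ + _]addrC -[X in _ = _ + X]opprB; congr (_ - _).
  rewrite -mulmxBl -mulmxBr SE; congr (_ *m _ *m _).
  by rewrite addrK.
exact: transpose_le B0 (bulk_M bz) (bulk_M bz).
Qed.

(** Away from the real axis the stability operator is invertible without any
    assumption on the density, locally uniformly in one of its parameters. *)
Lemma local_stable n (S : 'M[C]_n -> 'M[C]_n) A z Mz : (0 < n)%N ->
  self_energy c0 C2 S -> adjm A = A -> mdesol S A z Mz -> cim z != 0 ->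
  exists K, 0 < K /\ forall w Mw, mdesol S A w Mw ->
    `|cim z| / 2 <= `|cim w| <= 2 * `|cim z| ->
    opb K Mw /\ forall X, fn2 X <= K * fn2 (X - Mz *m S X *m Mw).
Proof.
move=> n_gt0 hS hA solz zim; set eta := `|cim z| / 2.
have z0 : 0 < `|cim z| by rewrite normr_gt0.
have eta0 : 0 < eta by rewrite divr_gt0.
have [ag pg hg] := inv_habs_facts solz; have ph := psd_habs solz.
have kim (w : C) Mw : mdesol S A w Mw -> eta <= `|cim w| -> lepd eta%:CC%:M (kweight S w Mw).
  move=> solw h; apply: lepd_trans (kweight_ge_im hS solw); exact: lepd_scalar.
set m := (eta ^+ 2)^-1; have m0 : 0 < m by rewrite invr_gt0 exprn_gt0.
set H := 1 + m; have H0 : 0 < H by rewrite /H; posr.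
set ku := 2 * `|cim z| + C2 * H; have ku0 : 0 < ku by rewrite /ku; posr.
set gu := fn2 (invmx (habs z Mz)) + 1.
have fg0 := fn2_ge0 (invmx (habs z Mz)).
have gu0 : 0 < gu by rewrite /gu; posr.
have gu_le : lepd (invmx (habs z Mz)) gu%:CC%:M.
  apply: lepdP => [||v]; rewrite ?adjm_scalar ?conj_cinj // qf_scalar.
  have := wip_le_young v (invmx (habs z Mz) *m v) (psd1 C n) (psd1 C 1).
  rewrite -!fn2_wip /wip !mulmx1 mulmxA.
  have -> : gu * fn2 v = fn2 (invmx (habs z Mz)) * fn2 v + fn2 v by rewrite /gu; ring.
  have := fn2M_le (invmx (habs z Mz)) v.
  have := fn2_ge0 v; have := mulr_ge0 fg0 (fn2_ge0 v).
  move: (fn2 (invmx (habs z Mz)) * fn2 v) (fn2 (_ *m v)) (cre _) (fn2 v).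
  by move=> a1 a2 a3 a4 *; lra.
set e := eta / (ku + eta); have e0 : 0 < e by rewrite /e; posr.
have d0 : 0 < ku + eta by exact: addr_gt0.
have e1 : e < 1 by rewrite /e ltr_pdivrMr // mul1r ltrDr.
set K := 4 / (1 - (1 - e)) ^+ 2 * (gu * ku / (H^-1 * eta)).
have K0 : 0 < K.
  have ee : 0 < 1 - (1 - e) by rewrite opprB addrC subrK.
  by have Hi : 0 < H^-1 by [rewrite invr_gt0]; rewrite /K; posr.
exists (K + m + 1); split; first by posr.
move=> w Mw solw /andP[w1 w2].
have ke := kim _ _ solw w1; split.
  apply: opb_le (mde_opb hS hA solw eta0 ke).
  by rewrite -/m addrAC lerDr addr_ge0 // ltW.
move=> X.
have hu := mde_habs_le hS hA solw eta0 ke; rewrite -/m -/H in hu.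
have hz := mde_habs_le hS hA solz eta0 (kim _ _ solz _); rewrite -/m -/H in hz.
have hzu : lepd (habs z Mz) H%:CC%:M.
  by apply: hz; rewrite /eta ler_pdivrMr // ler_peMr // ?ler1n // ltW.
have kk : lepd (kweight S w Mw) ku%:CC%:M.
  have := lepd_add2 (lepd_scalar C n w2) (se_le n_gt0 C2_gt0 hS (ltW H0) hu).
  by rewrite /ku rmorphD raddfD.
have le2 : lepd (S (Mw *m kweight S w Mw *m adjm Mw)) ((1 - e)%:CC *: kweight S w Mw).
  rewrite (ward hS hA solw).
  have h2 : lepd (e%:CC *: kweight S w Mw) (`|cim w|)%:CC%:M.
    apply: (@lepd_trans _ _ _ (e%:CC *: ku%:CC%:M)).
      by apply: lepdZ; [exact: ltW | exact: kk].
    rewrite scale_scalar_mx -rmorphM; apply: lepd_scalar; apply: le_trans w1.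
    rewrite -/eta /e mulrAC ler_pdivrMr // ler_pM2l // lerDl ltW //.
  rewrite rmorphB rmorph1 scalerBl scale1r {1}/kweight addrAC [X in lepd _ X]addrC.
  exact: psd_addl.
have := kraus_lower (se_kraus hS) X (b := 1 - e) (gl := H^-1) (gu := gu) (kl := eta) (ku := ku)
  _ _ eta0 (ltW gu0) pg (psd_kweight hS solw) (adjm_habs z Mz) hg (ward_S_le hS hA solz) le2
  _ gu_le ke kk.
rewrite -/K => low.
apply: (@le_trans _ _ (K * fn2 (X - Mz *m S X *m Mw))).
  apply: low.
  - by rewrite subr_gt0 e1 ltrBlDr ltrDl.
  - by rewrite invr_gt0.
  - exact: lepd_invl H0 ph hg ag hzu.
by rewrite ler_wpM2r ?fn2_ge0 // -addrA lerDl addr_ge0 // ltW.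
Qed.

End Stability.

(** * Differentiability of the solution *)

Section SuperOperators.
Variables (F : fieldType) (n : nat).
Implicit Types (T U : 'M[F]_n -> 'M[F]_n).

Definition superlin T := forall a X Y, T (a *: X + Y) = a *: T X + T Y.

Lemma mul_lin_mx T X : superlin T -> mxvec X *m lin_mx T = mxvec (T X).
Proof.
move=> lT; pose TL : {linear 'M[F]_n -> 'M[F]_n} :=
  HB.pack T (GRing.isLinear.Build F 'M[F]_n 'M[F]_n *:%R T lT).
exact: (mul_vec_lin TL).
Qed.

Lemma lin_mx_eq T (P : 'M[F]_(n * n)) : superlin T ->
  (forall X, mxvec X *m P = mxvec (T X)) -> lin_mx T = P.
Proof.
move=> lT h; apply/row_matrixP => i; rewrite -[row i _]vec_mxK -[row i P]vec_mxK.
congr mxvec; apply: (can_inj (@mxvecK _ _ _)); rewrite !vec_mxK.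
by rewrite !rowE -[delta_mx 0 i]vec_mxK mul_lin_mx // h.
Qed.

Lemma lin_mx_unit T : superlin T -> (forall X, T X = 0 -> X = 0) -> lin_mx T \in unitmx.
Proof.
move=> lT inj; rewrite -row_free_unit -kermx_eq0; apply/eqP.
apply/row_matrixP => i; rewrite row0 -[row i _]vec_mxK.
set X := vec_mx _; suff -> : X = 0 by rewrite linear0.
apply: inj; apply: (can_inj (@mxvecK _ _ _)); rewrite -mul_lin_mx // vec_mxK.
by rewrite -row_mul mulmx_ker row0 linear0.
Qed.

Lemma superlin_surj T Y : superlin T -> (forall X, T X = 0 -> X = 0) -> exists X, T X = Y.
Proof.
move=> lT inj; exists (vec_mx (mxvec Y *m invmx (lin_mx T))).
apply: (can_inj (@mxvecK _ _ _)); rewrite -mul_lin_mx // vec_mxK mulmxKV //.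
exact: lin_mx_unit.
Qed.

Definition stabop (S : 'M[F]_n -> 'M[F]_n) (Mz Mw X : 'M[F]_n) : 'M[F]_n :=
  X - Mz *m S X *m Mw.

Lemma superlin_stabop S Mz Mw : superlin S -> superlin (stabop S Mz Mw).
Proof.
move=> lS a X Y; rewrite /stabop lS mulmxDr mulmxDl -scalemxAr -scalemxAl scalerBr opprD.
by rewrite addrACA.
Qed.

End SuperOperators.

Lemma superlin_S (R : realType) (C : complexField R) (c0 C2 : R) n
  (S : 'M[C]_n -> 'M[C]_n) : self_energy c0 C2 S -> superlin S.
Proof. by move=> hS a X Y; rewrite (krausD (se_kraus hS)) (krausZ (se_kraus hS)). Qed.

Section Differentiability.
Variables (R : realType) (C : complexField R).
Variables (c0 C2 : R) (n : nat) (S : 'M[C]_n -> 'M[C]_n) (A : 'M[C]_n).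
Hypothesis C2_gt0 : 0 < C2.
Hypothesis n_gt0 : (0 < n)%N.
Hypothesis hS : self_energy c0 C2 S.
Hypothesis hA : adjm A = A.

(** The difference of two solutions is the image of [(z - w) Mz Mw] under the
    inverse of the stability operator. *)
Lemma mde_difference z w Mz Mw : mdesol S A z Mz -> mdesol S A w Mw ->
  (Mz - Mw) - Mz *m S (Mz - Mw) *m Mw = (z - w) *: (Mz *m Mw).
Proof.
move=> sz sw.
have e : invmx Mw - invmx Mz = (z - w)%:M + S (Mz - Mw).
  rewrite (mde_eq sz) (mde_eq sw) (krausB (se_kraus hS)) [(z - w)%:M]raddfB /=.
  by apply/matrixP => i j; rewrite !mxE; ring.
have := congr1 (fun X => Mz *m X *m Mw) e; rewrite /=.
rewrite mulmxBr mulmxBl mulmxV ?(mde_unit sz) // mul1mx mulmxKV ?(mde_unit sw) //.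
by move=> e2; rewrite [X in X - _ = _]e2 mulmxDr mulmxDl mul_mx_scalar -scalemxAl addrK.
Qed.

Variable M : C -> 'M[C]_n.
Hypothesis hM : forall z, cim z != 0 -> mdesol S A z (M z).

Lemma lower_inj (T : 'M[C]_n -> 'M[C]_n) K : (forall X, fn2 X <= K * fn2 (T X)) ->
  forall X, T X = 0 -> X = 0.
Proof.
move=> low X TX; have := low X; rewrite TX fn2_0 mulr0 => h.
by apply/fn2_eq0/le_anti; rewrite h fn2_ge0.
Qed.

(** The difference quotient and its limit [L] solve linear equations whose
    operators differ by [M (z + h) - M z], so the stability at [z + h] bounds
    their difference. *)
Lemma mde_diff z : cim z != 0 ->
  exists L, L - M z *m S L *m M z = M z *m M z /\
  exists K d, [/\ 0 < K, 0 < d & forall h, 0 < cnorm h < d ->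
    fn2 (h^-1 *: (M (z + h) - M z) - L) <= K * cnorm h ^+ 2].
Proof.
move=> zim; have sz := hM zim.
have z0 : 0 < `|cim z| by rewrite normr_gt0.
have [K [K0 loc]] := local_stable C2_gt0 n_gt0 hS hA sz zim.
have at_z : `|cim z| / 2 <= `|cim z| <= 2 * `|cim z|.
  by move: (`|cim z|) z0 => a a0; apply/andP; split; lra.
have [_ low] := loc _ _ sz at_z.
have [L hL] := superlin_surj (M z *m M z) (superlin_stabop (M z) (M z) (superlin_S hS)) (lower_inj low).
exists L; split=> //.
set P := M z + M z *m S L.
have P0 := fn2_ge0 P; have M0 := fn2_ge0 (M z).
exists (K * (fn2 P * (K * (K * fn2 (M z)))) + 1), (`|cim z| / 2).
split; [by posr | by posr |] => h /andP[h0 hd].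
have near : `|cim z| / 2 <= `|cim (z + h)| <= 2 * `|cim z|.
  have := cim_le_cnorm h; rewrite cimD.
  have := ler_distD (cim z + cim h) (cim z) 0; rewrite !subr0 opprD addrA subrr add0r normrN.
  have := ler_normD (cim z) (cim h).
  by move: (`|cim z|) (`|cim h|) (`|cim z + cim h|) (cnorm h) hd z0 => a b c d *; apply/andP; split; lra.
have wim : cim (z + h) != 0.
  by have /andP[l _] := near; rewrite -normr_gt0 (lt_le_trans _ l) // divr_gt0.
have sw := hM wim; have [bw lowh] := loc _ _ sw near.
set w := z + h in near wim sw bw lowh *.
have zw : z - w = - h by rewrite /w opprD addrA subrr add0r.
have dif := mde_difference sz sw; rewrite zw in dif.
have D_le : fn2 (M w - M z) <= cnorm h ^+ 2 * (K * (K * fn2 (M z))).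
  rewrite -fn2N opprB; apply: le_trans (lowh _) _; rewrite dif fn2Z cnormN.
  rewrite mulrCA ler_wpM2l ?sqr_ge0 // ler_pM2l //.
  exact: opb_mulr.
have h_neq0 : h != 0 by rewrite -cnorm_eq0 gt_eqF.
set Q := h^-1 *: (M w - M z).
have hQ : Q - M z *m S Q *m M w = M z *m M w.
  rewrite /Q (krausZ (se_kraus hS)) -scalemxAr -scalemxAl -scalerBr.
  rewrite -[M w - M z]opprB (krausN (se_kraus hS)) mulmxN mulNmx -opprD dif.
  by rewrite scaleNr opprK scalerA mulVf // scale1r.
have hE : (Q - L) - M z *m S (Q - L) *m M w = P *m (M w - M z).
  rewrite (krausB (se_kraus hS)) mulmxBr mulmxBl /P mulmxDl !mulmxBr -hL -hQ.
  by apply/matrixP => i j; rewrite !mxE; ring.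
apply: le_trans (lowh _) _; rewrite hE.
apply: (@le_trans _ _ (K * (fn2 P * (cnorm h ^+ 2 * (K * (K * fn2 (M z))))))).
  rewrite ler_pM2l //; apply: le_trans (fn2M_le _ _) _.
  by rewrite ler_wpM2l.
rewrite mulrDl mul1r; apply: ler_wpDr; first exact: sqr_ge0.
by le_eq; ring.
Qed.

End Differentiability.

(** * Continuation of the density along vertical lines *)

Section RealInduction.
Variable R : realType.

(** A function that is continuous, and that decreases at rate at most [L] as
    long as it stays above [a], stays above the line of slope [- L] through its
    starting value until this line reaches [a]. *)
Lemma slope_continuation (u : R -> R) (L a t1 t : R) : t1 <= t -> 0 <= L ->
  a + L * (t - t1) <= u t1 ->
  (forall r, t1 <= r <= t -> exists K d, [/\ 0 < K, 0 < d &
    forall r', `|r' - r| < d -> `|u r' - u r| <= K * `|r' - r|]) ->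
  (forall r, t1 <= r <= t -> a <= u r -> exists d, 0 < d /\
    forall r', `|r' - r| < d -> `|u r' - u r| <= L * `|r' - r|) ->
  a <= u t.
Proof.
move=> t1t L0 ut1 cont decay.
set line := fun r => u t1 - L * (r - t1).
pose E : set R := fun r => t1 <= r <= t /\ forall r', t1 <= r' <= r -> line r' <= u r'.
have line1 : line t1 = u t1 by rewrite /line subrr mulr0 subr0.
have Et1 : E t1.
  split; first by rewrite lexx t1t.
  by move=> r' /andP[h1 h2]; have -> : r' = t1 by [apply/le_anti; rewrite h2 h1]; rewrite line1.
have hasE : has_sup E.
  by split; [exists t1 | exists t => r [/andP[]]].
set s := sup E.
have t1s : t1 <= s by apply: sup_upper_bound.
have st : s <= t by apply: ge_sup; [exists t1 | move=> r [/andP[]]].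
have below r : t1 <= r -> r < s -> line r <= u r.
  move=> h1 h2; have rs : 0 < s - r by rewrite subr_gt0.
  have [e [_ he] re] := sup_adherent rs hasE; apply: he.
  by rewrite h1 ltW //; move: re; rewrite -/s opprB addrC subrK.
have at_s : line s <= u s.
  have [->|ns] := eqVneq s t1; first by rewrite line1.
  have ts : t1 < s by rewrite lt_def ns.
  rewrite leNgt; apply/negP => us; set g := line s - u s.
  have g0 : 0 < g by rewrite subr_gt0.
  have [K [d [K0 d0 hK]]] := cont s ltac:(by rewrite t1s st).
  pose e := Num.min (d / 2) (Num.min (g / (2 * K)) (s - t1)).
  have e0 : 0 < e by rewrite !lt_min !divr_gt0 ?mulr_gt0 // subr_gt0.
  have ed : e < d.
    have : e <= d / 2 by rewrite ge_min lexx.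
    by move: (e) => x; lra.
  have eg : K * e <= g / 2.
    have : e <= g / (2 * K) by rewrite !ge_min lexx orbT.
    by rewrite invfM mulrA ler_pdivlMr // mulrC.
  have es : e <= s - t1 by rewrite !ge_min lexx !orbT.
  have r1 : t1 <= s - e by lra.
  have r2 : s - e < s by lra.
  have := hK (s - e); rewrite addrAC subrr add0r normrN gtr0_norm // => /(_ ed).
  have := below _ r1 r2; have : line s <= line (s - e).
    by rewrite /line lerD2l lerN2 ler_wpM2l //; lra.
  move=> h1 h2 /ler_normlP [h3 h4].
  move: h1 h2 h3 h4 eg g0; rewrite /g; clear.
  by move: (line (s - e)) (line s) (u (s - e)) (u s) (K * e) => *; lra.
have Es : E s.
  split=> [|r' /andP[h1]]; first by rewrite t1s st.
  by rewrite le_eqVlt => /orP[/eqP -> //|]; apply: below.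
have line_a r : t1 <= r <= t -> a <= line r.
  move=> /andP[h1 h2]; rewrite /line lerBrDr; apply: le_trans ut1.
  by rewrite lerD2l ler_wpM2l // lerD2r.
have [ets|nts] := eqVneq s t; first by rewrite -ets; apply: le_trans at_s; apply: line_a; rewrite t1s st.
have lts : s < t by rewrite lt_def eq_sym nts.
have sI : t1 <= s <= t by rewrite t1s st.
have [d [d0 hd]] := decay s sI (le_trans (line_a _ sI) at_s).
pose e := Num.min (d / 2) (t - s).
have e0 : 0 < e by rewrite lt_min divr_gt0 // subr_gt0.
have ed : e < d.
  have : e <= d / 2 by rewrite ge_min lexx.
  by move: (e) => x; lra.
have et : e <= t - s by rewrite ge_min lexx orbT.
have : E (s + e).
  split=> [|r' /andP[h1 h2]]; first by apply/andP; split; lra.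
  have [le|lt] := leP r' s; first by case: Es => _; apply; rewrite h1.
  have := hd r'; rewrite gtr0_norm ?subr_gt0 // => /(_ ltac:(lra)).
  move=> /ler_normlP [h3 h4].
  have : line r' = line s - L * (r' - s) by rewrite /line; ring.
  by move: (line r') (line s) (L * _) (u s) (u r') at_s h3 h4 => *; lra.
move=> /(sup_upper_bound hasE); rewrite -/s; lra.
Qed.

End RealInduction.

Section Continuation.
Variables (R : realType) (C : complexField R).

Lemma normtr_sqr_le n (X : 'M[C]_n) : (0 < n)%N ->
  cnorm (normtr X) ^+ 2 <= n%:R^-1 * fn2 X.
Proof.
move=> n0; have n0R : 0 < n%:R :> R by rewrite ltr0n.
rewrite /normtr cnormM cnormV -(rmorph_nat (cinj C)) cnorm_real ger0_norm ?ler0n //.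
rewrite exprMn [X in X * _]expr2 -mulrA ler_pM2l ?invr_gt0 // ler_pdivrMl //.
have := cnorm_sum_CS (fun i => X i i) (fun=> 1); rewrite /mxtrace.
under eq_bigr do rewrite mulr1; move=> h; apply: le_trans h _.
rewrite -{1}(rmorph1 (cinj C)) cnorm_real normr1 expr1n sumr_const card_ord mulrC.
rewrite ler_pM2l // fn2E; apply: ler_sum => i _.
by rewrite (bigD1 i) //= lerDl; apply: sumr_ge0 => j _; apply: sqr_ge0.
Qed.

Lemma normtr_habs n (z : C) (M : 'M[C]_n) :
  cre (normtr (habs z M)) = Num.sg (cim z) * cim (normtr M).
Proof.
rewrite /normtr /habs linearZ /= mulrCA creZ; congr (_ * _).
rewrite -(rmorph_nat (cinj C)) -fmorphV creZ cimZ; congr (_ * _).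
by have := imm_qf M 1%:M; rewrite adjm1 !mul1mx !mulmx1.
Qed.

Lemma normtrB n (X Y : 'M[C]_n) : normtr (X - Y) = normtr X - normtr Y.
Proof. by rewrite /normtr linearB /= mulrBr. Qed.

Lemma normtrZ n a (X : 'M[C]_n) : normtr (a *: X) = a * normtr X.
Proof. by rewrite /normtr linearZ /= mulrCA. Qed.

(** The sign [s] selects one of the two half-planes, which are treated alike. *)
Definition vert (x s t : R) : C := x%:CC + 'i * (s * t)%:CC.

Lemma cim_i (a : R) : cim ('i * a%:CC : C) = a.
Proof. by rewrite /cim mulNr mulrA mulCii mulN1r opprK cre_inj. Qed.

Lemma cim_real (a : R) : cim (a%:CC : C) = 0.
Proof.
by apply: (@cinj_inj _ C); rewrite cimE rmorph0; apply/Creal_ImP/cinj_real.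
Qed.

Lemma cim_vert x s t : cim (vert x s t) = s * t.
Proof. by rewrite cimD cim_real cim_i add0r. Qed.

(** If the density of states is at least [2 thr] at heights arbitrarily close to
    [0] over [x], it is at least [thr] at all heights below a constant: where it
    is at least [thr], its derivative is bounded. *)
Lemma density_continuation (c0 C2 CA thr : R) : 0 < c0 -> 0 < C2 -> 0 < thr ->
  exists t0 : R, 0 < t0 /\ exists n0 : nat,
  forall n (S : 'M[C]_n -> 'M[C]_n) A (M : C -> 'M[C]_n), (n0 < n)%N ->
    self_energy c0 C2 S -> adjm A = A -> opb (CA ^+ 2) A ->
    (forall z, cim z != 0 -> mdesol S A z (M z)) ->
  forall x s, s = 1 \/ s = -1 ->
    let u t := cre (normtr (habs (vert x s t) (M (vert x s t)))) in
    (forall t1, 0 < t1 -> exists t, 0 < t < t1 /\ 2 * thr <= u t) ->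
  forall t, 0 < t < t0 -> thr <= u t.
Proof.
move=> c00 C20 thr0.
have [B [B1 hB]] := bulk_exists C CA c00 C20 thr0.
have B0 : 0 < B by apply: lt_le_trans B1.
have [K [K0 [n0 hK]]] := same_side_stable C C2 c00 B1.
set L := 2 * (K * B ^+ 2) + 2; have L0 : 0 < L by rewrite /L; posr.
exists (Num.min 1 (thr / L)); split; first by rewrite lt_min ltr01 divr_gt0.
exists n0 => n S A M n_gt hS hA bA hM x s hs u small t /andP[tpos].
rewrite lt_min => /andP[t_lt1 t_ltL].
have n_gt0 : (0 < n)%N by apply: leq_ltn_trans n_gt.
have n0R : 0 < n%:R :> R by rewrite ltr0n.
have s1 : `|s| = 1 by case: hs => ->; rewrite ?normrN normr1.
have [t1 [/andP[t10 t1t] ut1]] := small t tpos.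
have sne0 : s != 0 by rewrite -normr_gt0 s1.
have cimz r : 0 < r -> cim (vert x s r) != 0.
  by move=> r0; rewrite cim_vert mulf_neq0 // gt_eqF.
have sgz r : 0 < r -> Num.sg (cim (vert x s r)) = s.
  move=> r0; rewrite cim_vert sgrM (gtr0_sg r0) mulr1.
  by case: hs => ->; rewrite ?sgrN sgr1.
have step r r' : cnorm (vert x s r' - vert x s r) = `|r' - r|.
  have -> : vert x s r' - vert x s r = 'i * (s * (r' - r))%:CC.
    by rewrite /vert mulrBr rmorphB /=; ring.
  by rewrite cnormM cnorm_real normrM s1 cnorm_i !mul1r.
(* The increments of the density along the vertical line are controlled by the
   difference quotients of the solution. *)
have incr r r' Lm (q : R) : 0 < r -> 0 < r' -> r' != r -> 0 <= q ->
    fn2 ((vert x s r' - vert x s r)^-1 *: (M (vert x s r') - M (vert x s r)) - Lm) <= n%:R ->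
    2 * fn2 Lm + 2 * n%:R <= q ^+ 2 * n%:R -> `|u r' - u r| <= q * `|r' - r|.
  move=> r0 r'0 rr q0 h1 h2.
  set h := vert x s r' - vert x s r; set Q := h^-1 *: _ in h1.
  have hn : cnorm h = `|r' - r| := step r r'.
  have h0 : h != 0 by rewrite -cnorm_eq0 hn normr_eq0 subr_eq0.
  have MQ : M (vert x s r') - M (vert x s r) = h *: Q.
    by rewrite /Q scalerA mulfV // scale1r.
  rewrite /u !normtr_habs !sgz // -mulrBr normrM s1 mul1r -cimB -normtrB MQ normtrZ.
  apply: le_trans (cim_le_cnorm _) _; rewrite cnormM hn mulrC ler_wpM2r //.
  rewrite -(@ler_pXn2r _ 2) ?nnegrE ?cnorm_ge0 //.
  apply: le_trans (normtr_sqr_le _ n_gt0) _; rewrite ler_pdivrMl // mulrC.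
  apply: le_trans h2; have -> : Q = (Q - Lm) + Lm by rewrite subrK.
  by apply: le_trans (fn2D_le _ _) _; rewrite addrC lerD2l ler_pM2l.
have near r : 0 < r -> exists Lm, Lm - M (vert x s r) *m S Lm *m M (vert x s r) =
      M (vert x s r) *m M (vert x s r) /\ exists d, 0 < d /\
    forall r' q, `|r' - r| < d -> 0 <= q -> 2 * fn2 Lm + 2 * n%:R <= q ^+ 2 * n%:R ->
      `|u r' - u r| <= q * `|r' - r|.
  move=> r0; have [Lm [eL [K' [d [K'0 d0 hd]]]]] :=
    mde_diff C20 n_gt0 hS hA hM (cimz r r0).
  exists Lm; split=> //.
  pose e := Num.min (Num.min d r) (Num.min 1 (K' + 1)^-1).
  have Ki : 0 < (K' + 1)^-1 by posr.
  exists e; split; first by rewrite !lt_min d0 r0 ltr01 Ki.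
  move=> r' q; rewrite !lt_min => /andP[/andP[a1 a2] /andP[a3 a4]] q0 hq.
  have [->|rr] := eqVneq r' r; first by rewrite !subrr normr0 mulr0.
  have r'0 : 0 < r' by move: a2; rewrite ltr_norml => /andP[l _]; lra.
  apply: (incr _ _ Lm) => //.
  set h := vert x s r' - vert x s r.
  have hn : cnorm h = `|r' - r| := step r r'.
  have h0 : 0 < cnorm h < d by rewrite hn a1 normr_gt0 subr_eq0 rr.
  have zh : vert x s r + h = vert x s r' by rewrite /h addrC subrK.
  have := hd h h0; rewrite zh => h1; apply: le_trans h1 _.
  rewrite hn; apply: (@le_trans _ _ 1); last by rewrite ler1n.
  have K1 : 0 < K' + 1 by posr.
  have : K' * `|r' - r| <= 1.
    move: a4; rewrite -ler_pdivlMl // mulr1 => /ltW a4; apply: le_trans a4 _.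
    by rewrite lef_pV2 ?posrE // lerDl.
  have := normr_ge0 (r' - r); move: a3; rewrite expr2.
  by move: (`|r' - r|) => y y1 y0 hy; nra.
apply: (@slope_continuation _ u L thr t1 t (ltW t1t) (ltW L0)) => [|r|r].
- apply: le_trans ut1; rewrite mulr_natl mulr2n lerD2l.
  have : L * t <= thr by rewrite mulrC -ler_pdivlMr // ltW.
  by apply: le_trans; rewrite ler_pM2l // gerBl ltW.
- move=> /andP[h1 h2]; have r0 : 0 < r by apply: lt_le_trans h1.
  have [Lm [_ [d [d0 hd]]]] := near r r0.
  exists (2 * fn2 Lm + 2), d; split=> //; first by have := fn2_ge0 Lm; lra.
  move=> r' hr; apply: hd => //; first by have := fn2_ge0 Lm; lra.
  have n1 : 1 <= n%:R :> R by rewrite ler1n.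
  have := fn2_ge0 Lm; move: (fn2 Lm) (n%:R : R) n1 => f m n1 f0; nra.
- move=> /andP[h1 h2] hu; have r0 : 0 < r by apply: lt_le_trans h1.
  have [Lm [eL [d [d0 hd]]]] := near r r0.
  exists d; split=> // r' hr; apply: hd => //; first exact: ltW.
  have bz : bulk S A B (vert x s r) (M (vert x s r)).
    apply: hB => //; last exact: hM (cimz r r0).
    by rewrite cim_vert normrM s1 mul1r gtr0_norm // r0 (le_trans h2) // ltW.
  have := hK n S A _ _ n_gt hS hA bz Lm; rewrite eL => low.
  have M2 : fn2 (M (vert x s r) *m M (vert x s r)) <= B * (B * n%:R).
    apply: le_trans (bulk_M bz _) _; rewrite ler_pM2l //.
    exact: opb_fn2 (bulk_M bz).
  have : fn2 Lm <= K * (B * (B * n%:R)) by apply: le_trans low _; rewrite ler_pM2l.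
  move=> h3; have KB : 0 <= K * B ^+ 2 by rewrite mulr_ge0 ?sqr_ge0 // ltW.
  apply: (@le_trans _ _ (L * n%:R)).
    have -> : L * n%:R = 2 * (K * (B * (B * n%:R))) + 2 * n%:R by rewrite /L; ring.
    by rewrite lerD2r ler_pM2l.
  rewrite ler_pM2r // expr2 ler_peMl ?ltW //.
  by rewrite /L; move: (K * _) KB => y; lra.
Qed.

End Continuation.

(** * Traces over the space of matrices *)

Section RankOne.
Variables (F : fieldType) (N : nat).

(** Explicit form of the logarithmic derivative of a determinant under the
    rank-one update [B = B1 - phi u], when [D] and [B1] satisfy the relation
    that differentiating [Delta B1 = q u] produces. *)
Lemma rank_one_trace (B1 D1 : 'M[F]_N) (phi : 'cV[F]_N) (u m Delta mu : 'rV[F]_N)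
    (zeta q : F) :
  B1 \in unitmx -> zeta != 0 -> q != 0 -> q = zeta + (Delta *m phi) 0 0 ->
  Delta *m B1 = q *: u ->
  mu *m B1 - Delta *m D1 = (1 + (mu *m phi) 0 0) *: u + q *: m ->
  let B := B1 - phi *m u in
  B \in unitmx /\
  \tr (invmx B *m (D1 + phi *m m)) =
    \tr (invmx B1 *m D1) - zeta^-1 + (1 + (mu *m phi) 0 0) / q.
Proof.
move=> B1u z0 q0 qE DB1 muB1 B.
set d := (Delta *m phi) 0 0 in qE *; set e := (mu *m phi) 0 0 in muB1 *.
have uB1 : u *m invmx B1 = q^-1 *: Delta.
  by rewrite -[Delta](mulmxK B1u) DB1 -scalemxAl scalerA mulVf // scale1r.
have sc (x : 'rV[F]_N) (y : 'cV[F]_N) : x *m y = ((x *m y) 0 0)%:M.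
  exact: mx11_scalar.
set P := phi *m Delta.
have PP : P *m P = d *: P.
  by rewrite /P mulmxA -[phi *m _ *m phi]mulmxA (sc Delta phi) -/d mul_mx_scalar scalemxAl.
pose G := invmx B1 *m (1%:M + zeta^-1 *: P).
have BG : B *m G = 1%:M.
  have -> : B *m G = (1%:M - q^-1 *: P) *m (1%:M + zeta^-1 *: P).
    by rewrite /G mulmxA mulmxBl mulmxV // -[phi *m u *m _]mulmxA uB1 -scalemxAr.
  rewrite mulmxDr mulmx1 mulmxBl mul1mx -scalemxAr -scalemxAl PP !scalerA.
  rewrite -addrA -[RHS]addr0; congr (_ + _); rewrite -scaleNr -scalerBl -scalerDl.
  rewrite (_ : _ + _ = 0) ?scale0r //.
  have -> : d = q - zeta by rewrite qE addrAC subrr add0r.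
  by field; rewrite z0 q0.
have Bu : B \in unitmx by case: (mulmx1_unit BG).
have -> : invmx B = G by rewrite -[G](mulKmx Bu) BG mulmx1.
split=> //.
have trc (x : 'cV[F]_N) (y : 'rV[F]_N) : \tr (x *m y) = (y *m x) 0 0.
  by rewrite mxtrace_mulC trace_mx11.
have key : Delta *m D1 + q *: m = mu *m B1 - (1 + e) *: u.
  by apply/eqP; rewrite eq_sym subr_eq -addrA [q *: m + _]addrC -muB1 addrC subrK.
pose psi := invmx B1 *m phi.
have k2 := congr1 (fun X => (X *m psi) 0 0) key.
rewrite /= mulmxDl mulmxBl -!scalemxAl /psi !mulmxA (mulmxK B1u) uB1 -scalemxAl in k2.
have addE (X Y : 'M[F]_1) : (X + Y) 0 0 = X 0 0 + Y 0 0 by rewrite mxE.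
have oppE (X : 'M[F]_1) : (- X) 0 0 = - X 0 0 by rewrite mxE.
have scaleE a (X : 'M[F]_1) : (a *: X) 0 0 = a * X 0 0 by rewrite mxE.
rewrite -!mulmxA -/psi !addE !oppE !scaleE -/d -/e in k2.
have t1 : \tr (invmx B1 *m (phi *m m)) = (m *m psi) 0 0 by rewrite mulmxA trc.
have t2 : \tr (invmx B1 *m (P *m D1)) = (Delta *m (D1 *m psi)) 0 0.
  by rewrite /P -[phi *m _ *m _]mulmxA [invmx B1 *m (phi *m _)]mulmxA trc mulmxA.
have t3 : \tr (invmx B1 *m (P *m (phi *m m))) = d * (m *m psi) 0 0.
  have Pphi : P *m phi = d *: phi by rewrite /P -mulmxA (sc Delta phi) -/d mul_mx_scalar.
  by rewrite [P *m _]mulmxA Pphi -scalemxAl -scalemxAr linearZ /= t1.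
rewrite /G -mulmxA mulmxDl mul1mx -scalemxAl !mulmxDr !mxtraceD -scalemxAr linearZ /=.
rewrite mulmxDr mxtraceD t1 t2 t3 -!addrA; congr (_ + _).
have -> : (Delta *m (D1 *m psi)) 0 0 = e - (1 + e) * (q^-1 * d) - q * (m *m psi) 0 0.
  by rewrite -k2 addrK.
have -> : d = q - zeta by rewrite qE addrAC subrr add0r.
by field; rewrite z0 q0.
Qed.

End RankOne.

Section SuperTrace.
Variables (F : fieldType) (n : nat).
Implicit Types (T U : 'M[F]_n -> 'M[F]_n).

Lemma sum_pairs (V : nmodType) (f : 'I_(n * n) -> V) :
  \sum_k f k = \sum_a \sum_b f (mxvec_index a b).
Proof.
rewrite (reindex (uncurry (@mxvec_index n n))) /=; last exact: curry_mxvec_bij.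
by rewrite pair_bigA; apply: eq_bigr => -[].
Qed.

Lemma row_lin_mx T a b : superlin T ->
  row (mxvec_index a b) (lin_mx T) = mxvec (T (delta_mx a b)).
Proof.
by move=> lT; rewrite -mul_lin_mx // mxvec_delta -rowE.
Qed.

Lemma tr_lin_mx T : superlin T -> \tr (lin_mx T) = \sum_a \sum_b T (delta_mx a b) a b.
Proof.
move=> lT; rewrite /mxtrace sum_pairs; apply: eq_bigr => a _; apply: eq_bigr => b _.
by rewrite -(mxvecE (T (delta_mx a b))) -row_lin_mx // [RHS]mxE.
Qed.

Lemma superlin_comp T U : superlin T -> superlin U -> superlin (fun X => T (U X)).
Proof. by move=> lT lU a X Y; rewrite lU lT. Qed.

Lemma lin_mx_comp T U : superlin T -> superlin U ->
  lin_mx (fun X => T (U X)) = lin_mx U *m lin_mx T.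
Proof.
move=> lT lU; apply: lin_mx_eq => [|X]; first exact: superlin_comp.
by rewrite mulmxA !mul_lin_mx.
Qed.

Definition smul (P Q : 'M[F]_n) : 'M[F]_(n * n) := lin_mx (fun X => P *m X *m Q).

Lemma superlin_smul P Q : superlin (fun X : 'M[F]_n => P *m X *m Q).
Proof. by move=> a X Y; rewrite mulmxDr mulmxDl -scalemxAr -scalemxAl. Qed.

Lemma mul_smul P Q X : mxvec X *m smul P Q = mxvec (P *m X *m Q).
Proof. exact: mul_lin_mx (superlin_smul P Q). Qed.

Lemma smulM P Q P' Q' : smul P Q *m smul P' Q' = smul (P' *m P) (Q *m Q').
Proof.
apply/esym/lin_mx_eq => [|X]; first exact: superlin_smul.
by rewrite mulmxA !mul_smul !mulmxA.
Qed.

Lemma smul_eq P Q (Y : 'M[F]_(n * n)) :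
  (forall X, mxvec X *m Y = mxvec (P *m X *m Q)) -> smul P Q = Y.
Proof. by move=> h; apply: lin_mx_eq => //; exact: superlin_smul. Qed.

Lemma smulBr P Q Q' : smul P (Q - Q') = smul P Q - smul P Q'.
Proof.
by apply: smul_eq => X; rewrite mulmxBr !mul_smul -linearB mulmxBr.
Qed.

Lemma smulZr a P Q : smul P (a *: Q) = a *: smul P Q.
Proof.
by apply: smul_eq => X; rewrite -scalemxAr mul_smul -linearZ scalemxAr.
Qed.

Definition sopinv T (X : 'M[F]_n) : 'M[F]_n := vec_mx (mxvec X *m invmx (lin_mx T)).

Definition Vmx (S : 'M[F]_n -> 'M[F]_n) (Mz Mw : 'M[F]_n) : 'M[F]_n :=
  \matrix_(i, j) \sum_b (sopinv (stabop S Mz Mw) (Mz *m S (delta_mx j b) *m Mw)) i b.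

Lemma stabop_mx S Mz Mw : superlin S ->
  lin_mx (stabop S Mz Mw) = 1%:M - lin_mx S *m smul Mz Mw.
Proof.
move=> lS; apply: lin_mx_eq => [|X]; first exact: superlin_stabop.
by rewrite mulmxBr mulmx1 mulmxA mul_lin_mx // mul_smul -linearB.
Qed.

(** The sum over one index in the definition of [V] turns the trace into a
    trace over all of matrix space, and the trace is then the logarithmic
    derivative of the stability operator in the direction [L]. *)
Lemma trace_Vmx S L Mz Mw : superlin S -> Mz \in unitmx ->
  let B := 1%:M - lin_mx S *m smul Mz Mw in
  B \in unitmx ->
  \tr (L *m invmx Mz *m Vmx S Mz Mw) = \tr (invmx B *m (lin_mx S *m smul L Mw)).
Proof.
move=> lS Mzu B Bu; set Q := L *m invmx Mz.
pose T X := sopinv (stabop S Mz Mw) (Mz *m S X *m Mw).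
have BE : lin_mx (stabop S Mz Mw) = B by rewrite stabop_mx.
have mT X : mxvec (T X) = mxvec X *m (lin_mx S *m smul Mz Mw *m invmx B).
  by rewrite /T /sopinv vec_mxK BE !mulmxA mul_lin_mx // mul_smul.
have lT : superlin T.
  move=> a X Y; apply: (can_inj (@mxvecK _ _ _)); rewrite mT linearP mulmxDl -scalemxAl -!mT.
  by rewrite linearP.
have -> : \tr (Q *m Vmx S Mz Mw) = \tr (lin_mx (fun X => Q *m T X *m 1%:M)).
  rewrite tr_lin_mx; last exact: (superlin_comp (superlin_smul Q 1%:M) lT).
  rewrite /mxtrace; apply: eq_bigr => j _; rewrite mxE.
  under [RHS]eq_bigr => b _ do rewrite mulmx1 mxE.
  rewrite exchange_big /=; apply: eq_bigr => i _.
  by rewrite [Vmx _ _ _ _ _]mxE mulr_sumr; apply: eq_bigr => b _.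
rewrite (lin_mx_comp (superlin_smul Q 1%:M) lT) -/(smul Q 1%:M).
have -> : lin_mx T = lin_mx S *m smul Mz Mw *m invmx B by apply: lin_mx_eq.
have comm : lin_mx S *m smul Mz Mw *m invmx B = invmx B *m (lin_mx S *m smul Mz Mw).
  have e : lin_mx S *m smul Mz Mw = 1%:M - B by rewrite /B opprB addrC subrK.
  by rewrite e mulmxBl mulmxBr mul1mx mulmx1 mulmxV // mulVmx.
rewrite comm -!mulmxA smulM mulmx1 /Q -mulmxA mulVmx // mulmx1.
by [].
Qed.

End SuperTrace.

(** * The trace formula *)

Section TraceFormula.
Variables (R : realType) (C : complexField R).
Variables (c0 C2 : R) (n : nat) (S : 'M[C]_n -> 'M[C]_n) (A : 'M[C]_n).
Hypothesis hS : self_energy c0 C2 S.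

Let S1 := unflat c0 S.

Lemma superlin_unflat : superlin S1.
Proof.
move=> a X Y; rewrite /S1 /unflat (superlin_S hS) /normtr linearP /= mulrDr mulrDr.
rewrite scalerBr [(_ + _)%:M]raddfD /= opprD addrACA; congr (_ - _ + _).
by rewrite scale_scalar_mx; congr (_%:M); ring.
Qed.

(** The functional [X |-> c0 <X>] as a column. *)
Definition phi_col : 'cV[C]_(n * n) := (c0%:CC / n%:R) *: (mxvec (1%:M : 'M[C]_n))^T.

Lemma phi_colE X : mxvec X *m phi_col = (c0%:CC * normtr X)%:M.
Proof.
rewrite -scalemxAr -scale_scalar_mx /normtr -scale_scalar_mx scalerA; congr (_ *: _).
apply/matrixP => i j; rewrite !ord1 !mxE mulr1n (sum_pairs (fun k => mxvec X 0 k * _ k 0)).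
rewrite /mxtrace; apply: eq_bigr => a _; rewrite (bigD1 a) //= big1 ?addr0 => [|b ba].
  by rewrite mxvecE mxE mxvecE mxE eqxx mulr1.
by rewrite mxvecE mxE mxvecE mxE eq_sym (negPf ba) mulr0.
Qed.

Lemma lin_mx_flat : lin_mx S = lin_mx S1 + phi_col *m mxvec 1%:M.
Proof.
apply: lin_mx_eq => [|X]; first exact: superlin_S hS.
rewrite mulmxDr mul_lin_mx; last exact: superlin_unflat.
rewrite mulmxA phi_colE mul_scalar_mx -linearZ -linearD /S1 /unflat scalemx1.
by rewrite subrK.
Qed.

(** The trace splits into a regular part, which involves the stability operator
    without the flat part of [S], and two explicit terms. *)
Lemma trace_formula z w Mz Mw L :
  mdesol S A z Mz -> mdesol S A w Mw -> L - Mz *m S L *m Mz = Mz *m Mz ->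
  let q := (z - w) + c0%:CC * normtr (Mz - Mw) in
  let B1 := 1%:M - lin_mx S1 *m smul Mz Mw in
  B1 \in unitmx -> z - w != 0 -> q != 0 ->
  \tr (L *m invmx Mz *m Vmx S Mz Mw) =
    \tr (invmx B1 *m (lin_mx S1 *m smul L Mw)) - (z - w)^-1 +
    (1 + c0%:CC * normtr L) / q.
Proof.
move=> sz sw hL q B1 B1u zw q0.
set u := mxvec (Mz *m Mw); set Delta := mxvec (Mz - Mw).
have one_smul P : mxvec 1%:M *m smul P Mw = mxvec (P *m Mw).
  by rewrite mul_smul mulmx1.
have BE : 1%:M - lin_mx S *m smul Mz Mw = B1 - phi_col *m u.
  by rewrite lin_mx_flat mulmxDl opprD addrA -mulmxA one_smul.
have DE : lin_mx S *m smul L Mw = lin_mx S1 *m smul L Mw + phi_col *m mxvec (L *m Mw).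
  by rewrite lin_mx_flat mulmxDl -[_ *m _ *m smul L Mw]mulmxA one_smul.
have qE : q = (z - w) + (Delta *m phi_col) 0 0.
  by rewrite phi_colE mxE eqxx mulr1n.
have DB : Delta *m (1%:M - lin_mx S *m smul Mz Mw) = (z - w) *: u.
  rewrite mulmxBr mulmx1 mulmxA mul_lin_mx; last exact: superlin_S hS.
  by rewrite mul_smul -linearB (mde_difference hS sz sw) linearZ.
have DB1 : Delta *m B1 = q *: u.
  rewrite -[B1](subrK (phi_col *m u)) -BE mulmxDr DB mulmxA phi_colE mul_scalar_mx.
  by rewrite -scalerDl.
have muB1 : mxvec L *m B1 - Delta *m (lin_mx S1 *m smul L Mw) =
            (1 + (mxvec L *m phi_col) 0 0) *: u + q *: mxvec (L *m Mw).
  rewrite /B1 mulmxBr mulmx1 !mulmxA !(mul_lin_mx _ superlin_unflat).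
  rewrite !mul_smul -!linearB phi_colE mxE eqxx mulr1n.
  have -> : (1 + c0%:CC * normtr L) *: u + q *: mxvec (L *m Mw) =
     mxvec ((1 + c0%:CC * normtr L) *: (Mz *m Mw) + q *: (L *m Mw)).
    by rewrite linearD !linearZ.
  congr mxvec.
  have SL : S L = invmx Mz *m L *m invmx Mz - 1%:M.
    have := congr1 (fun X => invmx Mz *m X *m invmx Mz) hL; rewrite /= !mulmxBr !mulmxBl.
    rewrite !mulmxA mulVmx ?(mde_unit sz) // !mul1mx mulmxK ?(mde_unit sz) //.
    by rewrite mulmxV ?(mde_unit sz) // => <-; rewrite opprB addrC subrK.
  have SD : S (Mz - Mw) = invmx Mw - invmx Mz - (z - w)%:M.
    rewrite (mde_eq sz) (mde_eq sw) (krausB (se_kraus hS)) [(z - w)%:M]raddfB /=.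
    by apply/matrixP => i j; rewrite !mxE; ring.
  rewrite /S1 /unflat SL SD !mulmxBr !mulmxBl !mul_mx_scalar -!scalemxAl !mulmxA.
  rewrite mulmxV ?(mde_unit sz) // mul1mx !scale1r mulmxKV ?(mde_unit sw) //.
  rewrite /q !scalerDl scale1r.
  by apply/matrixP => i j; rewrite !mxE; ring.
have [Bu tr] := rank_one_trace B1u zw q0 qE DB1 muB1.
rewrite trace_Vmx ?(mde_unit sz) //; [| exact: superlin_S hS | by rewrite BE].
by rewrite BE DE tr phi_colE mxE eqxx mulr1n.
Qed.

End TraceFormula.

(** * Hilbert-Schmidt bounds *)

Section HilbertSchmidt.
Variables (R : realType) (C : complexField R).

Lemma fn2_mxvec m n (X : 'M[C]_(m, n)) : fn2 (mxvec X) = fn2 X.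
Proof.
rewrite !fn2E big_ord1 (reindex (uncurry (@mxvec_index m n))) /=; last exact: curry_mxvec_bij.
by rewrite pair_bigA; apply: eq_bigr => -[a b] _; rewrite mxvecE.
Qed.

Lemma fn2_rows m n (X : 'M[C]_(m, n)) : fn2 X = \sum_i fn2 (row i X).
Proof.
rewrite fn2E; apply: eq_bigr => i _; rewrite fn2E big_ord1.
by apply: eq_bigr => j _; rewrite mxE.
Qed.

Lemma fn2_lin_mx n (T : 'M[C]_n -> 'M[C]_n) : superlin T ->
  fn2 (lin_mx T) = \sum_a \sum_b fn2 (T (delta_mx a b)).
Proof.
move=> lT; rewrite fn2_rows sum_pairs; apply: eq_bigr => a _; apply: eq_bigr => b _.
by rewrite row_lin_mx // fn2_mxvec.
Qed.

Lemma fn2_mul_rows m n p (K : R) (Y : 'M[C]_(m, n)) (P : 'M[C]_(n, p)) :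
  (forall v : 'rV[C]_n, fn2 (v *m P) <= K * fn2 v) -> fn2 (Y *m P) <= K * fn2 Y.
Proof.
move=> h; rewrite !fn2_rows mulr_sumr; apply: ler_sum => i _.
by rewrite row_mul.
Qed.

Lemma tr_mul_le n m (X : 'M[C]_(n, m)) (Y : 'M[C]_(m, n)) :
  cnorm (\tr (X *m Y)) ^+ 2 <= fn2 X * fn2 Y.
Proof.
have -> : \tr (X *m Y) = \sum_ij X ij.1 ij.2 * Y ij.2 ij.1.
  rewrite sum_pairE /=.
  by apply: eq_bigr => i _; rewrite mxE.
apply: le_trans (cnorm_sum_CS _ _) _; le_eq.
by rewrite !fn2E !sum_pairE; congr (_ * _); rewrite exchange_big.
Qed.

(** Summing the bound on the coefficients over vectors [P_(r,.)] placed at a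
    fixed second index. *)
Lemma cov_slice n (g : 'I_n * 'I_n -> 'I_n * 'I_n -> C) (c : R) (P : 'M[C]_n) :
  covbound g c ->
  \sum_r \sum_a \sum_be cnorm (\sum_i g (i, a) be * P r i) ^+ 2 <= n%:R * c ^+ 2 * fn2 P.
Proof.
move=> bg; have slice r a : \sum_be cnorm (\sum_i g (i, a) be * P r i) ^+ 2 <=
    c ^+ 2 * \sum_i cnorm (P r i) ^+ 2.
  have := bg (fun al => if al.2 == a then P r al.1 else 0).
  have e1 be : \sum_al g al be * (if al.2 == a then P r al.1 else 0) =
               \sum_i g (i, a) be * P r i.
    rewrite sum_pairE /=.
    apply: eq_bigr => i _; rewrite (bigD1 a) //= eqxx big1 ?addr0 // => b /negPf ->.
    by rewrite mulr0.
  under eq_bigr do rewrite e1.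
  rewrite [X in _ <= _ * X]sum_pairE /= => h; apply: le_trans h _; le_eq.
  congr (_ * _); apply: eq_bigr => i _; rewrite (bigD1 a) //= eqxx big1 ?addr0 //.
  by move=> b /negPf ->; rewrite cnorm0 expr0n.
rewrite fn2E mulr_sumr; apply: ler_sum => r _.
apply: le_trans (ler_sum _ (fun a _ => slice r a)) _.
by rewrite sumr_const card_ord -[X in X <= _]mulr_natl mulrA.
Qed.

Lemma cov_slice' n (g : 'I_n * 'I_n -> 'I_n * 'I_n -> C) (c : R) (P : 'M[C]_n) :
  covbound g c ->
  \sum_r \sum_a \sum_be cnorm (\sum_i g (a, i) be * P r i) ^+ 2 <= n%:R * c ^+ 2 * fn2 P.
Proof.
move=> bg; apply: (@cov_slice _ (fun al be => g (al.2, al.1) be)) => x.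
have := bg (fun al => x (swap_ix al)); rewrite -[X in _ ^+ 2 * X]reindex_swap.
under [X in _ <= _ * X]eq_bigr => al _ do rewrite swap_ixK.
apply: le_trans; le_eq; apply: eq_bigr => be _; rewrite -[X in _ = cnorm X ^+ 2]reindex_swap.
by congr (cnorm _ ^+ 2); apply: eq_bigr => -[].
Qed.

Lemma superlin_sum n (T : 'M[C]_n -> 'M[C]_n) I (r : seq I) (a : I -> C) X :
  superlin T -> T (\sum_(i <- r) a i *: X i) = \sum_(i <- r) a i *: T (X i).
Proof.
move=> lT; elim: r => [|i r IH]; last by rewrite !big_cons lT IH.
by rewrite !big_nil; have := lT (-1) 0 0; rewrite scaler0 addr0 scaleN1r addNr.
Qed.

Section Covariance.
Variables (n : nat) (T : 'M[C]_n -> 'M[C]_n) (g : 'I_n * 'I_n -> 'I_n * 'I_n -> C) (c : R).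
Hypothesis bg : covbound g c.
Hypothesis gC : forall al be, g al be = g be al.
Hypothesis TE : forall X, T X = covform g X.

Lemma superlin_cov : superlin T.
Proof.
move=> a X Y; rewrite !TE; apply/matrixP => i j; rewrite !mxE mulr_sumr -big_split.
apply: eq_bigr => k _; rewrite mulr_sumr -big_split; apply: eq_bigr => l _ /=.
by rewrite !mxE mulrDr mulrCA.
Qed.

Lemma cov_delta a b i j : T (delta_mx a b) i j = g (i, a) (b, j).
Proof.
rewrite TE mxE (bigD1 a) //= (bigD1 b) //= mxE !eqxx mulr1 !big1 ?addr0 //.
  by move=> k ka; apply: big1 => l _; rewrite mxE (negPf ka) mulr0.
by move=> l lb; rewrite mxE eqxx (negPf lb) mulr0.
Qed.

(** Composing the covariance map with a one-sided multiplication by [P] gives an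
    operator on matrix space whose Hilbert-Schmidt norm does not see the operator
    norm of [P], only its Frobenius norm; this is how [M'], which is bounded only
    in that norm, is controlled. *)
Lemma fn2_smull (P : 'M[C]_n) : fn2 (lin_mx T *m smul P 1%:M) <= n%:R * c ^+ 2 * fn2 P.
Proof.
rewrite -(lin_mx_comp (superlin_smul P 1%:M) superlin_cov) fn2_lin_mx; last first.
  exact: superlin_comp (superlin_smul P 1%:M) superlin_cov.
apply: le_trans (cov_slice P bg); le_eq.
rewrite [RHS]exchange_big /=; apply: eq_bigr => a _.
under eq_bigr => b _ do rewrite mulmx1 fn2E.
rewrite exchange_big /=; apply: eq_bigr => r _; rewrite [RHS]sum_pairE.
apply: eq_bigr => b _; apply: eq_bigr => j _; congr (cnorm _ ^+ 2); rewrite mxE.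
by apply: eq_bigr => i _; rewrite cov_delta mulrC.
Qed.

Lemma fn2_smulr (P : 'M[C]_n) : fn2 (lin_mx T *m smul 1%:M P) <= n%:R * c ^+ 2 * fn2 P.
Proof.
rewrite -(lin_mx_comp (superlin_smul 1%:M P) superlin_cov) fn2_lin_mx; last first.
  exact: superlin_comp (superlin_smul 1%:M P) superlin_cov.
rewrite -(fn2_tr P); apply: le_trans (cov_slice' P^T bg).
le_eq.
under eq_bigr => a _ do under eq_bigr => b _ do rewrite mul1mx fn2E.
rewrite exchange_big [RHS]exchange_big /=; apply: eq_bigr => b _.
under [RHS]eq_bigr => r _ do rewrite sum_pairE.
rewrite exchange_big [RHS]exchange_big /=; apply: eq_bigr => i _.
rewrite [RHS]exchange_big /=; apply: eq_bigr => a _; apply: eq_bigr => r _.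
congr (cnorm _ ^+ 2); rewrite mxE; apply: eq_bigr => l _.
by rewrite cov_delta gC [P^T _ _]mxE.
Qed.

Lemma fn2_smul_pre (P : 'M[C]_n) : fn2 (smul 1%:M P *m lin_mx T) <= n%:R * c ^+ 2 * fn2 P.
Proof.
rewrite -(lin_mx_comp superlin_cov (superlin_smul 1%:M P)) fn2_lin_mx; last first.
  exact: superlin_comp superlin_cov (superlin_smul 1%:M P).
apply: le_trans (cov_slice P bg); le_eq.
rewrite exchange_big /=; apply: eq_bigr => b _.
under eq_bigr => a _ do rewrite mul1mx fn2E.
under [RHS]eq_bigr => r _ do rewrite sum_pairE.
rewrite exchange_big [RHS]exchange_big /=; apply: eq_bigr => i _.
rewrite exchange_big /=; apply: eq_bigr => j _; apply: eq_bigr => a _.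
congr (cnorm _ ^+ 2).
have -> : delta_mx a b *m P = \sum_r P b r *: delta_mx a r.
  apply/matrixP => k l; rewrite summxE (bigD1 l) //= big1 ?addr0 => [|r rl].
    rewrite !mxE eqxx andbT (bigD1 b) //= big1 ?addr0 => [|r rb].
      by rewrite !mxE eqxx andbT mulrC.
    by rewrite !mxE (negPf rb) andbF mul0r.
  by rewrite !mxE [l == r]eq_sym (negPf rl) andbF mulr0.
rewrite (superlin_sum _ _ _ superlin_cov).
by rewrite summxE; apply: eq_bigr => r _; rewrite mxE cov_delta gC mulrC.
Qed.

(** The trace of [X |-> P T(X) Q] pairs the coefficients with [P] and [Q]. *)
Lemma tr_cov (P Q : 'M[C]_n) :
  cnorm (\tr (lin_mx T *m smul P Q)) ^+ 2 <= c ^+ 2 * fn2 P * fn2 Q.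
Proof.
rewrite -(lin_mx_comp (superlin_smul P Q) superlin_cov) tr_lin_mx; last first.
  exact: superlin_comp (superlin_smul P Q) superlin_cov.
have -> : \sum_a \sum_b (P *m T (delta_mx a b) *m Q) a b =
   \sum_be (\sum_al g al be * P al.2 al.1) * Q be.2 be.1.
  rewrite [RHS]sum_pairE exchange_big /=; apply: eq_bigr => b _.
  under eq_bigr => a _ do rewrite mxE.
  rewrite exchange_big /=; apply: eq_bigr => j _; rewrite -mulr_suml; congr (_ * _).
  rewrite sum_pairE exchange_big /=.
  apply: eq_bigr => a _; rewrite mxE; apply: eq_bigr => i _.
  by rewrite cov_delta mulrC.
apply: le_trans (cnorm_sum_CS _ _) _.
have sw (X : 'M[C]_n) : \sum_be cnorm (X be.2 be.1) ^+ 2 = fn2 X.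
  by rewrite sum_pairE exchange_big fn2E.
rewrite sw ler_wpM2r ?fn2_ge0 //.
by have := bg (fun al => P al.2 al.1); rewrite sw.
Qed.

End Covariance.
End HilbertSchmidt.

(** * The regular part of the derivative *)

Section DerivativeBound.
Variables (R : realType) (C : complexField R).
Variables (c0 C2 : R).
Hypothesis c0_gt0 : 0 < c0.
Hypothesis C2_gt0 : 0 < C2.

Lemma le_of_sqr (x p : R) : x ^+ 2 <= p -> x <= p + 1.
Proof. by move=> h; have := sqr_ge0 (x - 1); nra. Qed.

(** Without its flat part, [S] still has bounded coefficients: the flat part has
    those of a multiple of the flip of index pairs. *)
Lemma unflat_cov n (S : 'M[C]_n -> 'M[C]_n) : (0 < n)%N -> self_energy c0 C2 S ->
  exists g, [/\ covbound g (2 * (C2 + c0) / n%:R),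
    forall al be, g al be = g be al & forall X, unflat c0 S X = covform g X].
Proof.
move=> n_gt0 hS; have [g [bg gC SE]] := se_cov hS.
have n0R : 0 < n%:R :> R by rewrite ltr0n.
pose g1 al be : C := g al be - if al == (be.2, be.1) then (c0 / n%:R)%:CC else 0.
exists g1; split.
- move=> x.
  have e be : \sum_al g1 al be * x al =
      \sum_al g al be * x al - (c0 / n%:R)%:CC * x (be.2, be.1).
    under eq_bigr => al _ do rewrite /g1 mulrBl.
    rewrite sumrB; congr (_ - _); rewrite (bigD1 (be.2, be.1)) //= eqxx.
    by rewrite big1 ?addr0 // => al /negPf ->; rewrite mul0r.
  have two (a b : C) : cnorm (a - b) ^+ 2 <= 2 * cnorm a ^+ 2 + 2 * cnorm b ^+ 2.
    have := cnormD a (- b); rewrite cnormN => h.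
    have a0 := cnorm_ge0 a; have b0 := cnorm_ge0 b; have ab := cnorm_ge0 (a - b).
    move: (cnorm a) (cnorm b) (cnorm (a - b)) h a0 b0 ab => p q r h p0 q0 r0.
    apply: (@le_trans _ _ ((p + q) ^+ 2)); first by rewrite ler_pXn2r ?nnegrE ?addr_ge0.
    by have := sqr_ge0 (p - q); rewrite !expr2; nra.
  apply: le_trans (_ : \sum_be (2 * cnorm (\sum_al g al be * x al) ^+ 2 +
           2 * ((c0 / n%:R) ^+ 2 * cnorm (x (be.2, be.1)) ^+ 2)) <= _).
    apply: ler_sum => be _; rewrite e; apply: le_trans (two _ _) _.
    rewrite lerD2l cnormM exprMn cnorm_real ger0_norm //.
    by rewrite divr_ge0 ?ltW.
  rewrite big_split /= -!mulr_sumr.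
  have -> : \sum_i cnorm (x (i.2, i.1)) ^+ 2 = \sum_al cnorm (x al) ^+ 2.
    by rewrite -[RHS]reindex_swap.
  have := bg x; set u := \sum_be _; set v := \sum_al cnorm (x al) ^+ 2 => h.
  have v0 : 0 <= v by apply: sumr_ge0 => i _; apply: sqr_ge0.
  have -> : (2 * (C2 + c0) / n%:R) ^+ 2 * v =
    2 * ((C2 / n%:R) ^+ 2 * v) + 2 * ((c0 / n%:R) ^+ 2 * v) +
    n%:R^-1 ^+ 2 * (2 * C2 ^+ 2 + 2 * c0 ^+ 2 + 8 * (C2 * c0)) * v by ring.
  have : 0 <= n%:R^-1 ^+ 2 * (2 * C2 ^+ 2 + 2 * c0 ^+ 2 + 8 * (C2 * c0)) * v.
    by rewrite mulr_ge0 // mulr_ge0 ?sqr_ge0 //; posr.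
  by move=> r0; rewrite -[X in X <= _]addr0; apply: lerD => //; rewrite lerD2r ler_pM2l.
- move=> [a b] [c d]; rewrite /g1 (gC (a, b)) /=; congr (_ - _).
  by rewrite !xpair_eqE andbC [b == c]eq_sym [a == d]eq_sym.
- move=> X; rewrite /unflat SE; apply/matrixP => i j; rewrite !mxE.
  under [RHS]eq_bigr => a _.
    under eq_bigr => b _ do rewrite /g1 /= mulrBl.
    rewrite sumrB; over.
  rewrite sumrB; congr (_ - _).
  rewrite /normtr /mxtrace; have [->|ij] := eqVneq i j; last first.
    rewrite mulr0n big1 // => a _; apply: big1 => b _.
    by rewrite xpair_eqE (negPf ij) mul0r.
  rewrite mulr1n mulrA mulr_sumr; apply: eq_bigr => a _.
  rewrite (bigD1 a) //= eqxx big1 ?addr0 => [|b ba].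
    by rewrite rmorphM fmorphV rmorph_nat.
  by rewrite xpair_eqE eqxx eq_sym (negPf ba) mul0r.
Qed.

Lemma fn2_mul_smul n m (b1 b2 : R) (P Q : 'M[C]_n) (Y : 'M[C]_(m, n * n)) :
  0 < b1 -> 0 < b2 -> opb b1 P -> opb b2 Q -> fn2 (Y *m smul P Q) <= b1 * b2 * fn2 Y.
Proof.
move=> b10 b20 bP bQ; apply: fn2_mul_rows => v.
rewrite -[v]vec_mxK mul_smul !fn2_mxvec; apply: le_trans (opb_mulr _ b20 bQ) _.
by rewrite [b1 * b2]mulrC -mulrA ler_pM2l.
Qed.

Lemma opb1 n B : 1 <= B -> opb B (1%:M : 'M[C]_n).
Proof. by move=> B1 p V; rewrite mul1mx ler_peMl ?fn2_ge0. Qed.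

(** On opposite sides of the real axis the imaginary parts of [z - w] and of
    [<Mz - Mw>] have the same sign. *)
Lemma pole_lower n (S : 'M[C]_n -> 'M[C]_n) A B z w Mz Mw :
  bulk S A B z Mz -> bulk S A B w Mw -> cim z * cim w < 0 ->
  c0 / B <= cnorm ((z - w) + c0%:CC * normtr (Mz - Mw)).
Proof.
move=> bz bw zw; have B0 : 0 < B by apply: lt_le_trans (bulk_ge1 bz).
apply: le_trans (cim_le_cnorm _).
rewrite cimD cimB cimZ normtrB cimB.
have nz := normtr_habs z Mz; have nw := normtr_habs w Mw.
have := bulk_thr bz; have := bulk_thr bw; rewrite nz nw.
have far (a b X Y e : R) : 0 < a -> b < 0 -> e <= X -> Y < 0 -> e <= a - b + (X - Y).
  by move=> *; lra.
have [zp|zn] := ltrP 0 (cim z).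
  have wn : cim w < 0 by move: zw; rewrite pmulr_rlt0.
  rewrite (gtr0_sg zp) (ltr0_sg wn) mul1r mulN1r => a1 a2.
  apply: le_trans (ler_norm _); rewrite mulrBr; apply: far => //.
    by rewrite ler_pM2l.
  by rewrite pmulr_rlt0 // -oppr_gt0 (lt_le_trans _ a1) // invr_gt0.
have zn' : cim z < 0.
  by rewrite lt_def zn andbT; apply: contraTneq zw => <-; rewrite mul0r ltxx.
have wp : 0 < cim w by move: zw; rewrite nmulr_rlt0.
rewrite (gtr0_sg wp) (ltr0_sg zn') mul1r mulN1r => a1 a2.
rewrite -normrN; apply: le_trans (ler_norm _).
rewrite mulrBr (_ : - (_ + _) = cim w - cim z + (c0 * cim (normtr Mw) -
  c0 * cim (normtr Mz))); last by ring.
apply: far => //; first by rewrite ler_pM2l.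
by rewrite pmulr_rlt0 // -oppr_gt0 (lt_le_trans _ a2) // invr_gt0.
Qed.

(** All the terms of the derivative of the trace, apart from the explicit double
    pole, are bounded by a constant: traces of products of two operators are
    bounded by the Hilbert-Schmidt norms of these, and [S] contributes a bounded
    Hilbert-Schmidt norm. *)
Lemma derivative_bound (B : R) : 1 <= B -> exists K : R, 0 < K /\ exists n0 : nat,
  forall n (S : 'M[C]_n -> 'M[C]_n) A z w Mz Mw L L', (n0 < n)%N ->
    self_energy c0 C2 S -> adjm A = A -> bulk S A B z Mz -> bulk S A B w Mw ->
    cim z * cim w < 0 ->
    L - Mz *m S L *m Mz = Mz *m Mz -> L' - Mw *m S L' *m Mw = Mw *m Mw ->
  let S1 := lin_mx (unflat c0 S) in
  let B1 := 1%:M - S1 *m smul Mz Mw in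
  let q := (z - w) + c0%:CC * normtr (Mz - Mw) in
  [/\ B1 \in unitmx, q != 0 &
    cnorm (\tr (invmx B1 *m (S1 *m smul Mz L') *m invmx B1 *m (S1 *m smul L Mw)) +
           \tr (invmx B1 *m (S1 *m smul L L')) +
           (1 + c0%:CC * normtr L) * (1 + c0%:CC * normtr L') / q ^+ 2) <= K].
Proof.
move=> B1; have B0 : 0 < B by apply: lt_le_trans B1.
have [K1 [K10 [n1 hK1]]] := pair_stable C C2 c0_gt0 B1.
have [K2 [K20 [n2 hK2]]] := same_side_stable C C2 c0_gt0 B1.
set l := K2 * B ^+ 2; have l0 : 0 < l by rewrite /l; posr.
set Gm := (2 * (C2 + c0)) ^+ 2; have Gm0 : 0 < Gm by rewrite /Gm; posr.
set p1 := K1 * (B * B) * (Gm * l) * (K1 * (B * B) * (Gm * l)).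
set p2 := Gm * l * l.
set p3 := K1 * (B * B) * (Gm * l) * (Gm * l).
set p4 := (1 + c0 * (l + 1)) ^+ 2 * (B / c0) ^+ 2.
exists ((p1 + 1) + ((p2 + 1) + (p3 + 1)) + p4); split.
  by rewrite /p1 /p2 /p3 /p4; posr.
exists (maxn n1 n2) => n S A z w Mz Mw L L'; rewrite gtn_max => /andP[gt1 gt2].
move=> hS hA bz bw zw hL hL' S1 D q.
have n_gt0 : (0 < n)%N by apply: leq_ltn_trans gt1.
have n0R : 0 < n%:R :> R by rewrite ltr0n.
have lS1 : superlin (unflat c0 S) := superlin_unflat hS.
have low := hK1 n S A z w Mz Mw gt1 hS hA bz bw.
have DE : lin_mx (stabop (unflat c0 S) Mz Mw) = D by rewrite stabop_mx.
have Du : D \in unitmx.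
  rewrite -DE; apply: lin_mx_unit; first exact: superlin_stabop.
  exact: (lower_inj low).
have lowv (v : 'rV[C]_(n * n)) : fn2 (v *m invmx D) <= K1 * fn2 v.
  set x := v *m invmx D; have -> : v = x *m D by rewrite mulmxKV.
  rewrite -[x]vec_mxK -DE mul_lin_mx; last exact: superlin_stabop.
  by rewrite !fn2_mxvec.
have DR m (Y : 'M[C]_(m, n * n)) : fn2 (Y *m invmx D) <= K1 * fn2 Y.
  exact: fn2_mul_rows.
have DL m (Y : 'M[C]_(n * n, m)) : fn2 (invmx D *m Y) <= K1 * fn2 Y.
  rewrite -[invmx D]adjmK; apply: (opb_adj K10) => p V.
  by rewrite -fn2_adj adjmM adjmK -(fn2_adj V).
have [g [bg gC gE]] := unflat_cov n_gt0 hS.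
set c1 := 2 * (C2 + c0) / n%:R in bg.
have nc1 : n%:R * c1 ^+ 2 = Gm / n%:R by rewrite /c1 /Gm; field; rewrite gt_eqF.
have Lb (z' : C) M' X : bulk S A B z' M' -> X - M' *m S X *m M' = M' *m M' -> fn2 X <= l * n%:R.
  move=> b' hX; apply: le_trans (hK2 n S A z' M' gt2 hS hA b' X) _; rewrite hX.
  rewrite /l expr2 -!mulrA ler_pM2l //; apply: le_trans (bulk_M b' _) _.
  by rewrite ler_pM2l //; apply: opb_fn2 (bulk_M b').
have fL := Lb _ _ _ bz hL; have fL' := Lb _ _ _ bw hL'.
have hsb (X : 'M[C]_n) : fn2 X <= l * n%:R -> n%:R * c1 ^+ 2 * fn2 X <= Gm * l.
  move=> h; rewrite nc1 -mulrA ler_pM2l // ler_pdivrMl // [n%:R * _]mulrC //.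
have sl (X : 'M[C]_n) : fn2 X <= l * n%:R -> fn2 (S1 *m smul X 1%:M) <= Gm * l.
  by move=> h; apply: le_trans (fn2_smull bg gE X) _; apply: hsb.
have sr (X : 'M[C]_n) : fn2 X <= l * n%:R -> fn2 (S1 *m smul 1%:M X) <= Gm * l.
  by move=> h; apply: le_trans (fn2_smulr bg gC gE X) _; apply: hsb.
have sp (X : 'M[C]_n) : fn2 X <= l * n%:R -> fn2 (smul 1%:M X *m S1) <= Gm * l.
  by move=> h; apply: le_trans (fn2_smul_pre bg gC gE X) _; apply: hsb.
have BB0 : 0 < B * B by rewrite mulr_gt0.
have b1 : opb B (1%:M : 'M[C]_n) by apply: opb1.
(* A two-sided multiplication is split into two one-sided ones: the factor [L] or
   [L'] goes to the covariance map, the other one is bounded as an operator. *)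
have h1 : fn2 (invmx D *m (S1 *m smul Mz L')) <= K1 * (B * B) * (Gm * l).
  apply: le_trans (DL _ _) _; rewrite -mulrA ler_pM2l //.
  have -> : smul Mz L' = smul 1%:M L' *m smul Mz 1%:M by rewrite smulM !mulmx1.
  rewrite mulmxA; apply: le_trans (fn2_mul_smul _ B0 B0 (bulk_M bz) b1) _.
  by rewrite ler_pM2l // sr.
have h2 : fn2 (invmx D *m (S1 *m smul L Mw)) <= K1 * (B * B) * (Gm * l).
  apply: le_trans (DL _ _) _; rewrite -mulrA ler_pM2l //.
  have -> : smul L Mw = smul L 1%:M *m smul 1%:M Mw by rewrite smulM !mul1mx.
  rewrite mulmxA; apply: le_trans (fn2_mul_smul _ B0 B0 b1 (bulk_M bw)) _.
  by rewrite ler_pM2l // sl.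
have h3 : fn2 (smul 1%:M L' *m (S1 *m smul Mz Mw) *m invmx D) <= K1 * (B * B) * (Gm * l).
  apply: le_trans (DR _ _) _; rewrite -mulrA ler_pM2l // mulmxA.
  apply: le_trans (fn2_mul_smul _ B0 B0 (bulk_M bz) (bulk_M bw)) _.
  by rewrite ler_pM2l // sp.
have t1 : cnorm (\tr (invmx D *m (S1 *m smul Mz L') *m invmx D *m (S1 *m smul L Mw))) <= p1 + 1.
  apply: le_of_sqr; rewrite -[_ *m invmx D *m _]mulmxA; apply: le_trans (tr_mul_le _ _) _.
  by apply: ler_pM; rewrite ?fn2_ge0.
have t2 : cnorm (\tr (S1 *m smul L L')) <= p2 + 1.
  apply: le_of_sqr; apply: le_trans (tr_cov bg gE L L') _.
  apply: (@le_trans _ _ (c1 ^+ 2 * (l * n%:R) * (l * n%:R))).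
    apply: ler_pM => //; [|exact: fn2_ge0|]; last by apply: ler_wpM2l; rewrite ?sqr_ge0.
    by apply: mulr_ge0; [exact: sqr_ge0 | exact: fn2_ge0].
  le_eq; rewrite /p2.
  rewrite (_ : _ * _ = (n%:R * c1 ^+ 2) * n%:R * (l * l)); last by ring.
  by rewrite nc1 divfK ?gt_eqF // mulrA.
(* Only the first-order term of this expansion lacks two Hilbert-Schmidt factors;
   it is bounded by [tr_cov]. *)
have inv1 : invmx D = 1%:M + (S1 *m smul Mz Mw) *m invmx D.
  have -> : S1 *m smul Mz Mw = 1%:M - D by rewrite /D opprB addrC subrK.
  by rewrite mulmxBl mul1mx mulmxV // addrC subrK.
have t3 : cnorm (\tr (invmx D *m (S1 *m smul L L'))) <= (p2 + 1) + (p3 + 1).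
  rewrite inv1 mulmxDl mul1mx mxtraceD; apply: le_trans (cnormD _ _) _.
  apply: lerD t2 _; apply: le_of_sqr.
  have -> : smul L L' = smul L 1%:M *m smul 1%:M L' by rewrite smulM !mul1mx.
  rewrite [S1 *m (_ *m _)]mulmxA [X in \tr X]mulmxA mxtrace_mulC !mulmxA.
  rewrite -(mulmxA _ S1 (smul L _)); apply: le_trans (tr_mul_le _ _) _.
  apply: ler_pM; [exact: fn2_ge0 | exact: fn2_ge0 | | exact: sl].
  by rewrite [smul 1%:M L' *m _]mulmxA in h3.
have imq : c0 / B <= cnorm q := pole_lower bz bw zw.
have cB0 : 0 < c0 / B by rewrite divr_gt0.
have q_gt0 : 0 < cnorm q by apply: lt_le_trans imq.
have phiL (X : 'M[C]_n) : fn2 X <= l * n%:R -> cnorm (1 + c0%:CC * normtr X) <= 1 + c0 * (l + 1).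
  move=> h; apply: le_trans (cnormD _ _) _.
  rewrite cnorm1 lerD2l cnormM cnorm_real.
  rewrite (gtr0_norm c0_gt0) ler_pM2l //; apply: le_of_sqr.
  by apply: le_trans (normtr_sqr_le X n_gt0) _; rewrite ler_pdivrMl // mulrC.
have t4 : cnorm ((1 + c0%:CC * normtr L) * (1 + c0%:CC * normtr L') / q ^+ 2) <= p4.
  rewrite !cnormM cnormV [q ^+ 2]expr2 cnormM invfM /p4 expr2.
  have iq : (cnorm q)^-1 <= B / c0 by rewrite -[B / c0]invrK lef_pV2 ?posrE ?invr_gt0 ?invf_div // divr_gt0.
  apply: ler_pM; rewrite ?mulr_ge0 ?cnorm_ge0 ?invr_ge0 ?cnorm_ge0 //.
    by apply: ler_pM; rewrite ?cnorm_ge0 ?phiL.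
  by rewrite expr2; apply: ler_pM; rewrite ?invr_ge0 ?cnorm_ge0.
split=> //; first by rewrite -cnorm_eq0 gt_eqF.
apply: le_trans (cnormD _ _) _; apply: lerD t4.
by apply: le_trans (cnormD _ _) _; apply: lerD.
Qed.

End DerivativeBound.

(** * Limits and complex derivatives *)

Section MatrixLimits.
Variables (K : numFieldType) (T : Type) (F : set_system T).
Context {FF : Filter F}.

Definition mcvg m n (f : T -> 'M[K]_(m, n)) (L : 'M[K]_(m, n)) : Prop :=
  forall i j, (fun t => f t i j) @ F --> L i j.

Lemma cvg_sum_seq I (r : seq I) (P : pred I) (f : I -> T -> K) (l : I -> K) :
  (forall i, f i @ F --> l i) ->
  (fun t => \sum_(i <- r | P i) f i t) @ F --> \sum_(i <- r | P i) l i.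
Proof. by move=> h; apply: cvg_big => //; exact: add_continuous. Qed.

Lemma cvg_prod_seq I (r : seq I) (P : pred I) (f : I -> T -> K) (l : I -> K) :
  (forall i, f i @ F --> l i) ->
  (fun t => \prod_(i <- r | P i) f i t) @ F --> \prod_(i <- r | P i) l i.
Proof. by move=> h; apply: cvg_big => //; exact: mul_continuous. Qed.

Lemma mcvg_cst m n (L : 'M[K]_(m, n)) : mcvg (fun=> L) L.
Proof. by move=> i j; apply: cvg_cst. Qed.

Lemma mcvgB m n (f g : T -> 'M[K]_(m, n)) L L' :
  mcvg f L -> mcvg g L' -> mcvg (fun t => f t - g t) (L - L').
Proof.
move=> hf hg i j; rewrite !mxE; under eq_fun do rewrite !mxE.
exact: cvgB.
Qed.

Lemma mcvgM m n p (f : T -> 'M[K]_(m, n)) (g : T -> 'M[K]_(n, p)) L L' :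
  mcvg f L -> mcvg g L' -> mcvg (fun t => f t *m g t) (L *m L').
Proof.
move=> hf hg i j; rewrite mxE; under eq_fun do rewrite mxE.
by apply: cvg_sum_seq => k; apply: cvgM.
Qed.

Lemma mcvg_tr n (f : T -> 'M[K]_n) L : mcvg f L ->
  (fun t => \tr (f t)) @ F --> \tr L.
Proof. by move=> hf; apply: cvg_sum_seq => i. Qed.

Lemma mcvg_det n (f : T -> 'M[K]_n) L : mcvg f L ->
  (fun t => \det (f t)) @ F --> \det L.
Proof.
move=> hf; apply: cvg_sum_seq => s; apply: cvgM; first exact: cvg_cst.
exact: cvg_prod_seq.
Qed.

Lemma near_unitmx n (f : T -> 'M[K]_n) L : mcvg f L -> L \in unitmx ->
  \forall t \near F, f t \in unitmx.
Proof.
move=> hf; rewrite unitmxE unitfE => L0.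
have := mcvg_det hf => /cvgrPdist_lt /(_ `|\det L|).
rewrite normr_gt0 L0 => /(_ isT); apply: filterS => t h.
rewrite unitmxE unitfE; apply: contraTneq h => ->.
by rewrite subr0 ltxx.
Qed.

Lemma mcvg_inv n (f : T -> 'M[K]_n) L : mcvg f L -> L \in unitmx ->
  mcvg (fun t => invmx (f t)) (invmx L).
Proof.
move=> hf Lu i j; have nu := near_unitmx hf Lu.
have Ld : \det L != 0 by rewrite -unitfE -unitmxE.
have e (X : 'M[K]_n) : X \in unitmx -> invmx X i j = (\det X)^-1 * cofactor X j i.
  by move=> Xu; rewrite /invmx Xu !mxE.
rewrite e //; apply: (@cvg_trans _ ((fun t => (\det (f t))^-1 * cofactor (f t) j i) @ F)).
  apply: near_eq_cvg; apply: filterS nu => t ft; by rewrite e.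
apply: cvgM; first exact: cvgV Ld (mcvg_det hf).
apply: cvgM; first exact: cvg_cst.
apply: mcvg_det => k l; rewrite !mxE; under eq_fun do rewrite !mxE.
exact: hf.
Qed.

End MatrixLimits.

Section Derivative.
Variables (K : numFieldType).

Lemma is_derive_of_cvg (f : K -> K) (z l : K) :
  (fun h => h^-1 * (f (z + h) - f z)) @ 0^' --> l ->
  is_derive (z : K^o) 1 (f : K^o -> K^o) (l : K^o).
Proof.
move=> h.
have e : (fun h : K => h^-1 *: (((f : K^o -> K^o) \o shift (z : K^o)) (h *: (1 : K^o)) - f z)) =
         (fun h => h^-1 * (f (z + h) - f z)).
  apply/funext => x /=; rewrite /shift /=.
  by rewrite (_ : x *: (1 : K^o) = x) ?[x + z]addrC //; exact: mulr1.
split; first by rewrite /derivable e; apply/cvg_ex; exists l.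
by rewrite /derive e; apply: cvg_lim.
Qed.

End Derivative.

Section TraceDerivative.
Variables (R : realType) (C : complexField R).
Variables (c0 C2 : R) (n : nat) (S : 'M[C]_n -> 'M[C]_n) (A : 'M[C]_n).
Hypothesis C2_gt0 : 0 < C2.
Hypothesis n_gt0 : (0 < n)%N.
Hypothesis hS : self_energy c0 C2 S.
Hypothesis hA : adjm A = A.
Variable M : C -> 'M[C]_n.
Hypothesis hM : forall z, cim z != 0 -> mdesol S A z (M z).

Lemma entry_le m p (X : 'M[C]_(m, p)) i j : cnorm (X i j) ^+ 2 <= fn2 X.
Proof.
rewrite fn2E (bigD1 i) //= (bigD1 j) //= -addrA lerDl addr_ge0 //.
  by apply: sumr_ge0 => k _; apply: sqr_ge0.
by apply: sumr_ge0 => k _; apply: sumr_ge0 => l _; apply: sqr_ge0.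
Qed.

Lemma cinj_lt (a b : R) : (cinj C a < cinj C b) = (a < b).
Proof. by rewrite !lt_def cinj_le (inj_eq (@cinj_inj _ C)). Qed.

(** The complex derivative of the solution solves the differentiated equation. *)
Lemma quotient_cvg z : cim z != 0 -> exists L, L - M z *m S L *m M z = M z *m M z /\
  mcvg ((0 : C)^') (fun h : C => h^-1 *: (M (z + h) - M z)) L.
Proof.
move=> zim; have [L [hL [K [d [K0 d0 hd]]]]] := mde_diff C2_gt0 n_gt0 hS hA hM zim.
exists L; split=> // i j; apply/cvgrPdist_lt => e e0.
have er : e = (cre e)%:CC by rewrite cre_real // gtr0_real.
have e0' : 0 < cre e by rewrite -cinj_lt -er rmorph0.
have K1 : 0 < K + 1 by posr.
have e1 : (0 : C) < (cre e / (K + 1))%:CC by rewrite -(rmorph0 (cinj C)) cinj_lt divr_gt0.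
have d1 : (0 : C) < d%:CC by rewrite -(rmorph0 (cinj C)) cinj_lt.
near=> h.
have h0 : h != 0 by near: h; exact: nbhs_dnbhs_neq.
have hc : 0 < cnorm h by rewrite lt_def cnorm_eq0 h0 cnorm_ge0.
have h1 : cnorm h < d by rewrite -cinj_lt cinj_norm; near: h; exact: dnbhs0_lt.
have h2 : cnorm h < cre e / (K + 1).
  by rewrite -cinj_lt cinj_norm; near: h; exact: dnbhs0_lt.
rewrite er -cinj_norm cinj_lt -cnormN opprB.
rewrite -(@ltr_pXn2r _ 2) ?nnegrE ?cnorm_ge0 ?ltW //.
set X := h^-1 *: _; have -> : X i j - L i j = (X - L) i j by rewrite [RHS]mxE [(- L) _ _]mxE.
apply: le_lt_trans (entry_le _ _ _) _; apply: le_lt_trans (hd h _) _; first by rewrite hc.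
apply: (@le_lt_trans _ _ (((K + 1) * cnorm h) ^+ 2)).
  rewrite exprMn ler_wpM2r ?sqr_ge0 //.
  by move: (K) K0 => k k0; rewrite expr2; nra.
rewrite ltr_pXn2r ?nnegrE ?mulr_ge0 ?cnorm_ge0 ?ltW //.
by rewrite mulrC -ltr_pdivlMr.
Unshelve. all: by end_near. Qed.

Lemma id_cvg0 : (fun h : C => h) @ (0 : C)^' --> (0 : C).
Proof. exact: cvg_within. Qed.

Lemma quotient_cont z L : mcvg ((0 : C)^') (fun h : C => h^-1 *: (M (z + h) - M z)) L ->
  mcvg ((0 : C)^') (fun h : C => M (z + h)) (M z).
Proof.
move=> hL i j.
have -> : M z i j = 0 * L i j + M z i j by rewrite mul0r add0r.
apply: (@cvg_trans _ ((fun h : C => h * (h^-1 *: (M (z + h) - M z)) i j + M z i j) @ (0 : C)^')).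
  apply: near_eq_cvg; near=> h; have h0 : h != 0 by near: h; exact: nbhs_dnbhs_neq.
  by rewrite !mxE mulrA mulfV // mul1r subrK.
apply: cvgD; last exact: cvg_cst.
by apply: cvgM; [exact: id_cvg0 | exact: hL].
Unshelve. all: by end_near. Qed.

Lemma entry_derive z L i j : mcvg ((0 : C)^') (fun h : C => h^-1 *: (M (z + h) - M z)) L ->
  is_derive (z : C^o) 1 (fun u : C^o => M u i j : C^o) (L i j).
Proof.
move=> hL; apply: (is_derive_of_cvg (f := fun u => M u i j)).
have := hL i j; apply: cvg_trans; apply: near_eq_cvg; near=> h.
by rewrite !mxE.
Unshelve. all: by end_near. Qed.

Lemma smulE (P Q : 'M[C]_n) a b c d :
  smul P Q (mxvec_index a b) (mxvec_index c d) = P c a * Q b d.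
Proof.
transitivity (row (mxvec_index a b) (smul P Q) 0 (mxvec_index c d)); first by rewrite [RHS]mxE.
rewrite row_lin_mx; last exact: superlin_smul.
rewrite mxvecE mxE (bigD1 b) //= big1 ?addr0 => [|k kb]; last first.
  rewrite mxE big1 ?mul0r // => l _.
  by rewrite [delta_mx _ _ _ _]mxE (negPf kb) andbF mulr0.
rewrite mxE (bigD1 a) //= big1 ?addr0 => [|k ka]; last first.
  by rewrite [delta_mx _ _ _ _]mxE (negPf ka) mulr0.
by rewrite [delta_mx _ _ _ _]mxE !eqxx mulr1.
Qed.

Lemma mcvg_smul (P L : 'M[C]_n) (f : C -> 'M[C]_n) : mcvg ((0 : C)^') f L ->
  mcvg ((0 : C)^') (fun h : C => smul P (f h)) (smul P L).
Proof.
move=> hf k l; case/mxvec_indexP: k => a b; case/mxvec_indexP: l => c d.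
rewrite smulE; under eq_fun do rewrite smulE.
by apply: cvgM; [exact: cvg_cst | exact: hf].
Qed.

Lemma near_neq0 (f : C -> C) l : f @ (0 : C)^' --> l -> l != 0 ->
  \forall h \near (0 : C)^', f h != 0.
Proof.
move=> /cvgrPdist_lt /(_ `|l|); rewrite normr_gt0 => + l0 => /(_ l0).
by apply: filterS => h; apply: contraTneq => ->; rewrite subr0 ltxx.
Qed.

(** Subtracting two instances of [trace_formula] and dividing by [h] gives an
    exact expression in the difference quotient of [M], whose terms converge one
    by one. *)
Lemma trace_derive z w L L' : cim z != 0 -> cim w != 0 -> z - w != 0 ->
  L - M z *m S L *m M z = M z *m M z ->
  mcvg ((0 : C)^') (fun h : C => h^-1 *: (M (w + h) - M w)) L' ->
  let S1 := lin_mx (unflat c0 S) in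
  let D := 1%:M - S1 *m smul (M z) (M w) in
  let q := (z - w) + c0%:CC * normtr (M z - M w) in
  D \in unitmx -> q != 0 ->
  is_derive (w : C^o) 1
    (fun u : C^o => \tr (L *m invmx (M z) *m Vmx S (M z) (M u)) : C^o)
    (- ((z - w) ^+ 2)^-1 +
      (\tr (invmx D *m (S1 *m smul (M z) L') *m invmx D *m (S1 *m smul L (M w))) +
       \tr (invmx D *m (S1 *m smul L L')) +
       (1 + c0%:CC * normtr L) * (1 + c0%:CC * normtr L') / q ^+ 2)).
Proof.
move=> zim wim zw hL hL' S1 D q Du q0.
set p := 1 + c0%:CC * normtr L.
pose Mh h := M (w + h); pose Q h := h^-1 *: (Mh h - M w).
pose Dh h := 1%:M - S1 *m smul (M z) (Mh h).
pose zh h := (z - w) - h.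
pose qh h := zh h + c0%:CC * normtr (M z - Mh h).
have cMh : mcvg ((0 : C)^') Mh (M w) := quotient_cont hL'.
have cDh : mcvg ((0 : C)^') Dh D.
  apply: mcvgB; first exact: mcvg_cst.
  by apply: mcvgM; [exact: mcvg_cst | exact: mcvg_smul].
have czh : zh @ (0 : C)^' --> z - w.
  rewrite -[X in _ --> X]subr0; apply: cvgB; [exact: cvg_cst | exact: id_cvg0].
have cqh : qh @ (0 : C)^' --> q.
  apply: cvgD czh _; apply: cvgM; first exact: cvg_cst.
  apply: cvgM; first exact: cvg_cst.
  by apply: mcvg_tr; apply: mcvgB; [exact: mcvg_cst | exact: cMh].
pose F (h : C) := - ((z - w) * zh h)^-1 +
  (\tr (invmx (Dh h) *m (S1 *m smul (M z) (Q h)) *m invmx D *m (S1 *m smul L (Mh h))) +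
   \tr (invmx D *m (S1 *m smul L (Q h))) +
   p * (1 + c0%:CC * normtr (Q h)) / (q * qh h)).
apply: (is_derive_of_cvg (f := fun u => \tr (L *m invmx (M z) *m Vmx S (M z) (M u)))).
apply: (@cvg_trans _ (F @ (0 : C)^')); last first.
  apply: cvgD.
    rewrite expr2; apply: cvgN; apply: cvgV; first by rewrite mulf_neq0.
    by apply: cvgM; [exact: cvg_cst | exact: czh].
  apply: cvgD; first apply: cvgD.
  - apply: mcvg_tr; apply: mcvgM; last first.
      by apply: mcvgM; [exact: mcvg_cst | exact: mcvg_smul].
    apply: mcvgM; last exact: mcvg_cst.
    apply: mcvgM; first exact: mcvg_inv.
    by apply: mcvgM; [exact: mcvg_cst | exact: mcvg_smul].
  - apply: mcvg_tr; apply: mcvgM; first exact: mcvg_cst.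
    by apply: mcvgM; [exact: mcvg_cst | exact: mcvg_smul].
  - apply: cvgM.
      apply: cvgM; first exact: cvg_cst.
      apply: cvgD; first exact: cvg_cst.
      apply: cvgM; first exact: cvg_cst.
      by apply: cvgM; [exact: cvg_cst | exact: mcvg_tr].
    rewrite expr2; apply: cvgV; first by rewrite mulf_neq0.
    by apply: cvgM; [exact: cvg_cst | exact: cqh].
have w1 : (0 : C) < `|cim w|%:CC by rewrite -(rmorph0 (cinj C)) cinj_lt normr_gt0.
apply: near_eq_cvg; near=> h.
have h0 : h != 0 by near: h; exact: nbhs_dnbhs_neq.
have zh0 : zh h != 0 by near: h; exact: near_neq0 czh zw.
have qh0 : qh h != 0 by near: h; exact: near_neq0 cqh q0.
have Dhu : Dh h \in unitmx by near: h; exact: near_unitmx cDh Du.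
have him : cim (w + h) != 0.
  have : cnorm h < `|cim w|.
    by rewrite -cinj_lt cinj_norm; near: h; exact: dnbhs0_lt.
  move=> /(le_lt_trans (cim_le_cnorm h)); rewrite cimD; apply: contraTneq.
  by move=> /eqP; rewrite addrC addr_eq0 => /eqP ->; rewrite normrN ltxx.
have zwh : z - (w + h) = zh h by rewrite opprD addrA.
rewrite (trace_formula hS (hM zim) (hM him) hL); rewrite ?zwh //.
rewrite (trace_formula hS (hM zim) (hM wim) hL) //.
rewrite -/S1 -/D -/q -/p -/(Mh h) -/(Dh h) -/(qh h).
have hQ : Mh h - M w = h *: Q h by rewrite /Q scalerA mulfV // scale1r.
rewrite /F; move: (Q h) hQ => Qh hQ.
have eD : invmx (Dh h) - invmx D = h *: (invmx (Dh h) *m (S1 *m smul (M z) Qh) *m invmx D).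
  have -> : h *: (invmx (Dh h) *m (S1 *m smul (M z) Qh) *m invmx D) =
            invmx (Dh h) *m (D - Dh h) *m invmx D.
    rewrite scalemxAl scalemxAr; congr (_ *m _ *m _).
    rewrite scalemxAr -smulZr -hQ smulBr mulmxBr /D /Dh opprB [RHS]addrC addrA.
    by rewrite subrK addrC.
  by rewrite mulmxBr mulmxBl mulmxK // mulVmx // mul1mx.
have qq : qh h = q - h * (1 + c0%:CC * normtr Qh).
  have e : M z - Mh h = (M z - M w) - h *: Qh by rewrite -hQ opprB addrA subrK.
  by rewrite /qh /q /zh e [normtr (_ - _ - _)]normtrB normtrZ; ring.
have eK : \tr (invmx (Dh h) *m (S1 *m smul L (Mh h))) - \tr (invmx D *m (S1 *m smul L (M w))) =
  h * (\tr (invmx (Dh h) *m (S1 *m smul (M z) Qh) *m invmx D *m (S1 *m smul L (Mh h))) +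
       \tr (invmx D *m (S1 *m smul L Qh))).
  rewrite mulrDr; set Kh := S1 *m smul L (Mh h).
  have -> : h * \tr (invmx D *m (S1 *m smul L Qh)) =
     \tr (invmx D *m Kh) - \tr (invmx D *m (S1 *m smul L (M w))).
    by rewrite -linearB -mulmxBr -mulmxBr -smulBr hQ smulZr -!scalemxAr /= mxtraceZ.
  set Y := invmx (Dh h) *m (S1 *m smul (M z) Qh) *m invmx D in eD *.
  have -> : h * \tr (Y *m Kh) = \tr (invmx (Dh h) *m Kh) - \tr (invmx D *m Kh).
    by rewrite -linearB -mulmxBl eD -scalemxAl /= mxtraceZ.
  by rewrite addrA subrK.
have zz : z - w = zh h + h by rewrite /zh subrK.
move/eqP: eK; rewrite subr_eq => /eqP ->.
have qq' : q = qh h + h * (1 + c0%:CC * normtr Qh) by rewrite qq subrK.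
have fin (x1 x2 T p' k y r e : C) : k != 0 -> y != 0 -> r != 0 -> y + k != 0 ->
    r + k * e != 0 ->
    - ((y + k) * y)^-1 + (x1 + x2 + p' * e / ((r + k * e) * r)) =
    k^-1 * (k * (x1 + x2) + T - y^-1 + p' / r - (T - (y + k)^-1 + p' / (r + k * e))).
  by move=> k0 y0 r0 yk0 re0; field; rewrite k0 y0 r0 yk0 re0.
by rewrite zz qq'; apply: fin; rewrite -?zz -?qq'.
Unshelve. all: by end_near. Qed.

End TraceDerivative.

(** * Covariances of symmetric random matrices *)

Section CovarianceMap.
Variables (R : realType) (C : complexField R) (n : nat).
Implicit Types (X : 'M[C]_n) (g : 'I_n * 'I_n -> 'I_n * 'I_n -> R).

(** The coefficients of a covariance of a random symmetric matrix. *)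
Record symcov g : Prop := SymCov {
  symcovC : forall al be, g al be = g be al;
  symcovT : forall al be, g (swap_ix al) be = g al be;
  symcov_ge0 : forall x : 'I_n * 'I_n -> R,
    0 <= \sum_al \sum_be g al be * x al * x be }.

Definition gmx g : 'M[C]_#|{: 'I_n * 'I_n}| :=
  \matrix_(u, v) (g (enum_val u) (enum_val v))%:CC.

Lemma cre_mulJ (x y : C) : cre (x^* * y) = cre x * cre y + cim x * cim y.
Proof.
have {1}-> : x^* = (cre x)%:CC - 'i * (cim x)%:CC.
  by rewrite {1}[x]crect rmorphD rmorphM /= conjCi !conj_cinj mulNr.
rewrite mulrBl creB creZ; congr (_ + _).
have -> : 'i * (cim x)%:CC * y = (cim x)%:CC * ('i * y) by rewrite mulrAC mulrC.
by rewrite (creZ (cim x)) -mulrN /cim !mulNr !creN.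
Qed.

Lemma psd_gmx g : symcov g -> psd (gmx g).
Proof.
move=> hg; split=> [|v].
  by apply/matrixP => i j; rewrite adjmE !mxE conj_cinj (symcovC hg).
have ge0 (y : 'I_#|{: 'I_n * 'I_n}| -> R) :
    0 <= \sum_u \sum_w g (enum_val u) (enum_val w) * y u * y w.
  have := symcov_ge0 hg (fun al => y (enum_rank al)).
  rewrite (reindex _ (onW_bij _ (enum_val_bij _))) /=; congr (_ <= _).
  apply: eq_bigr => u _; rewrite (reindex _ (onW_bij _ (enum_val_bij _))) /=.
  by apply: eq_bigr => w _; rewrite !enum_valK.
have -> : cre (\tr (adjm v *m gmx g *m v)) =
    \sum_u \sum_w g (enum_val u) (enum_val w) * cre (v u 0) * cre (v w 0) +
    \sum_u \sum_w g (enum_val u) (enum_val w) * cim (v u 0) * cim (v w 0).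
  rewrite trace_mx11 mxE cre_sum exchange_big [X in _ + X]exchange_big.
  rewrite -big_split /=; apply: eq_bigr => w _; rewrite -big_split /=.
  rewrite mxE mulr_suml cre_sum; apply: eq_bigr => u _.
  by rewrite adjmE mxE mulrAC mulrC creZ cre_mulJ mulrDr !mulrA.
by rewrite addr_ge0 ?ge0.
Qed.

(** A symmetric covariance is completely positive; the square root of its
    matrix provides the Kraus operators. *)
Lemma kraus_symcov g : symcov g ->
  kraus (covform (fun al be => (g al be)%:CC : C)).
Proof.
move=> hg; have [G eG] := psd_ex_factor (psd_gmx hg).
have gE al be : (g al be)%:CC =
    \sum_k G (enum_rank al) k * (G (enum_rank be) k)^* :> C.
  have := congr1 (fun Y : 'M[C]__ => Y (enum_rank al) (enum_rank be)) eG.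
  rewrite !mxE !enum_rankK => ->; apply: eq_bigr => k _.
  by rewrite adjmE.
pose K k : 'M[C]_n := \matrix_(i, a) G (enum_rank (i, a)) k.
have entry (P Q X : 'M[C]_n) i j :
    (P *m X *m Q) i j = \sum_a \sum_b X a b * (P i a * Q b j).
  rewrite mxE exchange_big /=; apply: eq_bigr => b _; rewrite mxE mulr_suml.
  by apply: eq_bigr => a _; ring.
exists 'I_#|{: 'I_n * 'I_n}|, K; split=> X; apply/matrixP => i j;
  rewrite mxE summxE; under [RHS]eq_bigr do rewrite entry.
- rewrite [RHS]exchange_big /=; apply: eq_bigr => a _.
  rewrite [RHS]exchange_big /=; apply: eq_bigr => b _; rewrite -mulr_sumr mulrC.
  rewrite (symcovC hg) -(symcovT hg) (symcovC hg) gE; congr (_ * _).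
  by apply: eq_bigr => k _; rewrite adjmE !mxE.
- rewrite [RHS]exchange_big /=; apply: eq_bigr => a _.
  rewrite [RHS]exchange_big /=; apply: eq_bigr => b _; rewrite -mulr_sumr mulrC.
  rewrite -(symcovT hg) (symcovC hg) gE; congr (_ * _).
  by apply: eq_bigr => k _; rewrite adjmE !mxE mulrC.
Qed.

Section Split.
Variables (g : 'I_n * 'I_n -> 'I_n * 'I_n -> R) (cf : R).
Hypothesis hg : symcov g.
Hypothesis full : forall x : 'I_n * 'I_n -> R,
  (forall al, x (swap_ix al) = x al) ->
  cf / n%:R * \sum_al x al ^+ 2 <= \sum_al \sum_be g al be * x al * x be.

Let c := cf / 2 / n%:R.

(** The covariance of the Gaussian orthogonal ensemble. *)
Definition goecov (al be : 'I_n * 'I_n) : R :=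
  (al == be)%:R + (al == swap_ix be)%:R.

Definition redcov al be : R := g al be - c * goecov al be.

Lemma sum_delta_l (al : 'I_n * 'I_n) (F : 'I_n * 'I_n -> R) :
  \sum_be (al == be)%:R * F be = F al.
Proof.
rewrite (bigD1 al) //= eqxx mul1r big1 ?addr0 // => be /negPf h.
by rewrite eq_sym h mul0r.
Qed.

Lemma eq_swap (al be : 'I_n * 'I_n) : (swap_ix al == be) = (al == swap_ix be).
Proof. by rewrite (can2_eq (@swap_ixK _) (@swap_ixK _)). Qed.

Lemma goecov_qf (x : 'I_n * 'I_n -> R) :
  \sum_al \sum_be goecov al be * x al * x be =
  \sum_al x al ^+ 2 + \sum_al x al * x (swap_ix al).
Proof.
rewrite -big_split /=; apply: eq_bigr => al _.
under eq_bigr => be _ do rewrite -mulrA mulrDl -eq_swap.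
by rewrite big_split /= !sum_delta_l expr2.
Qed.

(** A lower bound on the quadratic form on symmetric vectors suffices, since the
    form does not change under symmetrization of its argument. *)
Lemma symcov_redcov : symcov redcov.
Proof.
split=> [al be|al be|x].
- by rewrite /redcov (symcovC hg) /goecov (eq_sym al) -eq_swap (eq_sym _ be).
- rewrite /redcov (symcovT hg) /goecov eq_swap (inj_eq (can_inj (@swap_ixK _))).
  by rewrite (addrC (al == be)%:R).
pose y al := (x al + x (swap_ix al)) / 2.
have ysym al : y (swap_ix al) = y al by rewrite /y swap_ixK addrC.
have := full ysym.
have -> : \sum_al y al ^+ 2 =
    (\sum_al x al ^+ 2 + \sum_al x al * x (swap_ix al)) / 2.
  have -> : \sum_al x al ^+ 2 =
      (\sum_al x al ^+ 2 + \sum_al x (swap_ix al) ^+ 2) / 2.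
    by rewrite (reindex_swap (fun al => x al ^+ 2)); lra.
  rewrite mulrDl -!big_split /= !mulr_suml -big_split /=.
  by apply: eq_bigr => al _; rewrite /y; field.
have -> : \sum_al \sum_be g al be * y al * y be =
    \sum_al \sum_be g al be * x al * x be.
  pose q (u v : 'I_n * 'I_n -> R) := \sum_al \sum_be g al be * u al * v be.
  have e1 u v : q (u \o swap_ix) v = q u v.
    rewrite /q -[RHS]reindex_swap; apply: eq_bigr => al _; apply: eq_bigr => be _.
    by rewrite (symcovT hg).
  have qC u v : q u v = q v u.
    rewrite /q exchange_big /=; apply: eq_bigr => al _; apply: eq_bigr => be _.
    by rewrite (symcovC hg) mulrAC.
  have e2 u v : q u (v \o swap_ix) = q u v by rewrite qC e1 qC.
  have -> : \sum_al \sum_be g al be * y al * y be =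
      (q x x + q (x \o swap_ix) x + q x (x \o swap_ix)
       + q (x \o swap_ix) (x \o swap_ix)) / 4.
    rewrite /q -!big_split /= mulr_suml; apply: eq_bigr => al _.
    rewrite -!big_split /= mulr_suml; apply: eq_bigr => be _.
    by rewrite /y /=; field.
  by rewrite !(e1, e2); rewrite -/(q x x); lra.
have -> : \sum_al \sum_be redcov al be * x al * x be =
    \sum_al \sum_be g al be * x al * x be -
    c * \sum_al \sum_be goecov al be * x al * x be.
  rewrite mulr_sumr -sumrB; apply: eq_bigr => al _.
  rewrite mulr_sumr -sumrB; apply: eq_bigr => be _.
  by rewrite /redcov; ring.
rewrite goecov_qf /c => h; rewrite subr_ge0; apply: le_trans h.
by le_eq; ring.
Qed.

Lemma self_energy_symcov (C2 : R) :
  covbound (fun al be => (g al be)%:CC : C) (C2 / n%:R) ->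
  self_energy (cf / 2) C2 (covform (fun al be => (g al be)%:CC : C)).
Proof.
move=> bd; split; first exact: kraus_symcov; last first.
  by exists (fun al be => (g al be)%:CC : C); split=> // al be; rewrite (symcovC hg).
exists (covform (fun al be => (redcov al be)%:CC : C)); split.
  exact/kraus_symcov/symcov_redcov.
move=> X; apply/matrixP => i j; rewrite !mxE.
have -> : (cf / 2 / n%:R)%:CC = c%:CC :> C by [].
have -> : ((cf / 2)%:CC * normtr X) *+ (i == j) =
          \sum_a \sum_b (c * ((i, a) == (j, b))%:R)%:CC * X a b.
  rewrite /normtr /mxtrace /c !rmorphM fmorphV rmorph_nat !mulr_sumr -sumrMnl.
  apply: eq_bigr => a _; rewrite (bigD1 a) //= big1 ?addr0 => [|b /negPf ba].
    rewrite rmorphM /= !rmorphM !fmorphV !rmorph_nat /= xpair_eqE eqxx andbT.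
    by case: (i == j); rewrite ?mulr1n ?mulr0n /=; ring.
  by rewrite xpair_eqE eq_sym (eq_sym a) ba andbF mulr0 rmorph0 mul0r.
have -> : c%:CC * X j i =
          \sum_a \sum_b (c * ((i, a) == (b, j))%:R)%:CC * X a b.
  rewrite (bigD1 j) //= (bigD1 i) //= eqxx mulr1 !big1 ?addr0 // => [a /negPf aj|b /negPf bi].
    by rewrite big1 // => b _; rewrite xpair_eqE aj andbF mulr0 rmorph0 mul0r.
  by rewrite xpair_eqE eq_sym bi mulr0 rmorph0 mul0r.
rewrite -!big_split /=; apply: eq_bigr => a _; rewrite -!big_split /=.
apply: eq_bigr => b _; rewrite -!mulrDl -!rmorphD; congr (_%:CC * _).
by rewrite /redcov /goecov /swap_ix /=; ring.
Qed.

End Split.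

End CovarianceMap.

(** * The complex numbers as a complex field *)

Section Concrete.
Variable R : realType.

Lemma real_complex_Re (x : R[i]) : real_complex R (complex.Re x) = 'Re x.
Proof. by rewrite complexRe. Qed.

Definition complexR : complexField R :=
  @ComplexField R (R[i]) (@complex.Re R) (real_complex R : {rmorphism R -> R[i]})
    (fun x => erefl x) real_complex_Re.

Lemma cimEc (x : complexR) : cim x = complex.Im x.
Proof. by case: x => a b; rewrite /cim /= /Num.imaginary /=; simpc. Qed.

Lemma cabsE (x : R[i]) : cabs x = cnorm (x : complexR).
Proof. by []. Qed.

Lemma immxE n (X : 'M[R[i]]_n) : immx X = imm (X : 'M[complexR]_n).
Proof. by []. Qed.

End Concrete.

(** * Moments of the entries *)

Section Moments.
Context (R : realType) (d : measure_display) (Omega : measurableType d).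
Variable P : probability Omega R.
Implicit Types f : Omega -> R.

Definition integr f := P.-integrable setT (EFin \o f).

Definition mean f : R := fine ('E_P[f])%E.

Lemma mean_fin f : integr f -> ('E_P[f])%E = (mean f)%:E.
Proof. by move=> /Lfun1_integrable/expectation_fin_num/fineK. Qed.

Lemma mean_comb I (r : seq I) (c : I -> R) (F : I -> Omega -> R) :
  (forall i, integr (F i)) ->
  integr (fun t => \sum_(i <- r) c i * F i t) /\
  mean (fun t => \sum_(i <- r) c i * F i t) = \sum_(i <- r) c i * mean (F i).
Proof.
move=> hF; elim: r => [|i r [IH1 IH2]].
  under eq_fun do rewrite big_nil.
  rewrite big_nil; split; last by rewrite /mean (expectation_cst P (0 : R)).
  exact: finite_measure_integrable_cst.
under eq_fun do rewrite big_cons.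
have hi : integr (fun t => c i * F i t).
  by have := integrableZl measurableT (c i) (hF i).
split; first by have := integrableD measurableT hi IH1.
rewrite big_cons -IH2 /mean.
rewrite (_ : (fun t => _) = (fun t => c i * F i t) \+ (fun t => \sum_(j <- r) c j * F j t))//.
rewrite expectationD; [|exact/Lfun1_integrable|exact/Lfun1_integrable].
rewrite fineD; [|exact/expectation_fin_num/Lfun1_integrable..].
congr (_ + _).
rewrite (_ : (fun t => c i * F i t) = c i \o* F i); last by apply/funext => t /=; rewrite mulrC.
rewrite expectationZl; last exact/Lfun1_integrable/hF.
by rewrite (mean_fin (hF i)) -EFinM.
Qed.

Lemma mean_combl f (c : R) : integr f -> mean (fun t => c * f t) = c * mean f.
Proof.
move=> hf; have [_] := mean_comb [:: tt] (fun=> c) (fun (_ : unit) => hf).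
by rewrite big_seq1 => <-; congr mean; apply/funext => t; rewrite big_seq1.
Qed.

Lemma integr_prod (f g : Omega -> R) :
  measurable_fun setT f -> measurable_fun setT g ->
  integr (fun t => f t ^+ 2) -> integr (fun t => g t ^+ 2) ->
  integr (fun t => f t * g t).
Proof.
move=> mf mg hf hg.
have hs := integrableD measurableT hf hg.
apply: (le_integrable measurableT _ _ hs) => [|t _ /=].
  apply/measurable_EFinP; exact: measurable_funM.
rewrite lee_fin [leRHS]ger0_norm; last by rewrite addr_ge0 ?sqr_ge0.
by rewrite ler_norml; apply/andP; split;
  have := sqr_ge0 (f t + g t); have := sqr_ge0 (f t - g t); nra.
Qed.

End Moments.

Section Partitions.

(** A block of a partition of two points is either everything or a singleton. *)
Lemma partition_I2 (p : {set {set 'I_2}}) :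
  finset.partition p [set: 'I_2]%SET -> p != [set [set: 'I_2]%SET]%SET ->
  exists i : 'I_2, [set i]%SET \in p.
Proof.
move=> /and3P[/eqP cp _ p0] pn.
have [B Bp BT] : exists2 B, B \in p & B != [set: 'I_2]%SET.
  apply/exists_inP; rewrite -negb_forall_in; apply: contraNN pn => /forall_inP h.
  rewrite finset.eqEsubset; apply/andP; split; apply/fintype.subsetP => B.
    by move=> /h; rewrite inE.
  rewrite inE => /eqP ->.
  have : (ord0 : 'I_2) \in finset.cover p by rewrite cp inE.
  by move=> /finset.bigcupP[D Dp _]; rewrite -(eqP (h _ Dp)).
have [i iB] : exists i, i \in B.
  by apply/set0Pn; apply: contraNneq p0 => <-.
exists i; suff -> : [set i]%SET = B by [].
apply/eqP; rewrite finset.eqEcard finset.sub1set iB cards1 /=.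
have : (#|B| < 2)%N.
  by rewrite -[X in (_ < X)%N](card_ord 2) -cardsT proper_card // finset.properT.
by rewrite ltnS.
Qed.

End Partitions.

(** * The covariance map of the model *)

Section OperatorNorm.
Variable R : realType.

Lemma l2normE N (v : 'cV[R[i]]_N) : l2norm v = Num.sqrt (fn2 (v : 'M[complexR R]_(N, 1))).
Proof.
by rewrite fn2E /l2norm; congr Num.sqrt; apply: eq_bigr => i _; rewrite big_ord1.
Qed.

(** The supremum is over a bounded set because the Frobenius norm bounds the
    operator norm. *)
Lemma opnorm_fn2 N (X : 'M[complexR R]_N) (c : R) (v : 'cV[complexR R]_N) :
  opnorm X <= c -> fn2 (X *m v) <= c ^+ 2 * fn2 v.
Proof.
move=> Xc.
pose S := [set l2norm (X *m v) | v in [set v | l2norm (v : 'cV[complexR R]_N) <= 1]].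
have S0 : S 0 by exists 0 => /=; rewrite ?mulmx0 l2normE fn2_0 sqrtr0 ?ler01.
have Sb : has_sup S.
  split; first by exists 0.
  exists (Num.sqrt (fn2 X)) => _ [u /= u1 <-].
  have u1' : fn2 (u : 'M[complexR R]_(N, 1)) <= 1.
    move: u1; rewrite l2normE => u1.
    by rewrite -(sqr_sqrtr (fn2_ge0 u)) expr_le1 ?sqrtr_ge0.
  rewrite l2normE; apply: ler_wsqrtr.
  apply: (le_trans (fn2M_le X u)); exact: (ler_piMr (fn2_ge0 X) u1').
have c0 : 0 <= c by apply: le_trans Xc; apply: ub_le_sup; [exact: Sb.2|].
have [->|vn] := eqVneq v 0; first by rewrite mulmx0 !fn2_0 mulr0.
have v0 : 0 < fn2 v.
  by rewrite lt_def fn2_ge0 andbT; apply: contraNneq vn => /fn2_eq0 ->.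
pose t := (Num.sqrt (fn2 v))^-1.
have t2 : t ^+ 2 = (fn2 v)^-1 by rewrite exprVn sqr_sqrtr // ltW.
have e m (Y : 'M[complexR R]_(m, 1)) : fn2 ((cinj (complexR R) t) *: Y) = (fn2 v)^-1 * fn2 Y.
  by rewrite fn2Z cnorm_real real_normK ?num_real // t2.
have : l2norm (X *m ((cinj (complexR R) t) *: v)) <= c.
  apply: le_trans Xc; apply: ub_le_sup; first exact: Sb.2.
  by exists ((cinj (complexR R) t) *: v) => //=; rewrite l2normE e mulVf ?gt_eqF // sqrtr1.
rewrite l2normE -scalemxAr e -[X in _ <= X](ger0_norm c0) -sqrtr_sqr ler_sqrt ?sqr_ge0 //.
by rewrite mulrC ler_pdivrMr.
Qed.

End OperatorNorm.

Section ModelCovariance.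
Context (R : realType) (p : model_params R) (N : nat).
Context (d : measure_display) (Omega : measurableType d).
Variables (P : probability Omega R) (A : 'M[R]_N) (W : pair_ix N -> {RV P >-> R}).
Hypothesis N_gt0 : (0 < N)%N.
Hypothesis hmodel : model A W p.
Let C := complexR R.

Definition wcov (al be : pair_ix N) : R := mean P (fun t => W al t * W be t).

Let NR_gt0 : 0 < N%:R :> R. Proof. by rewrite ltr0n. Qed.

Lemma measurable_W al : measurable_fun setT (W al).
Proof. exact: measurable_funPT. Qed.

Lemma integr_sqrW al : integr P (fun t => W al t ^+ 2).
Proof.
have mW2 : measurable_fun setT (EFin \o (fun t => W al t ^+ 2)).
  by apply/measurable_EFinP; apply: measurable_funX; exact: measurable_W.
have h : integr P (fun t => N%:R * W al t ^+ 2).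
  apply/integrableP; split.
    by apply/measurable_EFinP; apply: measurable_funM => //; exact/measurable_EFinP.
  apply: le_lt_trans (ltry (nu p 2)); apply: le_trans (A2 hmodel (leqnn 2) al).
  rewrite unlock; le_eq; apply: eq_integral => t _ /=.
  by rewrite [in RHS]normrM exprMn (ger0_norm (sqrtr_ge0 _)) sqr_sqrtr ?ler0n //
     normrM normrX (ger0_norm (ler0n _ _)).
have := integrableZl measurableT (N%:R^-1) h.
by apply: eq_integrable => // t _ /=; rewrite -EFinM mulrA mulVf ?mul1r // gt_eqF.
Qed.

Lemma integr_WW al be : integr P (fun t => W al t * W be t).
Proof.
by apply: integr_prod; [exact: measurable_W..|exact: integr_sqrW|exact: integr_sqrW].
Qed.

(** Products of at most two centred variables have only one nonzero term in
    the moment-cumulant formula. *)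
Lemma kappa2E al be : kappa W [:: al; be] = N%:R * wcov al be.
Proof.
rewrite /kappa /joint_cumulant /=.
have pT : finset.partition [set [set: 'I_2]%SET]%SET [set: 'I_2]%SET.
  apply/and3P; split.
  - by rewrite /finset.cover finset.big_set1.
  - by apply/finset.trivIsetP => B D; rewrite !inE => /eqP -> /eqP ->; rewrite eqxx.
  - by rewrite inE; apply/eqP => /finset.setP /(_ ord0); rewrite !inE.
rewrite (bigD1 [set [set: 'I_2]%SET]%SET) //= cards1 expr0 mul1r /= fact0 mul1r.
rewrite finset.big_set1 [X in _ + X]big1 ?addr0 => [|q /andP[qp qn]].
  rewrite -mean_combl; last exact: integr_WW.
  rewrite /mean; congr fine; congr ('E_P[_])%E; apply/funext => t.
  rewrite (eq_bigl xpredT) => [|i]; last by rewrite inE.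
  rewrite big_ord_recl big_ord1 !(tnth_nth al) /=.
  rewrite mulrACA -expr2 sqr_sqrtr ?ler0n //.
have [i iq] := partition_I2 qp qn.
rewrite (bigD1 [set i]%SET) //=.
set e := fine _; suff -> : e = 0 by rewrite mul0r mulr0.
rewrite /e; under [X in expectation _ X]eq_fun do rewrite finset.big_set1.
set b := tnth _ i.
have := @mean_combl _ _ _ P (W b) (Num.sqrt N%:R).
rewrite /mean (W_centered hmodel) mulr0; apply.
apply: (le_integrable measurableT _ _ (integrableD measurableT (finite_measure_integrable_cst P 1 measurableT) (integr_sqrW b))).
  by apply/measurable_EFinP; exact: measurable_W.
move=> t _ /=; rewrite lee_fin [leRHS]ger0_norm ?addr_ge0 ?sqr_ge0 //.
by rewrite ler_norml; apply/andP; split; nra.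
Qed.

Lemma wcovC al be : wcov al be = wcov be al.
Proof. by congr mean; apply/funext => t; rewrite mulrC. Qed.

Lemma wcov_qf (x : pair_ix N -> R) :
  integr P (fun t => (\sum_al x al * W al t) ^+ 2) /\
  mean P (fun t => (\sum_al x al * W al t) ^+ 2) =
  \sum_al \sum_be wcov al be * x al * x be.
Proof.
have [h1 h2] := @mean_comb _ _ _ P _ (index_enum _) (fun ab : pair_ix N * pair_ix N => x ab.1 * x ab.2)
  _ (fun ab => integr_WW ab.1 ab.2).
have e : (fun t => (\sum_al x al * W al t) ^+ 2) =
   (fun t => \sum_ab x ab.1 * x ab.2 * (W ab.1 t * W ab.2 t)).
  apply/funext => t; rewrite expr2 big_distrlr /= pair_bigA /=.
  by apply: eq_bigr => ab _; rewrite mulrACA.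
rewrite e; split=> //; rewrite h2 pair_bigA /=; apply: eq_bigr => ab _.
by rewrite -[RHS]mulrA mulrC.
Qed.

Lemma symcov_wcov : symcov wcov.
Proof.
split=> [|[a b] be|x]; first exact: wcovC.
  by congr mean; apply/funext => t; rewrite (W_sym hmodel).
rewrite -(wcov_qf x).2 /mean fine_ge0 //; apply: expectation_ge0 => t.
exact: sqr_ge0.
Qed.

Lemma wcov_full (x : pair_ix N -> R) : (forall al, x (swap_ix al) = x al) ->
  c_full p / N%:R * \sum_al x al ^+ 2 <= \sum_al \sum_be wcov al be * x al * x be.
Proof.
move=> xs; pose X : 'M[R]_N := \matrix_(i, j) x (i, j).
have sX : X^T = X by apply/matrixP => i j; rewrite !mxE -(xs (j, i)).
have := A4 hmodel sX.
have -> : \tr (X *m X) = \sum_al x al ^+ 2.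
  rewrite sum_pairE; apply: eq_bigr => i _.
  rewrite mxE; apply: eq_bigr => j _; rewrite !mxE expr2; congr (_ * _).
  by rewrite -(xs (j, i)).
have -> : (fun t => `|\tr (Wmx W t *m X)| ^+ 2) =
          (fun t => (\sum_al x al * W al t) ^+ 2).
  apply/funext => t; rewrite real_normK ?num_real //; congr (_ ^+ 2).
  rewrite sum_pairE; apply: eq_bigr => i _.
  rewrite mxE; apply: eq_bigr => j _; rewrite !mxE mulrC; congr (_ * _).
  by rewrite -(xs (j, i)).
have [h1 h2] := wcov_qf x.
rewrite (mean_fin h1) h2 -EFinM lee_fin => h.
by rewrite mulrAC ler_pdivrMr // [leRHS]mulrC.
Qed.

Lemma sum_enum_val (T : finType) (F : T -> R) :
  \sum_al F al = \sum_(u < #|T|) F (enum_val u).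
Proof. by rewrite (reindex _ (onW_bij _ (@enum_val_bij T))). Qed.

(** For two indices the matrix in the cumulant bound has the entries
    [N |E (W_al W_be)|], and the bound on the absolute values gives the one on the
    covariances. *)
Lemma wcov_bound :
  covbound (fun al be => cinj C (wcov al be)) (C_kappa p 2 / N%:R).
Proof.
move=> x.
have gE al be : wcov al be = N%:R^-1 * kappa W [:: al; be].
  by rewrite kappa2E mulrA mulVf ?mul1r // gt_eqF.
pose v : 'cV[C]_#|pair_ix N| := \col_u cinj C (cnorm (x (enum_val u))).
have kE u w : (cmx (kappa_abs_mx W 2) : 'M[C]__) u w =
    cinj C `|kappa W [:: enum_val u; enum_val w]|.
  rewrite !mxE (big_pred1 [tuple]) // => t; apply/esym/eqP.
  exact: tuple0.
have := opnorm_fn2 v (A3i hmodel (leqnn 2)).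
rewrite !fn2E.
have -> : \sum_i \sum_j cnorm (v i j) ^+ 2 = \sum_al cnorm (x al) ^+ 2.
  rewrite [RHS]sum_enum_val; apply: eq_bigr => u _; rewrite big_ord1 mxE cnorm_real.
  by rewrite ger0_norm ?cnorm_ge0.
move=> h; rewrite exprMn mulrAC -[leRHS]mulrC.
apply: le_trans (ler_wpM2l _ h); last exact: sqr_ge0.
rewrite sum_enum_val mulr_sumr; apply: ler_sum => w _; rewrite big_ord1 mxE -exprMn.
rewrite ler_sqr ?nnegrE ?mulr_ge0 ?invr_ge0 ?ler0n ?cnorm_ge0 //.
apply: (le_trans (cnorm_sum _ _ _)).
under [X in cnorm X]eq_bigr do rewrite kE mxE -rmorphM.
rewrite -rmorph_sum cnorm_real sum_enum_val ger0_norm; last first.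
  by apply: sumr_ge0 => u _; rewrite mulr_ge0 ?normr_ge0 ?cnorm_ge0.
rewrite mulr_sumr; apply: ler_sum => u _.
rewrite cnormM cnorm_real wcovC gE normrM ger0_norm ?invr_ge0 ?ler0n //.
by rewrite mulrA.
Qed.

Lemma covSE (X : 'M[C]_N) :
  (covS W X : 'M[C]_N) = covform (fun al be => cinj C (wcov al be)) X.
Proof.
apply/matrixP => i j; rewrite !mxE /cexpect.
have part (part : R[i] -> R) : (forall r (x : R[i]), part (r%:C * x) = r * part x) ->
    {morph part : x y / x + y} -> part 0 = 0 ->
    fine ('E_P[fun t => part ((cmx (Wmx W t) *m X *m cmx (Wmx W t)) i j)])%E =
    part (\sum_a \sum_b cinj C (wcov (i, a) (b, j)) * X a b).
  move=> partZ partD part0.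
  have [_ h] := @mean_comb _ _ _ P _ (index_enum _)
    (fun ab : pair_ix N => part (X ab.1 ab.2)) _
    (fun ab => integr_WW (i, ab.1) (ab.2, j)).
  have -> : (fun t => part ((cmx (Wmx W t) *m X *m cmx (Wmx W t)) i j)) =
      (fun t => \sum_ab part (X ab.1 ab.2) * (W (i, ab.1) t * W (ab.2, j) t)).
    apply/funext => t; rewrite mxE.
    rewrite sum_pairE /=.
    rewrite exchange_big (big_morph part partD part0); apply: eq_bigr => b _.
    rewrite mxE mulr_suml (big_morph part partD part0); apply: eq_bigr => a _.
    by rewrite !mxE mulrAC -rmorphM partZ mulrC.
  rewrite /mean in h; rewrite h (big_morph part partD part0).
  rewrite sum_pairE /=.
  apply: eq_bigr => a _; rewrite (big_morph part partD part0).
  by apply: eq_bigr => b _; rewrite partZ mulrC.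
rewrite !part //; last 4 first.
- by move=> r [x y]; rewrite /=; ring.
- by move=> [x y] [x' y'].
- by move=> r [x y]; rewrite /=; ring.
- by move=> [x y] [x' y'].
by case: (\sum_a _).
Qed.

Lemma self_energy_covS :
  self_energy (c_full p / 2) (C_kappa p 2) (covS W : 'M[C]_N -> 'M[C]_N).
Proof.
rewrite (funext covSE).
exact: (self_energy_symcov symcov_wcov wcov_full wcov_bound).
Qed.

Lemma opb_A : opb (C_A p ^+ 2) (cmx A : 'M[C]_N).
Proof.
move=> q V.
have colE (Y : 'M[C]_(N, q)) : fn2 Y = \sum_j fn2 (col j Y).
  rewrite fn2E exchange_big; apply: eq_bigr => j _; rewrite fn2E.
  by apply: eq_bigr => i _; rewrite big_ord1 !mxE.
rewrite !colE mulr_sumr; apply: ler_sum => j _.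
have -> : col j ((cmx A : 'M[C]_N) *m V) = (cmx A : 'M[C]_N) *m col j V.
  by apply/matrixP => i k; rewrite !mxE; apply: eq_bigr => l _; rewrite !mxE.
exact: (opnorm_fn2 _ (A1 hmodel)).
Qed.

Lemma adjm_A : adjm (cmx A : 'M[C]_N) = cmx A.
Proof.
apply/matrixP => i j; rewrite adjmE !mxE -(conj_cinj C (A i j)); congr (_^* )%R.
by rewrite -[in LHS](A_sym hmodel) mxE.
Qed.

End ModelCovariance.

(** * Solutions for the model *)

Lemma qfZ (R : realType) (C : complexField R) n m (a : R) (X : 'M[C]_n) (v : 'M[C]_(n, m)) :
  cre (\tr (adjm v *m (a%:CC *: X) *m v)) = a * cre (\tr (adjm v *m X *m v)).
Proof. by rewrite -scalemxAr -scalemxAl mxtraceZ creZ. Qed.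

Lemma imm_adj (R : realType) (C : complexField R) n (M : 'M[C]_n) : imm (adjm M) = - imm M.
Proof. by rewrite /imm adjmK -scalerN opprB. Qed.

Lemma habs_adj (R : realType) (C : complexField R) n (z : C) (M : 'M[C]_n) :
  habs (z^* ) (adjm M) = habs z M.
Proof. by rewrite /habs cim_conj sgrN rmorphN imm_adj scaleNr scalerN opprK. Qed.

Lemma cim_imm_adj (R : realType) (C : complexField R) n (z : C) (M : 'M[C]_n) :
  (cim (z^* ))%:CC *: imm (adjm M) = (cim z)%:CC *: imm M.
Proof. by rewrite cim_conj rmorphN imm_adj scaleNr scalerN opprK. Qed.

Lemma mde_eq_adj (R : realType) (C : complexField R) n (c0 C2 : R) S (A M : 'M[C]_n) z :
  self_energy c0 C2 S -> adjm A = A -> - invmx M = z%:M - A + S M ->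
  - invmx (adjm M) = (z^* )%:M - A + S (adjm M).
Proof.
move=> hS hA e; have := congr1 (@adjm R C n n) e.
by rewrite adjmN adjm_inv adjmD adjmB adjm_scalar hA -(se_adj hS).
Qed.

Section Solutions.
Context (R : realType) (p : model_params R) (N : nat).
Context (d : measure_display) (Omega : measurableType d).
Variables (P : probability Omega R) (A : 'M[R]_N) (W : pair_ix N -> {RV P >-> R}).
Hypothesis N_gt0 : (0 < N)%N.
Hypothesis hmodel : model A W p.
Let C := complexR R.
Let S : 'M[C]_N -> 'M[C]_N := covS W.
Let hS : self_energy (c_full p / 2) (C_kappa p 2) S := self_energy_covS N_gt0 hmodel.

Lemma vertE x s t : vert C x s t = Complex x (s * t).
Proof.
by rewrite [RHS](crect (Complex x (s * t) : C)) cimEc.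
Qed.

Lemma conj_vert x t : vert C x (-1) t = (vert C x 1 t)^*.
Proof. by rewrite !vertE mulN1r mul1r. Qed.

Lemma mdesol_of_mde z M : mde_solution A W z M -> mdesol S (cmx A) (z : C) (M : 'M[C]_N).
Proof.
case=> Mu Meq Mpos; split=> // v v0.
have := Mpos v v0; rewrite immxE /habs -cimEc.
have -> : (adjmx v *m ((cim (z : C))%:C *: imm (M : 'M[C]_N)) *m v) 0 0 =
   cinj C (cim (z : C)) * \tr (adjm v *m imm (M : 'M[C]_N) *m v).
  by rewrite -scalemxAr -scalemxAl mxE trace_mx11.
rewrite qfZ => h.
have {h} : 0 < cim (z : C) * cre (\tr (adjm v *m imm (M : 'M[C]_N) *m v)).
  rewrite -creZ -(@cinj_lt _ C) rmorph0 cre_real //; exact: gtr0_real.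
move: (cre _) => q; case: (sgrP (cim (z : C))) => [->|z0|z0]; rewrite ?mul0r ?ltxx //.
  by rewrite mul1r pmulr_rgt0.
by rewrite mulN1r nmulr_rgt0 // oppr_gt0.
Qed.

Lemma mde_conj (z : C) (M : 'M[C]_N) : mde_solution A W z M ->
  mde_solution A W (z^* ) (adjm M).
Proof.
case=> Mu Meq Mpos; split; first exact: (etrans (adjm_unit M) Mu).
  exact: (mde_eq_adj hS (adjm_A hmodel) Meq).
move=> v v0; have -> : (complex.Im (z^* ))%:C *: immx (adjm M) = (complex.Im z)%:C *: immx M.
  rewrite -(cimEc (z^* )) -(cimEc z) (immxE (adjm M)) (immxE M).
  exact: (cim_imm_adj z M).
exact: Mpos.
Qed.

Variable M : R[i] -> 'M[R[i]]_N.
Hypothesis hM : is_mde_M A W M.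

Lemma mdesol_M (z : C) : cim z != 0 -> mdesol S (cmx A) z (M z).
Proof. by rewrite cimEc => /hM[+ _] => /mdesol_of_mde. Qed.

(** Uniqueness gives the reflection principle. *)
Lemma M_conj (z : C) : cim z != 0 -> M (z^* ) = adjm (M z : 'M[C]_N).
Proof.
move=> z0; have /hM[_ uq] : complex.Im (z^* : C) != 0.
  by rewrite -cimEc cim_conj oppr_eq0.
apply: uq; apply: mde_conj; apply: (hM _).1; by rewrite -cimEc.
Qed.

Lemma habs_conj (z : C) : cim z != 0 -> habs (z^* ) (M (z^* ) : 'M[C]_N) = habs z (M z).
Proof.
move=> z0; rewrite (M_conj z0).
exact: (habs_adj z (M z)).
Qed.

(** Without a limit, [lim] takes the default value [0], which is not above
    [r]. *)
Lemma density_frequently (E r : R) : 0 < r -> r < rho M E ->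
  forall t1, 0 < t1 -> exists t, 0 < t < t1 /\
    pi * r <= cre (normtr (habs (vert C E 1 t) (M (vert C E 1 t) : 'M[C]_N))).
Proof.
move=> r0 hr t1 t10; apply: contrapT => /forallNP hn.
have small : \forall eta \near 0^'+,
    pi^-1 * complex.Re (ntr (immx (M (Complex E eta)))) <= r.
  near=> eta.
  have e0 : 0 < eta by [].
  have e1 : eta < t1 by near: eta; exact: nbhs_right_lt.
  have /not_andP[|/negP] := hn eta; first by rewrite e0 e1.
  rewrite -ltNge vertE mul1r /habs cimEc /= gtr0_sg // rmorph1 scale1r => /ltW h.
  by rewrite ler_pdivrMl ?pi_gt0.
move: hr; rewrite /rho ltNge => /negP; apply.
have [cv|dv] := pselect (cvg (pi^-1 * complex.Re (ntr (immx (M (Complex E eta)))) @[eta --> 0^'+])).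
  exact: limr_le.
by rewrite dvgP //; apply: ltW.
Unshelve. all: by end_near. Qed.

End Solutions.

(** * The derivative for the model *)

Section Bulk.
Variables (R : realType) (p : model_params R) (eps0 : R).
Hypothesis eps0_gt0 : 0 < eps0.
Let C := complexR R.
Let c0 := c_full p / 2.
Let C2 := C_kappa p 2.

Let c0_gt0 : 0 < c0. Proof. by rewrite divr_gt0 ?c_full_gt0. Qed.
Let C2_gt0 : 0 < C2. Proof. exact: C_kappa_gt0. Qed.

(** The density [rho] controls the solution only in the limit of small heights;
    [density_continuation] brings this to every height below a constant, and the
    reflection principle to both half-planes. *)
Lemma bulk_vert : exists B t0 : R, 1 <= B /\ 0 < t0 /\ exists n0 : nat,
  forall N : nat, (n0 < N)%N ->
  forall (d : measure_display) (Omega : measurableType d)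
    (P : probability Omega R) (A : 'M[R]_N) (W : pair_ix N -> {RV P >-> R})
    (M : R[i] -> 'M[R[i]]_N),
  model A W p -> is_mde_M A W M ->
  forall x s t, eps0 / 2 <= rho M x -> s = 1 \/ s = -1 -> 0 < t < t0 ->
  bulk (covS W : 'M[C]_N -> 'M[C]_N) (cmx A) B (vert C x s t) (M (vert C x s t)).
Proof.
pose thr := pi * (eps0 / 8); have thr0 : 0 < thr by rewrite mulr_gt0 ?pi_gt0 ?divr_gt0.
have [B [B1 hB]] := bulk_exists C (C_A p) c0_gt0 C2_gt0 thr0.
have [t0 [t00 [n0 cont]]] := density_continuation C (C_A p) c0_gt0 C2_gt0 thr0.
exists B, (Num.min t0 1); split=> //; split; first by rewrite lt_min t00 ltr01.
exists n0 => N Nn d Omega P A W M hmodel hM x s t hx hs /andP[tpos].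
rewrite lt_min => /andP[tt0 t1].
have N_gt0 : (0 < N)%N by apply: leq_ltn_trans Nn.
have hS := self_energy_covS N_gt0 hmodel.
have hsol := mdesol_M hM.
have s1 : `|s| = 1 by case: hs => ->; rewrite ?normrN normr1.
apply: (hB N _ _ N_gt0 hS (adjm_A hmodel) (opb_A hmodel)).
- by rewrite cim_vert normrM s1 mul1r gtr0_norm // tpos ltW.
- apply: hsol; rewrite cim_vert mulf_neq0 ?(gt_eqF tpos) //.
  by rewrite -normr_eq0 s1 oner_eq0.
apply: (cont N _ _ M Nn hS (adjm_A hmodel) (opb_A hmodel) hsol x s hs) => [r r0|]; last first.
  by rewrite tpos.
have e4 : 0 < eps0 / 4 by rewrite divr_gt0.
have lt : eps0 / 4 < rho M x by apply: lt_le_trans hx; lra.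
have [t' [t'r ht']] := density_frequently e4 lt r0.
exists t'; split; first exact: t'r.
have -> : 2 * thr = pi * (eps0 / 4) by rewrite /thr; field.
case: hs => ->; first exact: ht'.
have im0 : cim (vert C x 1 t') != 0.
  by rewrite cim_vert mul1r gt_eqF //; case/andP: t'r.
rewrite conj_vert (habs_conj N_gt0 hmodel hM im0).
exact: ht'.
Qed.

(** The trace has a double pole at [z = w] with coefficient [- 1], and a bounded
    remainder. *)
Lemma traceV_derive : exists K t0 : R, 0 < K /\ 0 < t0 /\ exists n0 : nat,
  forall N : nat, (n0 < N)%N ->
  forall (d : measure_display) (Omega : measurableType d)
    (P : probability Omega R) (A : 'M[R]_N) (W : pair_ix N -> {RV P >-> R})
    (M : R[i] -> 'M[R[i]]_N),
  model A W p -> is_mde_M A W M ->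
  forall x y s t, eps0 / 2 <= rho M x -> eps0 / 2 <= rho M y ->
    s = 1 \/ s = -1 -> 0 < t < t0 ->
  let z : R[i] := Complex x (s * t) in
  let w : R[i] := Complex y (- (s * t)) in
  exists err : R[i], cabs err <= K /\
    is_derive (w : (R[i])^o) 1 (fun u : (R[i])^o => traceV W M z u : (R[i])^o)
      (- ((z - w) ^+ 2)^-1 + err).
Proof.
have [B [t0 [B1 [t00 [n1 hB]]]]] := bulk_vert.
have [K [K0 [n2 hK]]] := derivative_bound C c0_gt0 C2_gt0 B1.
exists K, t0; split=> //; split=> //; exists (maxn n1 n2).
move=> N; rewrite gtn_max => /andP[Nn1 Nn2] d Omega P A W M hmodel hM x y s t hx hy hs ht z w.
have N_gt0 : (0 < N)%N by apply: leq_ltn_trans Nn1.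
have hS := self_energy_covS N_gt0 hmodel.
have hA := adjm_A hmodel.
have hsol := mdesol_M hM.
have hs' : - s = 1 \/ - s = -1 by case: hs => ->; [right|left; rewrite opprK].
have zE : z = vert C x s t by rewrite vertE.
have wE : w = vert C y (- s) t by rewrite vertE mulNr.
have bz := hB N Nn1 d Omega P A W M hmodel hM x s t hx hs ht.
have bw := hB N Nn1 d Omega P A W M hmodel hM y (- s) t hy hs' ht.
rewrite -zE in bz; rewrite -wE in bw.
have tpos : 0 < t by case/andP: ht.
have st0 : s * t != 0.
  by rewrite mulf_neq0 ?(gt_eqF tpos) //; case: hs => ->; rewrite ?oppr_eq0 oner_eq0.
have zim : cim (z : C) != 0 by rewrite cimEc.
have wim : cim (w : C) != 0 by rewrite cimEc /= oppr_eq0.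
have zw_im : cim (z : C) * cim (w : C) < 0.
  by rewrite !cimEc /= mulrN oppr_lt0 -expr2 exprn_even_gt0.
have zw0 : (z : C) - w != 0.
  apply: contraTneq zw_im => /eqP; rewrite subr_eq0 => /eqP ->.
  by rewrite -leNgt -expr2 sqr_ge0.
have [L [hL cL]] := quotient_cvg C2_gt0 N_gt0 hS hA hsol zim.
have [L' [hL' cL']] := quotient_cvg C2_gt0 N_gt0 hS hA hsol wim.
have [Du q0 bd] := hK N _ _ _ _ _ _ _ _ Nn2 hS hA bz bw zw_im hL hL'.
have dML : dM M z = L.
  apply/matrixP => i j; rewrite mxE derive1E.
  exact: (@derive_val _ _ _ _ _ _ _ (entry_derive i j cL)).
have der := trace_derive hS hsol zim wim zw0 hL cL' Du q0.
eexists; split; first exact: bd.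
rewrite /traceV dML; exact: der.
Qed.

End Bulk.

(** * Replacing the spectral parameters by their real parts *)

Lemma square_ratio_le (R : realType) (C : complexField R) (a b r : R) :
  a != 0 -> 0 <= r <= 1 -> `|b| <= r * `|a| ->
  cnorm (a%:CC ^+ 2 / ((a%:CC : C) + 'i * b%:CC) ^+ 2 - 1) <= 3 * r.
Proof.
move=> a0 /andP[r0 r1] hb; set zeta := a%:CC + _.
have zeta2 : cnorm zeta ^+ 2 = a ^+ 2 + b ^+ 2.
  rewrite sqr_cnorm /zeta creD cimD cre_inj cim_real cim_i add0r.
  rewrite (_ : cre ('i * _) = 0) ?addr0 //.
  by apply/eqP; rewrite -oppr_eq0 -creN -mulNr; apply/eqP; exact: cim_real.
have zeta0 : zeta != 0.
  rewrite -cnorm_eq0 -sqrf_eq0 zeta2 gt_eqF // ltr_wpDr ?sqr_ge0 //.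
  by rewrite lt_def sqrf_eq0 a0 sqr_ge0.
have -> : a%:CC ^+ 2 / zeta ^+ 2 - 1 = (- ('i * b%:CC)) * (2 * a%:CC + 'i * b%:CC) / zeta ^+ 2.
  by rewrite {1}(_ : a%:CC = zeta - 'i * b%:CC) ?addrK // /zeta; field.
rewrite !cnormM cnormV cnormN cnormM cnorm_i mul1r cnorm_real -/zeta.
rewrite (_ : cnorm (zeta ^+ 2) = cnorm zeta ^+ 2); last by rewrite !expr2 cnormM.
rewrite zeta2 ler_pdivrMr; last first.
  by rewrite ltr_wpDr ?sqr_ge0 // lt_def sqrf_eq0 a0 sqr_ge0.
have h2 : cnorm (2 * (a%:CC : C) + 'i * b%:CC) <= 2 * `|a| + `|b|.
  apply: le_trans (cnormD _ _) _; rewrite !cnormM cnorm_i mul1r !cnorm_real.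
  by rewrite -(rmorph_nat (cinj C)) cnorm_real ger0_norm.
have : `|b| * cnorm (2 * (a%:CC : C) + 'i * b%:CC) <= `|b| * (2 * `|a| + `|b|).
  exact: ler_wpM2l.
have : a ^+ 2 = `|a| ^+ 2 by rewrite real_normK ?num_real.
have := normr_ge0 a; have := normr_ge0 b; have := sqr_ge0 b.
move: (cnorm _) (a ^+ 2) (b ^+ 2) `|a| `|b| hb => c a2 b2 na nb hb b20 nb0 na0 -> h.
apply: le_trans h _.
have h1 : nb <= na by apply: le_trans hb (ler_piMl na0 r1).
have h3 := ler_wpM2r na0 hb; have h4 := ler_wpM2l nb0 h1; have h5 := mulr_ge0 r0 b20.
by rewrite expr2; lra.
Qed.

Lemma eventually_small (R : realType) (delta e : R) : 0 < delta -> 0 < e ->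
  exists n0 : nat, forall N, (n0 <= N)%N -> (N%:R `^ delta)^-1 <= e.
Proof.
move=> d0 e0; exists (Num.bound (e^-1 `^ delta^-1)) => N hN.
have ei : 0 < e^-1 by rewrite invr_gt0.
have h : e^-1 `^ delta^-1 <= N%:R.
  apply: ltW; apply: lt_le_trans (archi_boundP (powR_ge0 _ _)) _.
  by rewrite ler_nat.
rewrite -[leRHS]invrK lef_pV2 ?posrE //; last first.
  by apply: powR_gt0; apply: lt_le_trans h; apply: powR_gt0.
have := @ge0_ler_powR R delta (ltW d0) (e^-1 `^ delta^-1) N%:R.
rewrite !nnegrE powR_ge0 ler0n => /(_ isT isT h).
by rewrite -powRrM mulVf ?powRr1 // ?gt_eqF ?(ltW ei).
Qed.

Lemma eventually_pow_small (R : realType) (e : R) (k : nat) : 0 < e ->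
  exists n0 : nat, forall N, (n0 <= N)%N -> 0 < (N%:R : R) ^- k.+1 < e.
Proof.
move=> e0; exists (Num.bound (e^-1)).+1 => N hN.
have N1 : 1 <= N%:R :> R by rewrite ler1n; apply: leq_trans hN.
have N0 : 0 < N%:R :> R by apply: lt_le_trans N1.
rewrite invr_gt0 exprn_gt0 //= -[ltRHS]invrK ltf_pV2 ?posrE ?exprn_gt0 ?invr_gt0 //.
apply: (@lt_le_trans _ _ N%:R); last by rewrite exprS ler_peMr ?exprn_ege1 // ltW.
apply: lt_trans (archi_boundP _) _; first by rewrite invr_ge0 ltW.
by rewrite ltr_nat.
Qed.

Lemma divide_out (F : fieldType) (u Z e : F) : u != 0 ->
  - (u ^+ 2)^-1 * (1 + (u ^+ 2 * Z - 1 - u ^+ 2 * e)) = - Z + e.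
Proof. by move=> u0; field. Qed.

Theorem proposition5p2 (R : realType) (p : model_params R)
    (eps0 beta_s eps_s K : R) :
  0 < eps0 < 1 / 2 -> 0 < beta_s -> 0 < eps_s < 1 / 3 -> 0 < K ->
  exists C : R, 0 < C /\
  forall E0 eps_hat delta : R,
  0 < eps_hat < beta_s / 3 -> 0 < delta < 1 ->
  exists N0 : nat, forall N : nat, (N0 <= N)%N ->
  forall (d : measure_display) (Omega : measurableType d)
    (P : probability Omega R) (A : 'M[R]_N) (W : pair_ix N -> {RV P >-> R})
    (M : R[i] -> 'M[R[i]]_N),
  model A W p ->
  is_mde_M A W M ->
  stability_thresholds W M eps0 beta_s eps_s K ->
  eps0 <= rho M E0 ->
  [set` `[E0 - eps_hat, E0 + eps_hat]] `<=` [set E | eps0 / 2 <= rho M E] ->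
  let eta_s : R := N%:R ^- 100 in
  forall x y : R,
  x \in `[E0 - eps_hat, E0 + eps_hat] -> y \in `[E0 - eps_hat, E0 + eps_hat] ->
  N%:R `^ delta * eta_s <= `|x - y| ->
  forall sgn : R, sgn = 1 \/ sgn = - 1 ->
  let z : R[i] := Complex x (sgn * eta_s) in
  let w : R[i] := Complex y (- (sgn * eta_s)) in
  exists theta : R[i], cabs theta <= C * eps_hat /\
    is_derive (w : (R[i])^o) 1 (fun u : (R[i])^o => traceV W M z u : (R[i])^o)
      (- ((x - y) ^- 2)%:C * (1 + theta)).
Proof.
move=> /andP[eps0_gt0 _] beta0 _ _.
have [K1 [t0 [K10 [t00 [n1 hK]]]]] := traceV_derive p eps0_gt0.
(* The relative error has two parts: the effect of replacing [z - w] by [x - y],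
   which is at most [eps_hat] for large [N], and the bounded part of the
   derivative times [(x - y) ^+ 2 <= 4 * eps_hat ^+ 2]. *)
exists (1 + 2 * beta_s * K1); split; first by posr.
move=> E0 eh delta /andP[eh0 eh1] /andP[d0 _].
have e6 : 0 < Num.min 1 eh / 6 by rewrite divr_gt0 // lt_min ltr01.
have [n2 hn2] := eventually_small d0 e6.
have [n3 hn3] := @eventually_pow_small R t0 99 t00.
exists (maxn n1.+1 (maxn n2 n3)) => N; rewrite !geq_max => /and3P[Nn1 /hn2 small /hn3 eta_bd].
move=> d Omega P A W M hmodel hM _ _ sub eta_s x y hx hy hxy s hs z w.
have [err [err_le der]] := hK N Nn1 d Omega P A W M hmodel hM x y s eta_s
  (sub x hx) (sub y hy) hs eta_bd.
have eta0 : 0 < eta_s by case/andP: eta_bd.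
rewrite -/z -/w in der.
move: {eta_bd} eta_s eta0 hxy @z @w der => eta_s eta0 hxy z w der.
set a := x - y in hxy *; set b := 2 * (s * eta_s).
(* [b] is the imaginary part of [z - w]; its size relative to [a] is at most
   [r]. *)
set r := 2 * (N%:R `^ delta)^-1.
have Nd : 0 < N%:R `^ delta by rewrite powR_gt0 // ltr0n; apply: leq_trans Nn1.
have a0 : a != 0.
  by rewrite -normr_gt0; apply: lt_le_trans hxy; rewrite mulr_gt0.
have s1 : `|s| = 1 by case: hs => ->; rewrite ?normrN normr1.
have br : `|b| <= r * `|a|.
  have -> : `|b| = 2 * eta_s by rewrite /b !normrM s1 mul1r !gtr0_norm.
  by rewrite /r -[leRHS]mulrA ler_pM2l // ler_pdivlMl.
have [r1 r2] : r <= 1 /\ 3 * r <= eh.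
  move: small; rewrite ler_pdivlMr // le_min /r => /andP[]; split; lra.
have r0 : 0 <= r by rewrite /r mulr_ge0 // invr_ge0 ltW.
have aeh : `|a| <= 2 * eh.
  move: hx hy; rewrite !in_itv /= => /andP[? ?] /andP[? ?].
  by rewrite ler_norml /a; apply/andP; split; lra.
pose C := complexR R.
have zw : z - w = cinj C a + 'i * cinj C b :> C.
  by rewrite [LHS](crect (z - w : C)) cimEc /= opprK /b mulr_natl mulr2n.
have := @square_ratio_le R C a b r a0 _ br; rewrite r0 r1 => /(_ isT) ratio.
pose theta : C := cinj C a ^+ 2 / (cinj C a + 'i * cinj C b) ^+ 2 - 1 - cinj C (a ^+ 2) * err.
exists theta; split.
  rewrite cabsE /theta; apply: le_trans (cnormD _ _) _.
  rewrite cnormN cnormM cnorm_real ger0_norm ?sqr_ge0 // mulrDl mul1r.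
  apply: lerD; first exact: le_trans ratio r2.
  have a2 : a ^+ 2 <= 2 * beta_s * eh.
    rewrite -real_normK ?num_real //; have := normr_ge0 a; nra.
  by rewrite [leRHS]mulrAC; apply: ler_pM; rewrite ?sqr_ge0 ?cnorm_ge0.
rewrite (_ : _ * _ = - ((z - w) ^+ 2)^-1 + err); first exact: der.
have ca0 : cinj C a != 0 by rewrite -(rmorph0 (cinj C)) (inj_eq (@cinj_inj _ C)).
rewrite zw /theta; have -> : (a ^- 2)%:C = (cinj C a ^+ 2)^-1 :> C by rewrite -rmorphXn -fmorphV.
rewrite [cinj C (a ^+ 2)]rmorphXn /=; 
exact: divide_out.
Qed.
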